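(* For $\lambda>0$ let $\mathcal P_\lambda$ be the homogeneous Poisson point process of rate $\lambda$ in the Clifford torus $T^2\subset\mathbb E^4$, and let $f_1$ and $f_2$ be the numbers of $1$-faces and $2$-faces of $\mathrm{conv}\,\mathcal P_\lambda$. Then $\mathsf E\, f_1 = O^*(\lambda\ln\lambda)$ and $\mathsf E\, f_2 = O^*(\lambda\ln\lambda)$ as $\lambda\to\infty$.
   Context: The Clifford torus is $T^2=\{(\cos\phi,\sin\phi,\cos\psi,\sin\psi):-\pi<\phi,\psi\le\pi\}\subset\mathbb E^4$, with its natural (locally Euclidean, flat) Borel area measure $mes_2$, $mes_2(T^2)=4\pi^2$. The homogeneous Poisson point process $\mathcal P_\lambda$ of rate $\lambda>0$ is the random point set in $T^2$ such that for every Borel set $A\subset T^2$ the random variable $n(A)=|\mathcal P_\lambda\cap A|$ has the Poisson distribution with parameter $\lambda\, mes_2(A)$ (the standard Poisson point process with intensity measure $\lambda\, mes_2$). A polytope in $\mathbb E^4$ is called generic if it is a simplicial 4-polytope, or a simplex of dimension at most 3, or empty; $\mathrm{conv}\,\mathcal P_\lambda$ is almost surely generic. The $f$-vector $(f_0,f_1,f_2,f_3)$ of a 4-polytope has $f_i$ equal to the number of $i$-faces. By convention the $f$-vector of a 3-dimensional simplex is $(4,6,4,2)$, of a 2-dimensional simplex $(3,3,1,0)$, of a segment $(2,1,0,0)$, of a point $(1,0,0,0)$, and of the empty polytope $(0,0,0,0)$. All $f_i$ refer to the random polytope $\mathrm{conv}\,\mathcal P_\lambda$. For functions $F_1,F_2$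 of $\lambda$, $F_1=O^*(F_2)$ means $\limsup_{\lambda\to\infty}\max\left(\left|\frac{F_1}{F_2}\right|,\left|\frac{F_2}{F_1}\right|\right)<\infty$. *)

(* Defs.v *)
From HB Require Import structures.
From mathcomp Require Import all_boot all_order all_algebra.
From mathcomp Require Import finmap.
From mathcomp Require Import all_classical all_reals all_analysis.
Set Implicit Arguments.
Unset Strict Implicit.
Unset Printing Implicit Defensive.
Import Order.TTheory GRing.Theory Num.Theory.
Import numFieldNormedType.Exports.
Local Open Scope classical_set_scope.
Local Open Scope ring_scope.

Definition angle_square (R : realType) : set (R * R) :=
  `]- pi, pi]%classic `*` `]- pi, pi]%classic.

Definition clifford_param (R : realType) (p : R * R) : 'rV[R]_4 :=
  \row_(i < 4) [:: cos p.1; sin p.1; cos p.2; sin p.2]`_i.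

Definition clifford_torus (R : realType) : set 'rV[R]_4 :=
  @clifford_param R @` @angle_square R.

(* The parametrization by the two angles is a bijection from the square onto
   the torus and a local isometry, so the flat area measure is the image of
   the planar Lebesgue measure on the square. *)
Definition mes2 (R : realType) (A : set 'rV[R]_4) : \bar R :=
  ((@lebesgue_measure R) \x (@lebesgue_measure R))%E
    (@angle_square R `&` @clifford_param R @^-1` A).

(* The topology of 'rV[R]_4 (sup norm) is the Euclidean one. *)
Definition borel (R : realType) : set (set 'rV[R]_4) :=
  <<s [set U : set 'rV[R]_4 | open U] >>.

Definition npoints (R : realType) (X : {fset 'rV[R]_4}) (A : set 'rV[R]_4) :
  nat := #|` [fset x in X | x \in A]%fset|.

(* In [poisson_prob rate k U] the argument [k] is unused; for rate 0 this is
   the Dirac mass at 0, as it should be. *)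
Definition poisson_point_process (R : realType) (d : measure_display)
    (Omega : measurableType d) (P : probability Omega R) (lambda : R)
    (X : Omega -> {fset 'rV[R]_4}) : Prop :=
  [/\ forall w, [set` X w] `<=` @clifford_torus R,
      forall A, borel A -> A `<=` @clifford_torus R ->
        measurable_fun setT (fun w => npoints (X w) A),
      forall A, borel A -> A `<=` @clifford_torus R -> forall U : set nat,
        P [set w | U (npoints (X w) A)] =
        poisson_prob (lambda * fine (mes2 A)) 0%N U
    & forall (m : nat) (A : 'I_m -> set 'rV[R]_4),
        (forall i, borel (A i) /\ A i `<=` @clifford_torus R) ->
        trivIset setT A -> forall k : 'I_m -> nat,
        P [set w | forall i, npoints (X w) (A i) = k i] =
        (\prod_(i < m) P [set w | npoints (X w) (A i) = k i])%E].

Definition convex_hull (R : realType) (S : set 'rV[R]_4) : set 'rV[R]_4 :=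
  smallest (@convex_set R 'rV[R]_4) S.

Definition dotp (R : realType) (u v : 'rV[R]_4) : R :=
  \sum_(i < 4) u 0 i * v 0 i.

(* Faces of a polytope cut out by valid linear inequalities; the cases a = 0
   give K itself and the empty face. *)
Definition face (R : realType) (K F : set 'rV[R]_4) : Prop :=
  exists (a : 'rV[R]_4) (b : R),
    (forall x, K x -> dotp a x <= b) /\ F = K `&` [set x | dotp a x = b].

Definition flat (R : realType) (x : 'rV[R]_4) (V : {vspace 'rV[R]_4}) :
  set 'rV[R]_4 := [set x + v | v in [set` V]].

Definition affine_hull (R : realType) (S : set 'rV[R]_4) : set 'rV[R]_4 :=
  smallest [set L | exists x V, L = flat x V] S.

(* The empty set has no dimension in nat, hence is never counted as a face. *)
Definition has_dim (R : realType) (S : set 'rV[R]_4) (i : nat) : Prop :=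
  exists (x : 'rV[R]_4) (V : {vspace 'rV[R]_4}),
    affine_hull S = flat x V /\ (\dim V = i)%N.

(* The number f_i of i-dimensional faces of the convex hull of X. The polytope
   is a face of itself; for i <= 2 this gives the convention that a triangle
   has f-vector (3,3,1,0), a segment (2,1,0,0) and a point (1,0,0,0), and it
   is immaterial for a 4-polytope. Only f_3 of a tetrahedron, which is 2 by
   convention, would require a special case. *)
Definition nfaces (R : realType) (i : nat) (X : {fset 'rV[R]_4}) : nat :=
  #|` fset_set [set F | face (convex_hull [set` X]) F /\ has_dim F i]|.

(* F1 = O^*(F2) at +oo. In \bar R one has 0^-1 = +oo and (+oo)^-1 = 0, so
   zero or infinite values of one of the functions are not hidden. *)
Definition O_star (R : realType) (F1 F2 : R -> \bar R) : Prop :=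
  (limf_esup
    (fun l : R => maxe `|F1 l * (F2 l)^-1| `|F2 l * (F1 l)^-1|)
    (pinfty_nbhs R) < +oo)%E.

(* Main.v *)
Require Import Defs.
From mathcomp Require Import all_boot all_order all_algebra.
From mathcomp Require Import finmap.
From mathcomp Require Import all_classical all_reals all_analysis.
From mathcomp Require Import measurable_realfun ring lra zify.
Set Implicit Arguments.
Unset Strict Implicit.
Unset Printing Implicit Defensive.
Import Order.TTheory GRing.Theory Num.Theory.
Import numFieldNormedType.Exports.
Local Open Scope classical_set_scope.
Local Open Scope ring_scope.

(* A half-space meets the torus in a cap g(phi) + h(psi) >= b, with g and h
   sinusoidal. If x and y lie on the boundary of a cap without points of the
   process in its interior, then one of the two other corners of their angular
   rectangle lies in the cap, and a rectangle with sides half as long starts at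
   that corner and stays in the cap. Hence a pair at angular distances (s, t)
   spans an edge with probability at most of order exp(- lambda s t / 4), and the
   integral of lambda^2 exp(- c lambda s t) is of order lambda ln lambda. Among
   three points spanning a 2-face some pair realizes both angular extents up to
   a factor 2, so the third point costs a factor lambda s t, which the
   exponential absorbs. Conversely an axis-parallel ellipse through x and y
   gives a cap supporting the edge xy, and a one-parameter family of such
   ellipses also reaches a third point z; if the box around them is otherwise
   empty, xy and xyz are faces.

   Only events fixing the number of points in finitely many cells of a square
   grid are used. For the upper bound the mesh tends to 0 with lambda fixed
   (Fatou), so that eventually every cell contains at most one point. *)

(** * Faces of the convex hull *)

(** The logarithm reflects a scale invariance: the cost of a pair depends only on the product [s t],
    and rectangles of area about [1 / lambda] occur in all shapes, with sides from order
    [1 / lambda] to order 1. Hence the unit of length in both halves is about [1 / lambda]: blocks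
    of side [2 pi / M.+1] in the upper bound, and a mesh [2 pi / (1000 L)] in the lower bound, with
    [M.+1] and [L] between [lambda] and [lambda + 1]. Faces are labelled by affinely independent
    points of the process lying on them. A label recovers its face as the hull met with an affine
    span, so faces carrying further points are covered as well. In the lower bound a single family
    of events, three occupied cells in an otherwise empty box, serves for both [f_1] and [f_2]. An
    edge uses only two of the three cells; the third is still recovered from it because the box
    holds no other point. *)

Lemma convex_setP (R : realType) (A : set 'rV[R]_4) :
  (forall (x y : 'rV[R]_4) (t : R), A x -> A y -> 0 < t < 1 ->
     A (t *: x + (1 - t) *: y)) ->
  convex_set (A : set (convex_lmodType _)).
Proof.
move=> cA; apply/convex_setW => x y; rewrite !inE => Ax Ay t t0 t1.
by rewrite inE; apply: cA => //; rewrite t0.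
Qed.

Lemma flatP (R : realType) (x y : 'rV[R]_4) (V : {vspace 'rV[R]_4}) :
  flat x V y <-> y - x \in V.
Proof.
split; first by move=> [v /= vV <-]; rewrite addrC addKr.
by move=> yV; exists (y - x) => //=; rewrite addrC subrK.
Qed.

Lemma flat_sub (R : realType) (x y : 'rV[R]_4) (V W : {vspace 'rV[R]_4}) :
  flat x V `<=` flat y W -> (V <= W)%VS.
Proof.
move=> s; apply/subvP => v vV.
have /flatP : flat y W (x + v) by apply/s/flatP; rewrite addrC addKr.
have /flatP : flat y W x by apply/s/flatP; rewrite subrr mem0v.
by move=> xW vW; have := rpredB vW xW; rewrite opprB addrA subrK addrC addKr.
Qed.

Lemma flat_convex (R : realType) (x y z : 'rV[R]_4) (V : {vspace 'rV[R]_4})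
  (t : R) : flat x V y -> flat x V z -> flat x V (t *: y + (1 - t) *: z).
Proof.
move=> /flatP yV /flatP zV; apply/flatP.
have -> : t *: y + (1 - t) *: z - x = t *: (y - x) + (1 - t) *: (z - x).
  by apply/rowP => i; rewrite !mxE; ring.
by apply: rpredD; apply: rpredZ.
Qed.

Lemma dotpD (R : realType) (a x y : 'rV[R]_4) :
  dotp a (x + y) = dotp a x + dotp a y.
Proof.
by rewrite /dotp -big_split; apply: eq_bigr => i _; rewrite mxE mulrDr.
Qed.

Lemma dotpZ (R : realType) (a x : 'rV[R]_4) t : dotp a (t *: x) = t * dotp a x.
Proof.
by rewrite /dotp big_distrr; apply: eq_bigr => i _; rewrite mxE mulrCA.
Qed.

Lemma dotpB (R : realType) (a x y : 'rV[R]_4) :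
  dotp a (x - y) = dotp a x - dotp a y.
Proof. by rewrite dotpD -scaleN1r dotpZ mulN1r. Qed.

Lemma dot0p (R : realType) (x : 'rV[R]_4) : dotp 0 x = 0.
Proof. by rewrite /dotp big1 // => i _; rewrite mxE mul0r. Qed.

Lemma sub_convex_hull (R : realType) (S : set 'rV[R]_4) :
  S `<=` convex_hull S.
Proof. exact: sub_gen_smallest. Qed.

(* The points [p] of the hull with [dotp a p <= b], and lying in [L] in case of
   equality, form a convex set containing [S]. *)
Lemma face_sub_convex (R : realType) (S L : set 'rV[R]_4) (a : 'rV[R]_4) b :
  (forall x y t, L x -> L y -> 0 < t < 1 -> L (t *: x + (1 - t) *: y)) ->
  (forall x, S x -> dotp a x <= b) ->
  (forall x, S x -> dotp a x = b -> L x) ->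
  forall x, convex_hull S x -> dotp a x = b -> L x.
Proof.
move=> cL Sb SL x Kx.
suff [] : dotp a x <= b /\ (dotp a x = b -> L x) by [].
move: x Kx; apply: smallest_sub; last by move=> x Sx; split; [apply: Sb|apply: SL].
apply: convex_setP => y z t [yb yL] [zb zL] /[dup] t01 /andP[t0 t1] /=.
rewrite dotpD !dotpZ; split; first by nra.
move=> e; apply: cL => //; [apply: yL|apply: zL]; nra.
Qed.

Lemma convex_hull_le (R : realType) (S : set 'rV[R]_4) (a : 'rV[R]_4) b :
  (forall x, S x -> dotp a x <= b) -> forall x, convex_hull S x -> dotp a x <= b.
Proof.
move=> Sb; apply: smallest_sub => //.
apply: convex_setP => y z t /= yb zb /andP[t0 t1].
by rewrite dotpD !dotpZ; nra.
Qed.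

Lemma face_sub_flat (R : realType) (S F : set 'rV[R]_4) x V :
  face (convex_hull S) F -> F `&` S `<=` flat x V -> F `<=` flat x V.
Proof.
move=> [a [b [Kb ->]]] s y [Ky /= yb].
apply: (@face_sub_convex _ S (flat x V) a b) => //.
- by move=> p q t hp hq _; exact: flat_convex.
- by move=> z Sz; apply: Kb; exact: sub_convex_hull.
- by move=> z Sz zb; apply: s; split => //; split => //; apply: sub_convex_hull.
Qed.

(** Lets the dimension of a face be read off from the points of [S] on it. *)
Lemma face_affine_hull (R : realType) (S F : set 'rV[R]_4) :
  face (convex_hull S) F -> affine_hull F = affine_hull (F `&` S).
Proof.
move=> fF; apply/seteqP; split => y Fy L [Lf sL]; apply: Fy; split => //.
  by move: Lf sL => [x [V ->]]; apply: face_sub_flat.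
by move=> z [Fz _]; apply: sL.
Qed.

(** Used in both directions: a face is determined by its points in [S], which is what makes the
    faces of a finite set finite in number. *)
Lemma face_inj (R : realType) (S F F' : set 'rV[R]_4) :
  face (convex_hull S) F -> face (convex_hull S) F' ->
  F `&` S `<=` F' -> F `<=` F'.
Proof.
move=> [a [b [Kb ->]]] [a' [b' [Kb' ->]]] s y [Ky /= yb]; split => //.
apply: (@face_sub_convex _ S [set p | dotp a' p = b'] a b) => //=.
- by move=> p q t e1 e2 _; rewrite dotpD !dotpZ e1 e2; ring.
- by move=> z Sz; apply: Kb; exact: sub_convex_hull.
- by move=> z Sz zb; apply: (s z _).2; split => //; split => //; apply: sub_convex_hull.
Qed.

Lemma affine_hull2 (R : realType) (x y : 'rV[R]_4) :
  affine_hull [set x; y] = flat x <[y - x]>%VS.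
Proof.
apply/seteqP; split => [|z /flatP /vlineP[k e] L [[p [V ->]] s]].
  apply: smallest_sub; first by exists x, <[y - x]>%VS.
  by move=> z [->|->]; apply/flatP; rewrite ?subrr ?mem0v ?memv_line.
have /flatP xV := s x (or_introl erefl).
have /flatP yV := s y (or_intror erefl).
apply/flatP; have -> : z - p = k *: ((y - p) - (x - p)) + (x - p).
  by rewrite -[LHS](subrK x) [_ - p - x]addrAC e; apply/rowP => i; rewrite !mxE; ring.
by apply: rpredD => //; apply/rpredZ/rpredB.
Qed.

Lemma affine_hull3 (R : realType) (x y z : 'rV[R]_4) :
  affine_hull [set x; y; z] = flat x (<[y - x]> + <[z - x]>)%VS.
Proof.
apply/seteqP; split => [|w /flatP /memv_addP[_ /vlineP[k ->] [_ /vlineP[l ->] e]] L [[p [V ->]] s]].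
  apply: smallest_sub; first by exists x, (<[y - x]> + <[z - x]>)%VS.
  move=> w [[->|->]|->]; apply/flatP; rewrite ?subrr ?mem0v //.
    by rewrite (subvP (addvSl _ _)) ?memv_line.
  by rewrite (subvP (addvSr _ _)) ?memv_line.
have /flatP xV := s x (or_introl (or_introl erefl)).
have /flatP yV := s y (or_introl (or_intror erefl)).
have /flatP zV := s z (or_intror erefl).
apply/flatP.
have -> : w - p = k *: ((y - p) - (x - p)) + l *: ((z - p) - (x - p)) + (x - p).
  rewrite -[LHS](subrK x) [_ - p - x]addrAC e; apply/rowP => i.
  by rewrite !mxE; ring.
by apply: rpredD => //; apply: rpredD; apply/rpredZ/rpredB.
Qed.

Lemma dim_affine_hull2 (R : realType) (x y : 'rV[R]_4) :
  x != y -> \dim <[y - x]>%VS = 1%N.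
Proof. by move=> xy; rewrite dim_vline subr_eq0 eq_sym xy. Qed.

Lemma dim_affine_hull3 (R : realType) (x y z : 'rV[R]_4) :
  x != y -> z - x \notin <[y - x]>%VS ->
  \dim (<[y - x]> + <[z - x]>)%VS = 2%N.
Proof.
move=> xy zN; rewrite dimv_disjoint_sum ?(dim_affine_hull2 xy)//.
  by rewrite dim_vline; case: eqVneq zN => // ->; rewrite mem0v.
apply/eqP; rewrite -subv0; apply/subvP => w /memv_capP[/vlineP[k ->] /vlineP[l e]].
rewrite memv0; have [l0|l0] := eqVneq l 0; first by rewrite e l0 scale0r.
case/negP: zN; apply/vlineP; exists (l^-1 * k).
by rewrite -scalerA e scalerA mulVf// scale1r.
Qed.

Lemma has_dim_hull (R : realType) (F : set 'rV[R]_4) x V i :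
  has_dim F i -> F `<=` flat x V -> (i <= \dim V)%N.
Proof.
move=> [p [W [e <-]]] s; apply: dimvS; apply: (@flat_sub _ p x).
by rewrite -e; apply: smallest_sub => //; exists x, V.
Qed.

Lemma flat_eq (R : realType) (x y : 'rV[R]_4) (V : {vspace 'rV[R]_4}) :
  y - x \in V -> flat x V = flat y V.
Proof.
move=> xy; apply/seteqP; split => z /flatP zV; apply/flatP.
  by have := rpredB zV xy; rewrite opprB addrA subrK.
by have := rpredD zV xy; rewrite addrA subrK.
Qed.

Lemma has_dim_affine_hull (R : realType) (F T : set 'rV[R]_4) x V :
  has_dim F (\dim V) -> T `<=` F -> T x -> affine_hull T = flat x V ->
  affine_hull F = affine_hull T.
Proof.
move=> [p [W [e dW]]] TF Tx eT.
have sT : flat x V `<=` flat p W.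
  rewrite -e -eT => y Ty L [fL FL]; apply: Ty; split => //.
  exact: subset_trans FL.
have VW : V = W by apply/eqP; rewrite eqEdim dW leqnn (flat_sub sT).
rewrite e eT -VW; apply: flat_eq; rewrite VW; apply/flatP/sT/flatP.
by rewrite subrr mem0v.
Qed.

(** The functional supporting [F] is constant on [T], hence by the last hypothesis constant on the
    whole flat spanned by [T], so this flat meets the hull only inside [F]. Conversely, equal
    dimensions force the two affine hulls to coincide. *)
Lemma face_eq_hull (R : realType) (S F T : set 'rV[R]_4) x V :
  face (convex_hull S) F -> has_dim F (\dim V) -> T `<=` F `&` S -> T x ->
  affine_hull T = flat x V ->
  (forall a b, (forall z, T z -> dotp a z = b) ->
     forall v, v \in V -> dotp a v = 0) ->
  F = convex_hull S `&` affine_hull T.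
Proof.
move=> fF dF TF Tx eT Va.
have TF' : T `<=` F by move=> y /TF[].
have e := has_dim_affine_hull dF TF' Tx eT.
apply/seteqP; split => [y Fy|y [Ky]].
  split; first by move: fF Fy => [a [b [_ ->]]] [].
  by rewrite -e => L [_]; apply.
move: fF e TF => [a [b [Kb ->]]] e TF; rewrite eT => -[v vV yE]; split => //=.
rewrite -yE.
have Tb z : T z -> dotp a z = b by move=> /TF[[]].
by rewrite dotpD (Tb x Tx) (Va a b Tb v vV) addr0.
Qed.

Lemma edge_spanned (R : realType) (S F : set 'rV[R]_4) :
  face (convex_hull S) F -> has_dim F 1 ->
  exists x y, [/\ (F `&` S) x, (F `&` S) y, x != y &
    F = convex_hull S `&` affine_hull [set x; y]].
Proof.
move=> fF dF.
(* With too few independent points of [S] on it, [F] would be confined by [face_sub_flat] to a flat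
   of dimension 0. *)
have [x FSx] : exists x, (F `&` S) x.
  apply: contrapT => /forallNP h.
  have s p : F `<=` flat p 0.
    by apply: (face_sub_flat fF) => y /h.
  by have := has_dim_hull dF (s 0); rewrite dimv0.
have [y [FSy xy]] : exists y, (F `&` S) y /\ x != y.
  apply: contrapT => /forallNP h.
  suff s : F `<=` flat x 0 by have := has_dim_hull dF s; rewrite dimv0.
  apply: (face_sub_flat fF) => y FSy; have := h y; apply: contra_notP => xy.
  split => //; apply: contra_notN xy => /eqP <-; apply/flatP.
  by rewrite subrr mem0v.
exists x, y; split => //; apply: (face_eq_hull fF _ _ _ (affine_hull2 x y)).
- by rewrite dim_affine_hull2.
- by move=> z [->|->].
- by left.
- move=> a b h v /vlineP[k ->].
  by rewrite dotpZ dotpB (h x (or_introl _)) ?(h y (or_intror _))// subrr mulr0.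
Qed.

Lemma ridge_spanned (R : realType) (S F : set 'rV[R]_4) :
  face (convex_hull S) F -> has_dim F 2 ->
  exists x y z, [/\ (F `&` S) x, (F `&` S) y, (F `&` S) z, uniq [:: x; y; z] &
    F = convex_hull S `&` affine_hull [set x; y; z]].
Proof.
move=> fF dF.
have [x FSx] : exists x, (F `&` S) x.
  apply: contrapT => /forallNP h.
  have s p : F `<=` flat p 0.
    by apply: (face_sub_flat fF) => y /h.
  by have := has_dim_hull dF (s 0); rewrite dimv0.
have [y [FSy xy]] : exists y, (F `&` S) y /\ x != y.
  apply: contrapT => /forallNP h.
  suff s : F `<=` flat x 0 by have := has_dim_hull dF s; rewrite dimv0.
  apply: (face_sub_flat fF) => y FSy; have := h y; apply: contra_notP => xy.
  split => //; apply: contra_notN xy => /eqP <-; apply/flatP.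
  by rewrite subrr mem0v.
have [z [FSz zN]] : exists z, (F `&` S) z /\ z - x \notin <[y - x]>%VS.
  apply: contrapT => /forallNP h.
  suff s : F `<=` flat x <[y - x]>%VS.
    by have := has_dim_hull dF s; rewrite dim_affine_hull2.
  apply: (face_sub_flat fF) => z FSz; have := h z; apply: contra_notP => zN.
  by split => //; apply: contra_notN zN => /flatP.
exists x, y, z; split => //.
  rewrite /= !inE negb_or xy /= !andbT; apply/andP; split.
    by apply: contraNneq zN => <-; rewrite subrr mem0v.
  by apply: contraNneq zN => <-; rewrite memv_line.
apply: (face_eq_hull fF _ _ _ (affine_hull3 x y z)).
- by rewrite dim_affine_hull3.
- by move=> w [[->|->]|->].
- by left; left.
- move=> a b h v /memv_addP[_ /vlineP[k ->] [_ /vlineP[l ->] ->]].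
  rewrite dotpD !dotpZ !dotpB (h x (or_introl (or_introl _)))//.
  rewrite (h y (or_introl (or_intror _)))// (h z (or_intror _))//.
  by rewrite subrr !mulr0 addr0.
Qed.

Lemma face_edge (R : realType) (S F : set 'rV[R]_4) x y :
  face (convex_hull S) F -> F `&` S = [set x; y] -> x != y -> has_dim F 1.
Proof.
move=> fF e xy; exists x, <[y - x]>%VS; split; last exact: dim_affine_hull2.
by rewrite (face_affine_hull fF) e affine_hull2.
Qed.

(** A functional constant on [x] and [y] but different at [z] certifies affine independence; in the
    lower bound it comes from the cap that supports the edge [xy]. *)
Lemma face_triangle (R : realType) (S F : set 'rV[R]_4) x y z a b :
  face (convex_hull S) F -> F `&` S = [set x; y; z] -> x != y ->
  dotp a x = b -> dotp a y = b -> dotp a z != b -> has_dim F 2.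
Proof.
move=> fF e xy ax ay az; exists x, (<[y - x]> + <[z - x]>)%VS; split.
  by rewrite (face_affine_hull fF) e affine_hull3.
apply: dim_affine_hull3 => //; apply: contraNN az => /vlineP[k /(congr1 (dotp a))].
by rewrite dotpZ !dotpB ax ay subrr mulr0 => /eqP; rewrite subr_eq0.
Qed.

Lemma finite_faces (R : realType) (X : {fset 'rV[R]_4}) :
  finite_set [set F | face (convex_hull [set` X]) F].
Proof.
(* [g] recovers a face from the subset of [X] on it, so all faces lie in the image of the finite
   powerset of [X]. *)
pose g (Y : {fset 'rV[R]_4}) := xget set0
  [set F | face (convex_hull [set` X]) F /\ F `&` [set` X] = [set` Y]].
apply: (@sub_finite_set _ _ (g @` [set` fpowerset X])); last first.
  exact/finite_image/finite_fset.
move=> F /= fF; exists [fset x in X | x \in F]%fset.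
  by rewrite /= fpowersetE; apply/fsubsetP => x; rewrite !inE => /andP[].
have e : F `&` [set` X] = [set` [fset x in X | x \in F]%fset].
  apply/seteqP; split => x /=; rewrite !inE.
    by move=> [Fx ->]; rewrite /= inE.
  by move=> /andP[-> /set_mem].
rewrite /g; case: xgetP => [G _ [fG eG]|/(_ F) /=]; last by case.
have sG : G `&` [set` X] = F `&` [set` X] by rewrite eG e.
apply/seteqP; split; [apply: (face_inj fG fF)|apply: (face_inj fF fG)].
  by rewrite sG => x [].
by rewrite -sG => x [].
Qed.

(** The successor accounts for the hull itself, which is a face of itself and may have dimension
    [i]; only the other faces have a nonzero supporting functional. *)
Lemma nfaces_le (R : realType) (X : {fset 'rV[R]_4}) i (I : finType)
    (Q : pred I) (r : I -> set 'rV[R]_4) :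
  (forall F, face (convex_hull [set` X]) F -> has_dim F i ->
     F <> convex_hull [set` X] -> exists2 j, Q j & r j = F) ->
  (nfaces i X <= #|Q|.+1)%N.
Proof.
move=> h; rewrite /nfaces.
pose T := (convex_hull [set` X] |` [fset r j | j in Q])%fset.
apply: (@leq_trans #|` T|).
  apply: fsubset_leq_card; apply/fsubsetP => F; rewrite in_fset_set; last first.
    by apply: sub_finite_set (finite_faces X) => F' [].
  rewrite inE => -[fF dF]; rewrite !inE; have [->//|/eqP FK /=] := eqVneq.
  by have [j Qj <-] := h F fF dF FK; apply/imfsetP; exists j.
rewrite cardfsU1 -(add1n #|Q|); apply: leq_add; first exact: leq_b1.
by rewrite (leq_trans (leq_imfset_card _ _ _))// cardE.
Qed.

Lemma nfaces_ge (R : realType) (X : {fset 'rV[R]_4}) i (I : finType)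
    (Q : pred I) (r : I -> set 'rV[R]_4) :
  (forall j, Q j -> face (convex_hull [set` X]) (r j) /\ has_dim (r j) i) ->
  {in Q &, injective r} -> (#|Q| <= nfaces i X)%N.
Proof.
move=> h inj; rewrite /nfaces.
have <- : #|` [fset r j | j in Q]%fset| = #|Q|.
  by rewrite card_in_imfset// cardE.
apply: fsubset_leq_card; apply/fsubsetP => F /imfsetP[j Qj ->].
rewrite in_fset_set; first by rewrite inE; apply: h.
by apply: sub_finite_set (finite_faces X) => F' [].
Qed.

(** * Caps of the Clifford torus *)

Lemma dotp4 (R : realType) (a x : 'rV[R]_4) :
  dotp a x = a 0 0 * x 0 0 + a 0 1 * x 0 1 + a 0 (inord 2) * x 0 (inord 2)
    + a 0 (inord 3) * x 0 (inord 3).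
Proof.
rewrite /dotp 4!big_ord_recl big_ord0 addr0 !addrA.
by do ![congr (_ + _)|congr (_ * _)|congr (_ _ _)]; apply: val_inj;
  rewrite /= ?inordK.
Qed.

Lemma dotp_clifford (R : realType) (a : 'rV[R]_4) p :
  dotp a (clifford_param p) = (a 0 0 * cos p.1 + a 0 1 * sin p.1)
    + (a 0 (inord 2) * cos p.2 + a 0 (inord 3) * sin p.2).
Proof. by rewrite dotp4 !mxE /= !inordK //= addrA. Qed.

(** Taking [B] in absolute value puts the angle in [[0, pi]], where the cosine is monotone; the sign
    of [B] becomes a direction of motion in [half_arc0]. *)
Lemma polar_form (R : realType) (A B : R) : (A != 0) || (B != 0) ->
  exists r t, [/\ 0 < r, 0 <= t <= pi, A = r * cos t & `|B| = r * sin t].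
Proof.
move=> AB; pose r := Num.sqrt (A ^+ 2 + B ^+ 2).
have r2 : r ^+ 2 = A ^+ 2 + B ^+ 2 by rewrite sqr_sqrtr// addr_ge0 ?sqr_ge0.
have r0 : 0 < r.
  by rewrite sqrtr_gt0; case/orP: AB => h;
    [apply: ltr_pwDl|apply: ltr_wpDl]; rewrite ?sqr_ge0// exprn_even_gt0.
have Ar : -1 <= A / r <= 1.
  rewrite -ler_norml normrM normfV (gtr0_norm r0) ler_pdivrMr// mul1r.
  by rewrite -(@ler_pXn2r _ 2)// ?nnegrE ?(ltW r0)// real_normK ?num_real// r2 lerDl sqr_ge0.
exists r, (acos (A / r)); split => //.
- by rewrite acos_ge0 ?acos_lepi.
- by rewrite acosK ?in_itv//= mulrC divfK ?gt_eqF.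
- apply/eqP; rewrite -(@eqrXn2 _ 2)//; last first.
    by rewrite mulr_ge0 ?(ltW r0)// sin_acos// sqrtr_ge0.
  rewrite exprMn sin2cos2 acosK ?in_itv//= real_normK ?num_real//.
  have -> : r ^+ 2 * (1 - (A / r) ^+ 2) = r ^+ 2 - A ^+ 2.
    by field; rewrite gt_eqF.
  by rewrite r2 addrC addKr.
Qed.

Lemma ler_cosr (R : realType) (x y : R) :
  0 <= x -> x <= y -> y <= pi -> cos y <= cos x.
Proof.
move=> x0 xy ypi; move: xy; rewrite le_eqVlt => /predU1P[->//|xy].
apply: ltW; rewrite ltr_cos// in_itv/=; apply/andP; split; lra.
Qed.

Lemma ltr_cosr (R : realType) (x y : R) :
  0 <= x -> x < y -> y <= pi -> cos y < cos x.
Proof. by move=> x0 xy ypi; rewrite ltr_cos// in_itv/=; apply/andP; split; lra. Qed.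

(* Move away from [0] towards the maximum of [A cos + B sin]: writing this
   function as [r cos (s - t)] with [s] oriented so that [0 <= t], its values at
   [0 < s < d / 2] exceed [min (r cos t) (r cos s)], and both terms are at least
   the average of the values at [0] and [d]. *)
Lemma half_arc0 (R : realType) (A B d : R) :
  (A != 0) || (B != 0) -> 0 < d <= pi -> A * cos d + B * sin d <= A ->
  exists e : bool, forall s : R, 0 < s < d / 2 ->
    A + (A * cos d + B * sin d) < 2 * (A * cos s + (-1) ^+ e * B * sin s).
Proof.
move=> AB /andP[d0 dpi] dA; exists (B < 0) => s /andP[s0 sd].
have -> : (-1) ^+ (B < 0)%R * B = `|B|.
  by rewrite -normrEsign ?num_real.
have [r [t [r0 /andP[t0 tpi] At Bt]]] := polar_form AB.
have -> : A * cos s + `|B| * sin s = r * cos (s - t).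
  by rewrite At Bt cosB; ring.
set mid := A + _; have midA : mid <= 2 * (r * cos t) by rewrite /mid -At; lra.
have cd : 0 <= cos (d / 2) by apply: cos_ge0_pihalf; apply/andP; split; lra.
(* The values at [0] and [d] add up to [2 cos (d / 2)] times the value at the midpoint, and that
   value is at most [r]. *)
have midr : mid <= 2 * (r * cos (d / 2)).
  have -> : mid = 2 * (cos (d / 2) * (A * cos (d / 2) + B * sin (d / 2))).
    have dd : d = (d / 2) *+ 2 by rewrite mulr2n; field.
    by rewrite /mid {1 2}dd cos_mulr2n sin_mulr2n !mulr2n; ring.
  rewrite ler_pM2l// [leRHS]mulrC; apply: ler_wpM2l => //.
  have BB : B * sin (d / 2) <= `|B| * sin (d / 2).
    by rewrite ler_wpM2r ?ler_norm// sin_ge0_pi//; apply/andP; split; lra.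
  apply: (le_trans (lerD (lexx _) BB)); rewrite {1}At Bt.
  rewrite -!mulrA -mulrDr ler_piMr ?(ltW r0)// -cosB.
  exact: cos_le1.
case: (leP t s) => ts.
  have c1 : cos s <= cos (s - t) by apply: ler_cosr; lra.
  have c2 : cos (d / 2) < cos s by apply: ltr_cosr; lra.
  by nra.
have c1 : cos t < cos (s - t) by rewrite -[ltRHS]cosN opprB; apply: ltr_cosr; lra.
by nra.
Qed.

Lemma half_arc (R : realType) (p q x y : R) (u := fun t => p * cos t + q * sin t) :
  (p != 0) || (q != 0) -> 0 < `|y - x| <= pi -> u y <= u x ->
  exists e : bool, forall s : R, 0 < s < `|y - x| / 2 ->
    u x + u y < 2 * u (x + (-1) ^+ e * s).
Proof.
move=> pq; set d := `|_ - _| => dpi uyx.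
pose g : R := (-1) ^+ (y < x)%R; pose A := u x.
(* [B] is the derivative of [u] at [x] in the direction of [y]: recentred at [x], the function is
   again [A cos + B sin]. *)
pose B := g * (q * cos x - p * sin x).
have g2 : g ^+ 2 = 1 by rewrite sqrr_sign.
have yE : y = x + g * d.
  rewrite /g /d; case: ltP => xy.
    by rewrite ltr0_norm ?subr_lt0//; ring.
  by rewrite ger0_norm ?subr_ge0//; ring.
have uE s : u (x + g * s) = A * cos s + B * sin s.
  rewrite /u cosD sinD /A /B /u /g; case: (y < x)%R.
    by rewrite !expr1 !mulN1r cosN sinN; ring.
  by rewrite expr0 !mul1r; ring.
have AB : (A != 0) || (B != 0).
  apply: contraLR pq; rewrite !negb_or !negbK => /andP[/eqP A0 /eqP B0].
  have : p ^+ 2 + q ^+ 2 = 0.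
    have <- : A ^+ 2 + B ^+ 2 = p ^+ 2 + q ^+ 2.
      rewrite /B exprMn g2 /A /u mul1r.
      have -> : p ^+ 2 + q ^+ 2 = (p ^+ 2 + q ^+ 2) * (cos x ^+ 2 + sin x ^+ 2).
        by rewrite cos2Dsin2 mulr1.
      by ring.
    by rewrite A0 B0 expr0n addr0.
  by move/eqP; rewrite paddr_eq0 ?sqr_ge0// !sqrf_eq0.
rewrite {1}yE uE in uyx.
have [e he] := half_arc0 AB dpi uyx.
exists (e (+) (y < x)) => s sd; rewrite signr_addb -/g -mulrA mulrCA.
rewrite uE {1}yE uE; apply: (lt_le_trans (he s sd)).
by case: e {he}; rewrite ?expr1 ?expr0 ?mulN1r ?mul1r ?cosN ?sinN; lra.
Qed.

(** Admits the zero sinusoid, which occurs when the functional depends on one angle only, at the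
    price of strictness. *)
Lemma half_arc_le (R : realType) (p q x y : R)
    (u := fun t => p * cos t + q * sin t) :
  0 < `|y - x| <= pi -> u y <= u x ->
  exists e : bool, forall s : R, 0 < s < `|y - x| / 2 ->
    u x + u y <= 2 * u (x + (-1) ^+ e * s).
Proof.
move=> d uyx; have [pq|] := boolP ((p != 0) || (q != 0)).
  by have [e he] := half_arc pq d uyx; exists e => s /he/ltW.
rewrite negb_or !negbK => /andP[/eqP p0 /eqP q0]; exists false => s _.
by rewrite /u p0 q0 !mul0r addr0 mulr0.
Qed.

(* The two other corners of the rectangle with opposite vertices [p1] and [p2]
   have mean value [b]; the one where the function is at least [b] starts the
   rectangle on which it exceeds [b]. *)
Lemma empty_rectangle (R : realType) (a : 'rV[R]_4) b (x1 x2 y1 y2 : R)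
    (f := fun x y => dotp a (clifford_param (x, y))) :
  a != 0 -> f x1 y1 = b -> f x2 y2 = b -> f x2 y1 <= f x1 y1 ->
  0 < `|x2 - x1| <= pi -> 0 < `|y2 - y1| <= pi ->
  exists e1 e2 : bool, forall s t : R,
    0 < s < `|x2 - x1| / 2 -> 0 < t < `|y2 - y1| / 2 ->
    b < f (x1 + (-1) ^+ e1 * s) (y2 + (-1) ^+ e2 * t).
Proof.
move=> a0; rewrite /f !dotp_clifford /= => f1 f2 f21 dx.
rewrite distrC => dy.
have gx : a 0 0 * cos x2 + a 0 1 * sin x2 <= a 0 0 * cos x1 + a 0 1 * sin x1.
  by move: f21; rewrite lerD2r.
have gy : a 0 (inord 2) * cos y1 + a 0 (inord 3) * sin y1 <=
    a 0 (inord 2) * cos y2 + a 0 (inord 3) * sin y2 by lra.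
(* As [a != 0], at least one of the two sinusoids is nonzero; that one supplies the strict
   inequality. *)
have [A01|A01] := boolP ((a 0 0 != 0) || (a 0 1 != 0)).
  have [e1 h1] := half_arc A01 dx gx; have [e2 h2] := half_arc_le dy gy.
  exists e1, e2 => s t /h1 {}h1 /h2 {}h2; rewrite dotp_clifford /=; lra.
have A23 : (a 0 (inord 2) != 0) || (a 0 (inord 3) != 0).
  apply: contraLR a0; move: A01; rewrite !negb_or !negbK.
  move=> /andP[/eqP A0 /eqP A1] /andP[/eqP A2 /eqP A3].
  apply/eqP/rowP => i; rewrite mxE.
  case: i => [[|[|[|[|//]]]] hi]; [rewrite -[RHS]A0|rewrite -[RHS]A1|
      rewrite -[RHS]A2|rewrite -[RHS]A3]; congr (a _ _); apply: val_inj;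
      by rewrite /= ?inordK.
have [e1 h1] := half_arc_le dx gx; have [e2 h2] := half_arc A23 dy gy.
exists e1, e2 => s t /h1 {}h1 /h2 {}h2; rewrite dotp_clifford /=; lra.
Qed.

(** * Explicit caps through two or three given points *)

Lemma sin_mean (R : realType) (x : R) :
  0 <= x -> exists2 y, 0 <= y <= x & sin x = cos y * x.
Proof.
move=> x0.
have [|y] := @MVT_segment _ (@sin R) (@cos R) 0 x x0.
  by apply: continuous_subspaceT => z; exact: continuous_sin.
by rewrite in_itv/= sin0 !subr0 => yx e; exists y.
Qed.

Lemma sin_le (R : realType) (x : R) : 0 <= x -> sin x <= x.
Proof.
by move=> x0; have [y _ ->] := sin_mean x0; have := cos_le1 y; nra.
Qed.

Lemma half_le_sin (R : realType) (x : R) : 0 <= x <= 1 -> x / 2 <= sin x.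
Proof.
move=> /andP[x0 x1]; have [y /andP[y0 yx] ->] := sin_mean x0.
have s2 : sin (y / 2) <= y / 2 by apply: sin_le; lra.
have p2 := pi_ge2 R.
have s0 : 0 <= sin (y / 2) by apply: sin_ge0_pi; apply/andP; split; lra.
have yy : y = (y / 2) *+ 2 by rewrite mulr2n; field.
have -> : cos y = 1 - 2 * sin (y / 2) ^+ 2.
  by rewrite {1}yy cos_mulr2n cos2sin2 mulr2n; ring.
nra.
Qed.

Lemma ler_sinr (R : realType) (x y : R) :
  0 <= x -> x <= y -> y <= pi - x -> sin x <= sin y.
Proof.
move=> x0 xy ypi; case: (leP y (pi / 2)) => yp.
  move: xy; rewrite le_eqVlt => /predU1P[->//|xy].
  by apply: ltW; rewrite ltr_sin// in_itv/=; apply/andP; split; lra.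
have -> : sin y = sin (pi - y) by rewrite sinB sinpi cospi; ring.
have {xy} : x <= pi - y by lra.
rewrite le_eqVlt => /predU1P[->//|xy].
by apply: ltW; rewrite ltr_sin// in_itv/=; apply/andP; split; lra.
Qed.

Lemma clifford_form (R : realType) (a1 b1 a2 b2 m1 m2 : R) :
  exists w : 'rV[R]_4, forall x y, dotp w (clifford_param (x, y)) =
    (a1 * cos (x - m1) + b1 * sin (x - m1)) +
    (a2 * cos (y - m2) + b2 * sin (y - m2)).
Proof.
exists (\row_i [:: a1 * cos m1 - b1 * sin m1; a1 * sin m1 + b1 * cos m1;
                a2 * cos m2 - b2 * sin m2; a2 * sin m2 + b2 * cos m2]`_i).
move=> x y; rewrite dotp_clifford !mxE /= !inordK//= !cosB !sinB; ring.
Qed.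

Lemma sin_half_double (R : realType) (x : R) :
  sin x = 2 * sin (x / 2) * cos (x / 2).
Proof.
have {1}-> : x = (x / 2) *+ 2 by rewrite mulr2n; field.
by rewrite sin_mulr2n mulr2n; ring.
Qed.

Lemma cos_half_double (R : realType) (x : R) :
  cos x = 1 - 2 * sin (x / 2) ^+ 2.
Proof.
have {1}-> : x = (x / 2) *+ 2 by rewrite mulr2n; field.
by rewrite cos_mulr2n cos2sin2 mulr2n; ring.
Qed.

Lemma small_cos (R : realType) (x : R) : 0 <= x <= 1 -> 1 / 2 <= cos x.
Proof.
move=> /andP[x0 x1]; rewrite cos_half_double.
have s2 : sin (x / 2) <= x / 2 by apply: sin_le; lra.
have p2 := pi_ge2 R.
have s0 : 0 <= sin (x / 2) by apply: sin_ge0_pi; apply/andP; split; lra.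
nra.
Qed.

(* In the coordinates [P = sin (u / 2) / sin (a / 2)] and [Q] (likewise), with
   [k] and [l] close to 1 near the center, the caps are the discs
   [P ^ 2 + Q ^ 2 <= 2 + t (k P - l Q)] through [(-1, -1)] and [(1, 1)]. *)
Lemma cap_form (R : realType) (m1 m2 a b t : R) : 0 < a <= 1 -> 0 < b <= 1 ->
  exists w c, forall x y, let u := x - m1 in let v := y - m2 in
    let P := sin (u / 2) / sin (a / 2) in let k := cos (u / 2) / cos (a / 2) in
    let Q := sin (v / 2) / sin (b / 2) in let l := cos (v / 2) / cos (b / 2) in
    dotp w (clifford_param (x, y)) - c =
      2 - P ^+ 2 - Q ^+ 2 + t * (k * P - l * Q).
Proof.
have p2 := pi_ge2 R.
have sp (z : R) : 0 < z <= 1 -> (sin (z / 2) != 0) && (cos (z / 2) != 0).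
  move=> /andP[z0 z1].
  by rewrite !gt_eqF ?cos_gt0_pihalf ?sin_gt0_pi//; apply/andP; split; lra.
move=> /sp/andP[sa ca] /sp/andP[sb cb].
(* With [u = x - m1], one has [A (1 - cos u) = P ^ 2] and [sin u / sin a = k P], so these discs are
   cut out by linear functionals on the torus. *)
pose A := (2 * sin (a / 2) ^+ 2)^-1; pose B := (2 * sin (b / 2) ^+ 2)^-1.
have [w hw] := clifford_form A (t / (2 * sin (a / 2) * cos (a / 2)))
  B (- t / (2 * sin (b / 2) * cos (b / 2))) m1 m2.
exists w, (A + B - 2) => x y /=; rewrite hw.
rewrite (sin_half_double (x - m1)) (cos_half_double (x - m1)).
rewrite (sin_half_double (y - m2)) (cos_half_double (y - m2)) /A /B.
by field; rewrite sa ca sb cb.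
Qed.

(** As [21 a <= 1], [sin (21 a) >= 21 a / 2], whereas [sin (a / 2) <= a / 2]: the ratio is at least
    21. The upper bound on [|u|] is the mirror image of the lower one under
    [u / 2 -> pi - u / 2]. *)
Lemma far_sin (R : realType) (a u : R) : 0 < a <= 1 / 21 ->
  42 * a <= `|u| <= 2 * pi - 42 * a -> 20 < `|sin (u / 2) / sin (a / 2)|.
Proof.
move=> /andP[a0 a1] /andP[u1 u2]; have p2 := pi_ge2 R.
have s0 : 0 < sin (a / 2) by apply: sin_gt0_pi; apply/andP; split; lra.
rewrite normrM normfV (gtr0_norm s0) ltr_pdivlMr//.
have -> : `|sin (u / 2)| = sin (`|u| / 2).
  have [u0|u0] := leP 0 u.
    by rewrite !ger0_norm// sin_ge0_pi//; move: u2; rewrite ger0_norm//; lra.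
  rewrite !ltr0_norm// ?mulNr ?sinN//; rewrite -oppr_gt0 -sinN -mulNr.
  apply: sin_gt0_pi; move: u2; rewrite ltr0_norm//; lra.
have h1 : sin (a / 2) <= a / 2 by apply: sin_le; lra.
have h2 : 42 * a / 2 / 2 <= sin (42 * a / 2) by apply: half_le_sin; lra.
have h3 : sin (42 * a / 2) <= sin (`|u| / 2) by apply: ler_sinr; lra.
by lra.
Qed.

Lemma cos_ratio (R : realType) (a u : R) : 0 < a <= 1 ->
  `|cos (u / 2) / cos (a / 2)| <= 2.
Proof.
move=> a1; have c : 1 / 2 <= cos (a / 2) by apply: small_cos; lra.
have c0 : 0 < cos (a / 2) by lra.
rewrite normrM normfV (gtr0_norm c0) ler_pdivrMr//.
by have := cos_max (u / 2); lra.
Qed.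

(** The last term is at most [16 (|P| + |Q|)], so completing squares bounds the left side by
    [130 - (|P| - 8) ^ 2 - (|Q| - 8) ^ 2]; beyond 20 one square exceeds 144. *)
Lemma cap_lt0 (R : realType) (P Q k l t : R) :
  0 <= t <= 8 -> `|k| <= 2 -> `|l| <= 2 -> 20 < `|P| \/ 20 < `|Q| ->
  2 - P ^+ 2 - Q ^+ 2 + t * (k * P - l * Q) < 0.
Proof.
move=> /andP[t0 t8] k2 l2 PQ.
have e1 : k * P <= 2 * `|P|.
  by rewrite (le_trans (ler_norm _))// normrM ler_wpM2r.
have e2 : - (l * Q) <= 2 * `|Q|.
  by rewrite (le_trans (ler_norm _))// normrN normrM ler_wpM2r.
have e3 : t * (k * P - l * Q) <= 8 * (2 * `|P| + 2 * `|Q|).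
  have : k * P - l * Q <= 2 * `|P| + 2 * `|Q| by lra.
  have := normr_ge0 P; have := normr_ge0 Q; nra.
rewrite -(real_normK (num_real P)) -(real_normK (num_real Q)).
move: e3; set T := t * _; move: (normr_ge0 P) (normr_ge0 Q) PQ.
move: `|P| `|Q| T => p q T p0 q0 PQ e3.
have : 0 <= (p - 8) ^+ 2 by apply: sqr_ge0.
have : 0 <= (q - 8) ^+ 2 by apply: sqr_ge0.
by case: PQ => h; nra.
Qed.

(* The parameter [t] of the second cap solves a linear equation which puts the
   third point on its boundary. *)
Lemma edge_triangle_caps (R : realType) (m1 m2 a b u v : R) :
  0 < a <= 1 / 21 -> 0 < b <= 1 / 21 -> a < u <= 2 * a -> b < v <= 2 * b ->
  exists (w0 : 'rV[R]_4) c0 (w1 : 'rV[R]_4) c1,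
    let f w x y := dotp w (clifford_param (x, y)) in
    [/\ [/\ f w0 (m1 - a) (m2 - b) = c0, f w0 (m1 + a) (m2 + b) = c0
          & f w0 (m1 + u) (m2 - v) < c0],
        [/\ f w1 (m1 - a) (m2 - b) = c1, f w1 (m1 + a) (m2 + b) = c1
          & f w1 (m1 + u) (m2 - v) = c1]
      & forall x y, 42 * a <= `|x - m1| <= 2 * pi - 42 * a \/
                    42 * b <= `|y - m2| <= 2 * pi - 42 * b ->
          f w0 x y < c0 /\ f w1 x y < c1].
Proof.
move=> a21 b21 ua vb; have p2 := pi_ge2 R.
have a1 : 0 < a <= 1 by lra.
have b1 : 0 < b <= 1 by lra.
have pos (z : R) : 0 < z <= 1 -> 0 < sin (z / 2) /\ 1 / 2 <= cos (z / 2).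
  move=> z1; split; first by apply: sin_gt0_pi; lra.
  by apply: small_cos; lra.
have ratio (z w : R) : 0 < z <= 1 / 21 -> z < w <= 2 * z ->
    [/\ 1 < sin (w / 2) / sin (z / 2), sin (w / 2) / sin (z / 2) <= 2
      & 1 / 2 <= cos (w / 2) / cos (z / 2)].
  move=> z1 wz; have [|sz cz] := pos z; first by lra.
  have [|sw cw] := pos w; first by lra.
  rewrite ltr_pdivlMr// ler_pdivrMr// ler_pdivlMr; last by lra.
  split.
  - by rewrite mul1r ltr_sin ?in_itv/=; lra.
  - have : sin (w / 2) <= sin z by apply: ler_sinr; lra.
    by rewrite (sin_half_double z); have := cos_le1 (z / 2); nra.
  - by have := cos_le1 (z / 2); lra.
have [P1 P2 k2] := ratio _ _ a21 ua; have [Q1 Q2 l2] := ratio _ _ b21 vb.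
move: P1 P2 k2 Q1 Q2 l2.
set P := _ / sin (a / 2); set k := _ / cos (a / 2).
set Q := _ / sin (b / 2); set l := _ / cos (b / 2) => P1 P2 k2 Q1 Q2 l2.
have D0 : 0 < k * P + l * Q by nra.
pose t := (P ^+ 2 + Q ^+ 2 - 2) / (k * P + l * Q).
(* [P] and [Q] lie in []1, 2]] and [k, l >= 1 / 2]: the numerator is at most 6 and the denominator
   exceeds 1. *)
have t8 : 0 <= t <= 8.
  rewrite /t divr_ge0 ?(ltW D0)//=; last by nra.
  by rewrite ler_pdivrMr//; nra.
(* For [t = 0] the third point is outside the disc, since both its coordinates exceed 1 in absolute
   value. *)
have [w0 [c0 h0]] := cap_form m1 m2 0 a1 b1.
have [w1 [c1 h1]] := cap_form m1 m2 t a1 b1.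
have [sa ca] := pos a a1; have [sb cb] := pos b b1.
have sub (w : 'rV[R]_4) c x y : dotp w (clifford_param (x, y)) - c = 0 ->
  dotp w (clifford_param (x, y)) = c by move/eqP; rewrite subr_eq0 => /eqP.
have subl (w : 'rV[R]_4) c x y : dotp w (clifford_param (x, y)) - c < 0 ->
  dotp w (clifford_param (x, y)) < c by rewrite subr_lt0.
have Ax : m1 - a - m1 = - a by ring.
have Ay : m2 - b - m2 = - b by ring.
have Bx : m1 + a - m1 = a by ring.
have By : m2 + b - m2 = b by ring.
have Cx : m1 + u - m1 = u by ring.
have Cy : m2 - v - m2 = - v by ring.
exists w0, c0, w1, c1; split.
- split; [apply: sub|apply: sub|apply: subl]; rewrite h0 ?Ax ?Ay ?Bx ?By ?Cx ?Cy.
  + by rewrite !mulNr !sinN !cosN !mulNr !divff ?gt_eqF//; [ring|lra..].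
  + by rewrite !divff ?gt_eqF//; [ring|lra..].
  + by rewrite !mulNr !sinN !cosN !mulNr -/P -/k -/Q -/l mul0r addr0; nra.
- split; apply: sub; rewrite h1 ?Ax ?Ay ?Bx ?By ?Cx ?Cy.
  + by rewrite !mulNr !sinN !cosN !mulNr !divff ?gt_eqF//; [ring|lra..].
  + by rewrite !divff ?gt_eqF//; [ring|lra..].
  + rewrite !mulNr !sinN !cosN !mulNr -/P -/k -/Q -/l mulrN opprK /t divfK ?gt_eqF//.
    by ring.
move=> x y far.
have PQ : 20 < `|sin ((x - m1) / 2) / sin (a / 2)| \/
          20 < `|sin ((y - m2) / 2) / sin (b / 2)|.
  by case: far => far; [left|right]; apply: far_sin.
split; apply: subl; rewrite ?h0 ?h1; apply: cap_lt0 => //; try exact: cos_ratio.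
by rewrite lexx ler0n.
Qed.

(** * The grid and the law of its occupation numbers *)

Lemma clifford_param_continuous (R : realType) :
  continuous (@clifford_param R).
Proof.
move=> p; apply/cvg_ballP => e e0.
have h (i : 'I_4) : \forall q \near p,
    ball (clifford_param p 0 i) e (clifford_param q 0 i).
  have : (fun q : R * R => [:: cos q.1; sin q.1; cos q.2; sin q.2]`_i) @ p -->
         ([:: cos p.1; sin p.1; cos p.2; sin p.2]`_i : R).
    case: i => [[|[|[|[|//]]]] hi] /=.
    - by apply: (@continuous_comp _ _ _ fst cos); [exact: cvg_fst|exact: continuous_cos].
    - by apply: (@continuous_comp _ _ _ fst sin); [exact: cvg_fst|exact: continuous_sin].
    - by apply: (@continuous_comp _ _ _ snd cos); [exact: cvg_snd|exact: continuous_cos].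
    - by apply: (@continuous_comp _ _ _ snd sin); [exact: cvg_snd|exact: continuous_sin].
  move/cvg_ballP => /(_ e e0); apply: filterS => q; rewrite !mxE.
  exact.
suff : \forall q \near p, ball (clifford_param p) e (clifford_param q) by [].
have := @filter_forall _ _ _ _ (nbhs_filter (p : R * R)) h.
apply: (@filterS _ _ (nbhs_filter (p : R * R))) => q hq.
by split => // i j; rewrite !ord1.
Qed.

Lemma borel_clifford_segments (R : realType) (a b c d : R) :
  borel (@clifford_param R @` (`[a, b] `*` `[c, d])).
Proof.
rewrite -[borel _]/(measurable (_ : set (g_sigma_algebraType
  [set U : set 'rV[R]_4 | open U]))).
rewrite -[X in measurable X]setCK; apply: measurableC.
apply: sub_sigma_algebra; rewrite /= openC.
apply: compact_closed; first exact: norm_hausdorff.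
apply: continuous_compact.
  by apply: continuous_subspaceT => x; exact: clifford_param_continuous.
by apply: compact_setX; exact: segment_compact.
Qed.

Lemma angle_inj (R : realType) (x y : R) :
  cos x = cos y -> sin x = sin y -> `|x - y| < 2 * pi -> x = y.
Proof.
move=> c s xy; apply/eqP; rewrite -subr_eq0 -normr_eq0; apply/negPn/negP => n0.
have h0 : 0 < `|x - y| / 2 < pi.
  have : 0 < `|x - y| by rewrite lt0r n0 normr_ge0.
  by move=> n1; apply/andP; split; lra.
have := sin_gt0_pi h0.
have : cos `|x - y| = 1.
  by rewrite cos_norm cosB -c -s -!expr2 cos2Dsin2.
have {1}-> : `|x - y| = (`|x - y| / 2) *+ 2 by rewrite mulr2n; field.
by rewrite cos_mulr2n cos2sin2 mulr2n; nra.
Qed.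

Lemma clifford_inj (R : realType) (p q : R * R) :
  clifford_param p = clifford_param q ->
  `|p.1 - q.1| < 2 * pi -> `|p.2 - q.2| < 2 * pi -> p = q.
Proof.
move=> /rowP e d1 d2.
have := (e 0, e 1, e (inord 2), e (inord 3));
    rewrite !mxE /= !inordK//= => -[[[c1 s1] c2] s2].
by case: p q c1 s1 c2 s2 d1 d2 {e} => x y [x' y'] /= c1 s1 c2 s2 d1 d2;
  rewrite (angle_inj c1 s1 d1) (angle_inj c2 s2 d2).
Qed.

Definition mesh (R : realType) (N : nat) : R := 2 * pi / N%:R.

Definition angle_arc (R : realType) (N : nat) (a : int) : set R :=
  `](- pi + mesh R N * a%:~R), (- pi + mesh R N * (a + 1)%:~R)]%classic.

(* Indexing cells by all integers avoids any case distinction at the cut of the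
   angles at [pi]: cells repeat with period [N] in both indices, and [ocell]
   picks one index from each class. *)
Definition cell (R : realType) (N : nat) (c : int * int) : set 'rV[R]_4 :=
  @clifford_param R @` (angle_arc N c.1 `*` angle_arc N c.2).

Definition ocell (R : realType) (N : nat) (c : 'I_N * 'I_N) : set 'rV[R]_4 :=
  cell N (c.1%:Z, c.2%:Z).

Lemma mesh_gt0 (R : realType) N : (0 < N)%N -> 0 < mesh R N.
Proof. by move=> N0; rewrite divr_gt0 ?mulr_gt0 ?pi_gt0 ?ltr0n. Qed.

Lemma meshN (R : realType) N : (0 < N)%N -> mesh R N * N%:R = 2 * pi.
Proof. by move=> N0; rewrite divfK// pnatr_eq0 -lt0n. Qed.

Lemma angle_arcP (R : realType) N (a : int) (x : R) : angle_arc N a x <->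
  - pi + mesh R N * a%:~R < x <= - pi + mesh R N * (a%:~R + 1).
Proof. by rewrite /angle_arc /= in_itv /= intrD1. Qed.

Lemma arc_inj (R : realType) N (a b : int) (x : R) : (0 < N)%N ->
  angle_arc N a x -> angle_arc N b x -> a = b.
Proof.
move=> /(mesh_gt0 R) h /angle_arcP/andP[a1 a2] /angle_arcP/andP[b1 b2].
have ab : (a%:~R : R) < b%:~R + 1 by rewrite -(ltr_pM2l h); lra.
have ba : (b%:~R : R) < a%:~R + 1 by rewrite -(ltr_pM2l h); lra.
by move: ab ba; rewrite -!intrD1 !ltr_int; lia.
Qed.

Lemma arc_ex (R : realType) N (x : R) : (0 < N)%N -> exists a, angle_arc N a x.
Proof.
(* Arcs contain their right end and not their left one, hence the ceiling minus one instead of the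
   floor. *)
move=> /(mesh_gt0 R) h; exists (Num.ceil ((x + pi) / mesh R N) - 1); apply/angle_arcP.
have := ceil_itv ((x + pi) / mesh R N).
set c := Num.ceil _; rewrite intrB => /andP[].
rewrite ltr_pdivlMr// ler_pdivrMr// subrK mulrC => c1 c2.
by apply/andP; split; lra.
Qed.

Lemma arc_sub (R : realType) N (a : 'I_N) :
  angle_arc N a%:Z `<=` `](- pi), (pi : R)]%classic.
Proof.
move=> x /angle_arcP/andP[a1 a2]; rewrite /= in_itv /=.
have N0 : (0 < N)%N by case: N a {a1 a2} => [[]|].
have h := mesh_gt0 R N0; have hN := meshN R N0.
have a0 : (0 : R) <= a%:Z%:~R by rewrite -pmulrn ler0n.
have aN : (a%:Z%:~R : R) + 1 <= N%:R by rewrite -pmulrn natr1 ler_nat.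
by apply/andP; split; nra.
Qed.

Lemma clifford_square_inj (R : realType) :
  {in @angle_square R &, injective (@clifford_param R)}.
Proof.
move=> p q; rewrite !inE => -[p1 p2] [q1 q2] e; move: p1 p2 q1 q2.
rewrite /= !in_itv /= => p1 p2 q1 q2; apply: clifford_inj => //;
  by rewrite ltr_norml; apply/andP; split; lra.
Qed.

Lemma ocell_sub (R : realType) N (c : 'I_N * 'I_N) :
  ocell c `<=` @clifford_torus R.
Proof.
move=> _ [p [p1 p2] <-]; exists p => //; split; [exact: (arc_sub p1)|exact: (arc_sub p2)].
Qed.

Lemma ocell_mes2 (R : realType) N (c : 'I_N * 'I_N) :
  mes2 (@ocell R N c) = (mesh R N ^+ 2)%:E.
Proof.
have N0 : (0 < N)%N by case: N c => [[[]]|].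
have h := mesh_gt0 R N0.
rewrite /mes2 (_ : _ `&` _ = angle_arc N c.1%:Z `*` angle_arc N c.2%:Z).
  have L (a : int) : lebesgue_measure (@angle_arc R N a) = (mesh R N)%:E.
    rewrite lebesgue_measure_itv /= lte_fin ltrD2l ltr_pM2l// ltr_int ltzD1 lexx.
    by rewrite -EFinB intrD1; congr EFin; ring.
  transitivity (lebesgue_measure (@angle_arc R N c.1%:Z) *
                lebesgue_measure (@angle_arc R N c.2%:Z))%E.
    by apply: product_measure1E; exact: measurable_itv.
  by rewrite !L.
apply/seteqP; split => p /=.
  move=> [sp [q [q1 q2]]] /clifford_square_inj <- //; rewrite inE//.
  by split; [exact: (arc_sub q1)|exact: (arc_sub q2)].
move=> [p1 p2]; split; first by split; [exact: (arc_sub p1)|exact: (arc_sub p2)].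
by exists p.
Qed.

(** A cell is the compact image of a closed rectangle minus the images of its left and lower sides.
    [1 < N] makes the closed arcs shorter than [2 pi], so that opposite sides are not glued together
    and the removed sides miss the cell. *)
Lemma ocell_borel (R : realType) N (c : 'I_N * 'I_N) : (1 < N)%N ->
  borel (@ocell R N c).
Proof.
move=> N1; have N0 : (0 < N)%N by exact: ltn_trans N1.
have h := mesh_gt0 R N0; have hN := meshN R N0.
have h2 : mesh R N < 2 * pi.
  have : (1 : R) < N%:R by rewrite ltr1n.
  by nra.
pose a1 : R := - pi + mesh R N * c.1%:Z%:~R; pose b1 := a1 + mesh R N.
pose a2 : R := - pi + mesh R N * c.2%:Z%:~R; pose b2 := a2 + mesh R N.
have -> : @ocell R N c = @clifford_param R @` (`[a1, b1] `*` `[a2, b2])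
    `\` (@clifford_param R @` (`[a1, a1] `*` `[a2, b2])
      `|` @clifford_param R @` (`[a1, b1] `*` `[a2, a2])).
  apply/seteqP; split => [_ [p [/angle_arcP /= p1 /angle_arcP /= p2] <-]|_ [[p [p1 p2] <-] np]].
    split.
      exists p => //; split; rewrite /= in_itv /= /b1 /b2 /a1 /a2;
      by apply/andP; split; lra.
    move=> [[q [q1 q2]]|[q [q1 q2]]] /clifford_inj e; move: q1 q2 e;
      rewrite /= !in_itv /= => q1 q2 e.
      suff : q = p by move=> qp; move: q1 p1; rewrite qp /a1; lra.
      by apply: e; rewrite ltr_norml /b1 /b2 /a1 /a2 in q1 q2 *; apply/andP; split; lra.
    suff : q = p by move=> qp; move: q2 p2; rewrite qp /a2; lra.
    by apply: e; rewrite ltr_norml /b1 /b2 /a1 /a2 in q1 q2 *; apply/andP; split; lra.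
  exists p => //; move: p1 p2 np; rewrite /= !in_itv /=.
  move=> p1 p2 /not_orP[n1 n2].
  have m1 : p.1 != a1.
    apply: contra_notN n1 => /eqP e; exists p => //; split; rewrite /= in_itv /= ?e//.
    by rewrite lexx.
  have m2 : p.2 != a2.
    apply: contra_notN n2 => /eqP e; exists p => //; split; rewrite /= in_itv /= ?e//.
    by rewrite lexx.
  split; apply/angle_arcP; rewrite mulrDr mulr1 addrA -/a1 -/a2 -/b1 -/b2 lt_neqAle.
    by rewrite eq_sym m1.
  by rewrite eq_sym m2.
have := @borel_clifford_segments R; rewrite /borel => B.
by apply: (@measurableD _ (g_sigma_algebraType [set U : set 'rV[R]_4 | open U]));
  [exact: B|apply: (@measurableU _ (g_sigma_algebraType [set U : set 'rV[R]_4 | open U]));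
  exact: B].
Qed.

Lemma ocell_inj (R : realType) N (c e : 'I_N * 'I_N) (x : 'rV[R]_4) :
  ocell c x -> ocell e x -> c = e.
Proof.
have N0 : (0 < N)%N by case: N c e => [[[]]|].
move=> [p [p1 p2] <-] [q [q1 q2]] /clifford_square_inj qp.
have {}qp : q = p by apply: qp; rewrite inE; split;
    (exact: (arc_sub q1) || exact: (arc_sub q2) || exact: (arc_sub p1) || exact: (arc_sub p2)).
rewrite qp in q1 q2; case: c e p1 p2 q1 q2 => [c1 c2] [e1 e2] /= p1 p2 q1 q2.
have [/val_inj ->] := arc_inj N0 p1 q1.
by have [/val_inj ->] := arc_inj N0 p2 q2.
Qed.

Lemma trig_periodz (R : realType) (x : R) (q : int) :
  cos (x + 2 * pi * q%:~R) = cos x /\ sin (x + 2 * pi * q%:~R) = sin x.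
Proof.
have P n (y : R) : cos (y + 2 * pi * n%:R) = cos y /\ sin (y + 2 * pi * n%:R) = sin y.
  have -> : y + 2 * pi * n%:R = y + (pi *+ 2) *+ n.
    by rewrite -[_ *+ n]mulr_natr mulr2n; ring.
  by rewrite (periodicn (@cosD2pi R)) (periodicn (@sinD2pi R)).
case: q => n; first exact: P.
have [c s] := P n.+1 (x + 2 * pi * (Negz n)%:~R); rewrite -{}c -{}s.
by rewrite -addrA -mulrDr NegzE mulrNz -pmulrn addNr mulr0 addr0.
Qed.

Lemma clifford_periodz (R : realType) (x y : R) (p q : int) :
  clifford_param (x + 2 * pi * p%:~R, y + 2 * pi * q%:~R) = clifford_param (x, y).
Proof.
by rewrite /clifford_param /=; have [-> ->] := trig_periodz x p;
  have [-> ->] := trig_periodz y q.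
Qed.

Definition cidx (n : nat) (a : int) : 'I_n.+1 := inord `|(a %% n.+1)%Z|%N.

Lemma cidxE n a : (cidx n a)%:Z = (a %% n.+1)%Z.
Proof.
have h : (0 <= (a %% n.+1)%Z)%R by apply: modz_ge0.
rewrite /cidx inordK ?gez0_abs//.
by rewrite -ltz_nat gez0_abs// ltz_pmod.
Qed.

Lemma arc_shift (R : realType) n (a : int) (x : R) :
  angle_arc n.+1 a x <-> angle_arc n.+1 (cidx n a)%:Z (x - 2 * pi * (a %/ n.+1)%Z%:~R).
Proof.
rewrite !angle_arcP cidxE -(meshN R (ltn0Sn n)).
have -> : (a%:~R : R) = (a %/ n.+1)%Z%:~R * n.+1%:R + (a %% n.+1)%Z%:~R.
  by rewrite {1}(divz_eq a n.+1) intrD intrM.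
move: (mesh R n.+1) ((a %/ n.+1)%Z%:~R : R) ((a %% n.+1)%Z%:~R : R) => h q r.
split => /andP[h1 h2]; apply/andP; split; lra.
Qed.

Lemma cell_cidx (R : realType) n (c : int * int) :
  cell n.+1 c = @ocell R n.+1 (cidx n c.1, cidx n c.2).
Proof.
apply/seteqP; split => _ [p [p1 p2] <-].
  exists (p.1 - 2 * pi * (c.1 %/ n.+1)%Z%:~R, p.2 - 2 * pi * (c.2 %/ n.+1)%Z%:~R).
    by split; [exact: (arc_shift _ _ _).1 p1|exact: (arc_shift _ _ _).1 p2].
  rewrite -(clifford_periodz _ _ (c.1 %/ n.+1)%Z (c.2 %/ n.+1)%Z) !subrK.
  by case: p {p1 p2}.
exists (p.1 + 2 * pi * (c.1 %/ n.+1)%Z%:~R, p.2 + 2 * pi * (c.2 %/ n.+1)%Z%:~R).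
  by split; apply: (arc_shift _ _ _).2; rewrite /= addrK.
by rewrite clifford_periodz; case: p {p1 p2}.
Qed.

(** * Probabilities of prescribed occupation numbers *)

Definition occupancy (R : realType) (N : nat) (Y : {fset 'rV[R]_4})
    (S1 S0 : {set 'I_N * 'I_N}) : Prop :=
  (forall c, c \in S1 -> npoints Y (ocell c) = 1%N) /\
  (forall c, c \in S0 -> npoints Y (ocell c) = 0%N).

Lemma measurable_npoints (R : realType) d (Omega : measurableType d)
    (P : probability Omega R) lambda (X : Omega -> {fset 'rV[R]_4}) A k :
  poisson_point_process P lambda X -> borel A -> A `<=` @clifford_torus R ->
  measurable [set w | npoints (X w) A = k].
Proof.
move=> [_ mX _ _] bA sA; have := mX A bA sA measurableT [set k] I.
by rewrite setTI.
Qed.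

Lemma measurable_occupancy (R : realType) d (Omega : measurableType d)
    (P : probability Omega R) lambda (X : Omega -> {fset 'rV[R]_4}) N
    (S1 S0 : {set 'I_N * 'I_N}) :
  poisson_point_process P lambda X -> (1 < N)%N ->
  measurable [set w | occupancy (X w) S1 S0].
Proof.
move=> hX N1.
have -> : [set w | occupancy (X w) S1 S0] =
  (\bigcap_(c in [set` S1]) [set w | npoints (X w) (ocell c) = 1%N]) `&`
  (\bigcap_(c in [set` S0]) [set w | npoints (X w) (ocell c) = 0%N]).
  by apply/seteqP; split => w [].
by apply: measurableI; apply: fin_bigcap_measurable; rewrite ?finite_finset// => c _;
  apply: measurable_npoints hX _ _; [exact: ocell_borel|exact: ocell_sub
    |exact: ocell_borel|exact: ocell_sub].
Qed.

Lemma poisson_npoints (R : realType) d (Omega : measurableType d)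
    (P : probability Omega R) lambda (X : Omega -> {fset 'rV[R]_4}) N
    (c : 'I_N * 'I_N) k (m := lambda * mesh R N ^+ 2) :
  poisson_point_process P lambda X -> (1 < N)%N -> 0 < lambda ->
  P [set w | npoints (X w) (ocell c) = k] =
  (m ^+ k * k`!%:R^-1 * expR (- m))%:E.
Proof.
move=> [_ _ hP _] N1 l0; have := hP _ (ocell_borel c N1) (@ocell_sub _ _ c) [set k].
move=> ->; rewrite ocell_mes2 -/m.
have m0 : 0 < m by rewrite mulr_gt0// exprn_gt0// mesh_gt0// (ltn_trans _ N1).
rewrite /poisson_prob m0 esum_set1 ?lee_fin ?poisson_pmf_ge0//.
by rewrite /poisson_pmf m0.
Qed.

(** The cells of both sets form one disjoint family, with required number of points [k], to which
    independence applies in a single step. *)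
Lemma prob_occupancy (R : realType) d (Omega : measurableType d)
    (P : probability Omega R) lambda (X : Omega -> {fset 'rV[R]_4}) N
    (S1 S0 : {set 'I_N * 'I_N}) (m := lambda * mesh R N ^+ 2) :
  poisson_point_process P lambda X -> (1 < N)%N -> 0 < lambda ->
  (forall c, c \in S1 -> c \notin S0) ->
  P [set w | occupancy (X w) S1 S0] =
  (m ^+ #|S1| * expR (- (m * (#|S1| + #|S0|)%:R)))%:E.
Proof.
move=> hX N1 l0 dS.
pose S := S1 :|: S0; pose k (c : 'I_N * 'I_N) : nat := c \in S1.
have kS0 c : c \in S0 -> k c = 0%N.
  by move=> cS0; rewrite /k; case: (boolP (c \in S1)) => // /dS; rewrite cS0.
pose A (i : 'I_#|S|) := @ocell R N (enum_val i).
have hA i : borel (A i) /\ A i `<=` @clifford_torus R.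
  by split; [exact: ocell_borel|exact: ocell_sub].
have tA : trivIset setT A.
  move=> i j _ _ [x [Ai Aj]]; exact/enum_val_inj/(ocell_inj Ai Aj).
have [_ _ _ /(_ _ A hA tA (fun i => k (enum_val i)))] := hX.
rewrite (_ : [set w | forall i, _] = [set w | occupancy (X w) S1 S0]); last first.
  apply/seteqP; split => w /=.
    move=> h; have {}h c : c \in S -> npoints (X w) (ocell c) = k c.
      by move=> cS; have := h (enum_rank_in cS c); rewrite /A enum_rankK_in.
    split => c cS; rewrite h ?inE ?cS ?orbT//; last exact: kS0.
    by rewrite /k cS.
  move=> [h1 h0] i; have := enum_valP i; rewrite inE => /orP[iS|iS].
    by rewrite /A h1// /k iS.
  by rewrite /A h0// kS0.
move=> ->; rewrite -(big_enum_val (A :=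
    mem S) (fun c => P [set w | npoints (X w) (ocell c) = k c])).
under eq_bigr => c _ do rewrite (poisson_npoints c _ hX N1 l0) -/m.
rewrite prodEFin; congr EFin.
have -> : \prod_(c in S) (m ^+ k c * (k c)`!%:R^-1 * expR (- m)) =
  \prod_(c in S) (m ^+ k c) * \prod_(c in S) expR (- m).
  rewrite -big_split; apply: eq_bigr => c _.
  by rewrite /k; case: (c \in S1) => /=; rewrite ?factS fact0 ?muln1 invr1 mulr1.
rewrite prodr_const -expRM_natl; congr (_ * expR _); last first.
  have e : #|S| = (#|S1| + #|S0|)%N.
    rewrite -cardsUI -[LHS]addn0; congr addn; apply/esym/eqP; rewrite cards_eq0.
    by apply/eqP/setP => c; rewrite !inE; apply/negP => /andP[/dS/negP].
  by rewrite e; ring.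
rewrite (bigID (mem S1)) /= [X in _ * X]big1 ?mulr1; last first.
  by move=> c /andP[_ cS1]; rewrite /k (negbTE cS1) expr0.
rewrite (eq_bigl (mem S1)); last by move=> c /=; rewrite inE; case: (c \in S1);
    rewrite ?andbF.
rewrite (eq_bigr (fun=> m)) ?prodr_const// => c cS1.
by rewrite /k (cS1 : c \in S1).
Qed.

(** Allows [S1] and [S0] to overlap, as cells produced by index arithmetic on a circle may: the
    event is then empty. Otherwise the factor [expR (- (m * #|S1|))] is bounded by 1. *)
Lemma prob_occupancy_le (R : realType) d (Omega : measurableType d)
    (P : probability Omega R) lambda (X : Omega -> {fset 'rV[R]_4}) N
    (S1 S0 : {set 'I_N * 'I_N}) (m := lambda * mesh R N ^+ 2) :
  poisson_point_process P lambda X -> (1 < N)%N -> 0 < lambda ->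
  (P [set w | occupancy (X w) S1 S0] <=
  (m ^+ #|S1| * expR (- (m * #|S0|%:R)))%:E)%E.
Proof.
move=> hX N1 l0.
have m0 : 0 < m by rewrite mulr_gt0// exprn_gt0// mesh_gt0// (ltn_trans _ N1).
have [dS|/existsNP[c /not_implyP[c1 /negP/negPn c0]]] :=
  pselect (forall c, c \in S1 -> c \notin S0).
  rewrite (prob_occupancy hX)// lee_fin ler_wpM2l ?exprn_ge0 ?(ltW m0)//.
  by rewrite ler_expR lerN2 ler_pM2l// ler_nat leq_addl.
rewrite (_ : [set w | _] = set0) ?measure0.
  by rewrite lee_fin mulr_ge0 ?expR_ge0// exprn_ge0// ltW.
by apply/seteqP; split => w //= [/(_ c c1) + /(_ c c0)] => ->.
Qed.

(** * Upper bound: counting configurations with an empty rectangle *)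

Lemma lift_angle (R : realType) (x y : R) :
  exists k : int, `|x + 2 * pi * k%:~R - y| <= pi.
Proof.
have p0 := pi_gt0 R; pose t := (x - y) / (2 * pi).
have xE : x = y + 2 * pi * t by rewrite /t [_ * (_ / _)]mulrC divfK ?gt_eqF ?mulr_gt0// addrC subrK.
exists (- Num.floor (t + 1 / 2)).
have /andP[] := floor_itv (t + 1 / 2); rewrite intrD1 mulrNz.
set f : R := (_ %:~R) => h1 h2; rewrite xE ler_norml.
have a1 : 0 <= pi * (t + 1 / 2 - f) by apply: mulr_ge0; lra.
have a2 : 0 <= pi * (f + 1 - (t + 1 / 2)) by apply: mulr_ge0; lra.
by apply/andP; split; lra.
Qed.

(** Geodesic distance in the first circle factor, written in coordinates so that it does not depend
    on a choice of angles. *)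
Definition arcdist1 (R : realType) (x y : 'rV[R]_4) : R :=
  acos (x 0 0 * y 0 0 + x 0 1 * y 0 1).

Definition arcdist2 (R : realType) (x y : 'rV[R]_4) : R :=
  acos (x 0 (inord 2) * y 0 (inord 2) + x 0 (inord 3) * y 0 (inord 3)).

Lemma arcdist1E (R : realType) (p q : R * R) :
  arcdist1 (clifford_param p) (clifford_param q) = acos (cos (p.1 - q.1)).
Proof. by rewrite /arcdist1 !mxE /= cosB. Qed.

Lemma arcdist2E (R : realType) (p q : R * R) :
  arcdist2 (clifford_param p) (clifford_param q) = acos (cos (p.2 - q.2)).
Proof. by rewrite /arcdist2 !mxE /= !inordK// cosB. Qed.

Lemma arcdist1C (R : realType) (x y : 'rV[R]_4) : arcdist1 x y = arcdist1 y x.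
Proof. by rewrite /arcdist1 mulrC [_ * y 0 1]mulrC. Qed.

Lemma arcdist2C (R : realType) (x y : 'rV[R]_4) : arcdist2 x y = arcdist2 y x.
Proof. by rewrite /arcdist2 mulrC [_ * y 0 (inord 3)]mulrC. Qed.

Lemma acos_cos_small (R : realType) (t : R) : `|t| <= pi -> acos (cos t) = `|t|.
Proof. by move=> tpi; rewrite -cos_norm cosK// in_itv/= normr_ge0. Qed.

Lemma acos_cos_le (R : realType) (t : R) : acos (cos t) <= `|t|.
Proof.
have [/acos_cos_small -> //|tpi] := leP `|t| pi.
apply: le_trans (ltW tpi); apply: acos_lepi.
by rewrite cos_geN1 cos_le1.
Qed.

Lemma acos_cos_triangle (R : realType) (x y z : R) :
  acos (cos (x - z)) <= acos (cos (x - y)) + acos (cos (y - z)).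
Proof.
have [k hk] := lift_angle x y; have [l hl] := lift_angle z y.
have P (u v : R) (m : int) : cos (u + 2 * pi * m%:~R - v) = cos (u - v).
  by rewrite addrAC (trig_periodz _ m).1.
have <- : cos (x + 2 * pi * k%:~R - (z + 2 * pi * l%:~R)) = cos (x - z).
  rewrite P -cosN opprB P -cosN opprB //.
apply: (le_trans (acos_cos_le _)).
rewrite -(P x y k) -[cos (y - z)]cosN opprB -(P z y l).
rewrite (acos_cos_small hk) (acos_cos_small hl); apply: le_trans (ler_normB _ _).
by rewrite le_eqVlt; apply/orP; left; apply/eqP; congr (`|_|); ring.
Qed.

(* For one metric, a pair fails to have at least half of the largest distance for
   at most one of the three pairs; hence two metrics have a common good pair. *)
Lemma spread_pair (R : realType) (T : Type) (d1 d2 : T -> T -> R) (p q r : T) :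
  let tri (d : T -> T -> R) := forall x y, 0 <= d x y /\ d x y = d y x in
  let triangle (d : T -> T -> R) := [/\ d p q <= d p r + d r q,
    d p r <= d p q + d q r & d q r <= d q p + d p r] in
  tri d1 -> tri d2 -> triangle d1 -> triangle d2 ->
  exists x y z, [/\ [\/ (x, y, z) = (p, q, r), (x, y, z) = (p, r, q)
                      | (x, y, z) = (q, r, p)],
    d1 x z <= 2 * d1 x y /\ d1 y z <= 2 * d1 x y &
    d2 x z <= 2 * d2 x y /\ d2 y z <= 2 * d2 x y].
Proof.
move=> tri triangle t1 t2.
have [] := (t1 p q, t1 p r, t1 q r) => -[[a0 aE] [b0 bE]] [c0 cE].
have [] := (t2 p q, t2 p r, t2 q r) => -[[a0' aE'] [b0' bE']] [c0' cE'].
rewrite /triangle -aE -cE -aE' -cE' => -[T1 T2 T3] [T1' T2' T3'].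
pose good (a b c : R) := (b <= 2 * a) && (c <= 2 * a).
have g1 : good (d1 p q) (d1 p r) (d1 q r) /\ good (d2 p q) (d2 p r) (d2 q r) \/
  good (d1 p r) (d1 p q) (d1 q r) /\ good (d2 p r) (d2 p q) (d2 q r) \/
  good (d1 q r) (d1 p q) (d1 p r) /\ good (d2 q r) (d2 p q) (d2 p r).
  have goodC a b c : good a b c = good a c b by rewrite /good andbC.
  have two1 (a b c : R) : 0 <= a -> 0 <= b -> 0 <= c ->
      a <= b + c -> b <= a + c -> c <= a + b ->
      good a b c \/ good b a c /\ good c a b.
    rewrite /good => ? ? ? ? ? ?; have [ab|ab] := leP b (2 * a).
      have [ac|ac] := leP c (2 * a); first by left.
      by right; split; apply/andP; split; lra.
    by right; split; apply/andP; split; lra.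
  have two (a b c : R) : 0 <= a -> 0 <= b -> 0 <= c ->
      a <= b + c -> b <= a + c -> c <= a + b ->
      [\/ good a b c /\ good b a c, good a b c /\ good c a b
        | good b a c /\ good c a b].
    move=> a0'' b0'' c0'' h1 h2 h3.
    have [ga|gbc] := two1 _ _ _ a0'' b0'' c0'' h1 h2 h3; last by constructor 3.
    have [gb|[_ gc]] := two1 _ _ _ b0'' a0'' c0'' h2 h1 ltac:(lra).
      by constructor 1.
    by constructor 2; split => //; rewrite goodC.
  case: (two _ _ _ a0 b0 c0) => // -[? ?];
  case: (two _ _ _ a0' b0' c0') => // -[? ?]; by [lra|tauto].
case: g1 => [|[]] [/andP[h1 h2] /andP[h3 h4]].
- by exists p, q, r; split => //; constructor 1.
- by exists p, r, q; split; [constructor 2| |]; rewrite // -?cE -?cE'.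
- by exists q, r, p; split; [constructor 3| |]; rewrite // -?aE -?aE' -?bE -?bE'.
Qed.

Lemma npoints_eq0P (R : realType) (X : {fset 'rV[R]_4}) A :
  npoints X A = 0%N <-> forall x, x \in X -> ~ A x.
Proof.
rewrite /npoints; split.
  move=> /eqP; rewrite cardfs_eq0 => /eqP e x xX Ax.
  by have : x \in fset0 by rewrite -e !inE xX mem_set.
move=> h; apply/eqP; rewrite cardfs_eq0; apply/eqP/fsetP => x; rewrite !inE.
by apply/negP => /andP[/h + /set_mem].
Qed.

Lemma npoints_eq1 (R : realType) (X : {fset 'rV[R]_4}) A :
  npoints X A = 1%N -> exists x, [/\ x \in X, A x &
    forall y, y \in X -> A y -> y = x].
Proof.
rewrite /npoints => /eqP/cardfs1P[x e]; exists x.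
have : x \in [fset x]%fset by rewrite inE.
rewrite -e !inE => /andP[xX /set_mem Ax]; split => // y yX Ay.
have : y \in [fset x]%fset by rewrite -e !inE yX mem_set.
by rewrite inE => /eqP.
Qed.

Lemma npoints_le1 (R : realType) (X : {fset 'rV[R]_4}) A :
  (forall x y, x \in X -> y \in X -> A x -> A y -> x = y) ->
  (npoints X A <= 1)%N.
Proof.
move=> h; have [//|/eqP n0] := eqVneq (npoints X A) 0%N; first by move->.
have [x [xX Ax]] : exists x, x \in X /\ A x.
  apply: contrapT => /forallNP n; apply: n0; apply/npoints_eq0P => x xX Ax.
  by apply: (n x).
rewrite /npoints; apply: (@leq_trans #|` [fset x]%fset|); last by rewrite cardfs1.
apply: fsubset_leq_card; apply/fsubsetP => y.
by rewrite !inE => /andP[yX /set_mem Ay]; rewrite (h y x).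
Qed.

Lemma npoints_gt0 (R : realType) (X : {fset 'rV[R]_4}) A x :
  x \in X -> A x -> (0 < npoints X A)%N.
Proof.
by move=> xX Ax; rewrite lt0n; apply/negP => /eqP/npoints_eq0P/(_ x xX).
Qed.

(** * Index distances of cells and angular distances of points *)

Lemma index_gap (R : realType) n (a a' : int) (x x' : R) :
  angle_arc n.+1 a x -> angle_arc n.+1 a' x' ->
  mesh R n.+1 * (`|a' - a|%N%:R - 1) < `|x' - x| < mesh R n.+1 * (`|a' - a|%N%:R + 1).
Proof.
have h0 := mesh_gt0 R (ltn0Sn n); move: h0; set h := mesh _ _ => h0.
move=> /angle_arcP + /angle_arcP; rewrite -/h => /andP[a1 a2] /andP[b1 b2].
have -> : (`|a' - a|%N%:R : R) = `|a'%:~R - a%:~R|.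
  by rewrite -intrB -intr_norm pmulrn abszE.
pose u := x' - x; pose v := h * (a'%:~R - a%:~R).
have uv : `|u - v| < h by rewrite ltr_norml /u /v; apply/andP; split; lra.
have vE : h * `|a'%:~R - a%:~R| = `|v| by rewrite /v normrM (gtr0_norm h0).
have n1 : `|u| <= `|v| + `|u - v| by rewrite -{1}(subrK v u) addrC ler_normD.
have n2 : `|v| <= `|u| + `|u - v|.
  by rewrite -{1}(subrK u v) addrC (distrC u v) ler_normD.
by rewrite mulrBr mulrDr vE mulr1 -/u; apply/andP; split; lra.
Qed.

Lemma signz (a b : int) : a = b + (-1) ^+ (a < b)%R * `|a - b|%N%:Z.
Proof. by case: ltP => h; rewrite ?expr1 ?expr0; lia. Qed.

Definition cshift n (c : 'I_n.+1 * 'I_n.+1) (s : bool * bool) (d : nat * nat) :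
  int * int :=
  (c.1%:Z + (-1) ^+ s.1 * d.1%:Z, c.2%:Z + (-1) ^+ s.2 * d.2%:Z).

Definition tcell n (z : int * int) : 'I_n.+1 * 'I_n.+1 :=
  (cidx n z.1, cidx n z.2).

Lemma locate1 (R : realType) n (a : 'I_n.+1) (x y : R) : (0 < n)%N ->
  angle_arc n.+1 a%:Z x -> exists (k : int) (s : bool) (d : nat),
    let y' := y + 2 * pi * k%:~R in
    [/\ `|y' - x| <= pi, angle_arc n.+1 (a%:Z + (-1) ^+ s * d%:Z) y', (d <= n)%N &
      mesh R n.+1 * (d%:R - 1) < `|y' - x| < mesh R n.+1 * (d%:R + 1)].
Proof.
move=> n0 ax; have h0 := mesh_gt0 R (ltn0Sn n); have hN := meshN R (ltn0Sn n).
have [k yk] := lift_angle y x; have [b yb] := arc_ex (y + 2 * pi * k%:~R) (ltn0Sn n).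
exists k, (b < a%:Z)%R, `|b - a%:Z|%N => /=.
have gap := index_gap ax yb; split => //; first by rewrite -signz.
(* With [h] the mesh, [h (d - 1) < pi], and [h <= pi] because there are at least two arcs; hence
   [h d < 2 pi], that is [d < n.+1]. *)
rewrite -ltnS -(ltr_nat R) -(ltr_pM2l h0) hN.
have n2 : (2 : R) <= n.+1%:R by rewrite ler_nat ltnS.
have hn := ler_wpM2l (ltW h0) n2.
by move: gap yk => /andP[g1 _] yk; lra.
Qed.

Lemma locate (R : realType) n (c : 'I_n.+1 * 'I_n.+1) (p : R * R) (y : 'rV[R]_4) :
  (0 < n)%N -> angle_arc n.+1 c.1%:Z p.1 -> angle_arc n.+1 c.2%:Z p.2 ->
  clifford_torus y ->
  exists (q : R * R) (s : bool * bool) (d : 'I_n.+1 * 'I_n.+1),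
    [/\ y = clifford_param q, `|q.1 - p.1| <= pi /\ `|q.2 - p.2| <= pi,
     angle_arc n.+1 (cshift c s (d.1 : nat, d.2 : nat)).1 q.1 /\
     angle_arc n.+1 (cshift c s (d.1 : nat, d.2 : nat)).2 q.2,
     mesh R n.+1 * (d.1%:R - 1) < `|q.1 - p.1| < mesh R n.+1 * (d.1%:R + 1) &
     mesh R n.+1 * (d.2%:R - 1) < `|q.2 - p.2| < mesh R n.+1 * (d.2%:R + 1)].
Proof.
move=> n0 p1 p2 [q _ <-].
have [k1 [s1 [d1 /= [h1 a1 /ltnSE l1 g1]]]] := locate1 q.1 n0 p1.
have [k2 [s2 [d2 /= [h2 a2 l2 g2]]]] := locate1 q.2 n0 p2.
exists (q.1 + 2 * pi * k1%:~R, q.2 + 2 * pi * k2%:~R), (s1, s2).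
exists (Ordinal (l1 : (d1 < n.+1)%N), Ordinal (l2 : (d2 < n.+1)%N)).
by split => //; rewrite clifford_periodz; case: q {h1 a1 g1 h2 a2 g2}.
Qed.

(* Points in cells at index distance [d] have angles more than [d - 1] meshes
   apart; half of this length, measured from a point of a cell, covers at least
   this many of the following cells. *)
Definition chunk_side (d : nat) : nat := ((d - 3)./2)%N.

Lemma chunk_step (R : realType) n (a : int) (e : bool) k (d : nat) (x z D : R) :
  angle_arc n.+1 a x -> angle_arc n.+1 (a + (-1) ^+ e * k.+1%:Z) z ->
  mesh R n.+1 * (d%:R - 1) < D -> (k < chunk_side d)%N ->
  exists2 s, 0 < s < D / 2 & z = x + (-1) ^+ e * s.
Proof.
have h0 := mesh_gt0 R (ltn0Sn n); set h := mesh R n.+1 in h0 *.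
move=> /angle_arcP + /angle_arcP +; rewrite -/h => /andP[a1 a2] + dD kd.
(* Points of the arc [k.+1] steps away are at distance between [h k] and [h (k + 2)] from [x]. The 3
   in [chunk_side] gives [2 (k + 2) <= d - 1], which keeps them within [D / 2]. *)
have kd' : k.+1%:R * 2 + 3 <= d%:R :> R.
  rewrite -natrM -natrD ler_nat; move: kd; rewrite /chunk_side; lia.
have hk := ler_wpM2l (ltW h0) kd'.
have k0 : 0 <= h * k%:R by rewrite mulr_ge0// ltW.
rewrite -natr1 in hk.
have -> : (a + (-1) ^+ e * k.+1%:Z)%:~R = a%:~R + (-1) ^+ e * (k%:R + 1) :> R.
  by rewrite intrD intrM rmorph_sign -pmulrn natr1.
case: e => /=; rewrite ?expr1 ?expr0 ?mulN1r ?mul1r => /andP[z1 z2].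
  exists (x - z); last by ring.
  by apply/andP; split; lra.
exists (z - x); last by ring.
by apply/andP; split; lra.
Qed.

(** The corner inside the cap has the first angle of [p] and the second of [q], hence the starting
    arcs [a1] and [a2]. A point of [X] in one of these cells would violate the supporting
    inequality. *)
Lemma chunk_empty (R : realType) n (X : {fset 'rV[R]_4}) (w : 'rV[R]_4) b
    (p q : R * R) (a1 a2 : int) (d1 d2 : nat) :
  w != 0 -> (forall x, x \in X -> dotp w x <= b) ->
  dotp w (clifford_param p) = b -> dotp w (clifford_param q) = b ->
  dotp w (clifford_param (q.1, p.2)) <= dotp w (clifford_param p) ->
  angle_arc n.+1 a1 p.1 -> angle_arc n.+1 a2 q.2 ->
  mesh R n.+1 * (d1%:R - 1) < `|q.1 - p.1| <= pi ->
  mesh R n.+1 * (d2%:R - 1) < `|q.2 - p.2| <= pi ->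
  exists e1 e2 : bool, forall k l, (k < chunk_side d1)%N -> (l < chunk_side d2)%N ->
    npoints X (cell n.+1 (a1 + (-1) ^+ e1 * k.+1%:Z, a2 + (-1) ^+ e2 * l.+1%:Z)) = 0%N.
Proof.
move=> w0 wX wp wq wqp pa qa /andP[g1 h1] /andP[g2 h2].
have pos (d : nat) (D : R) : (0 < chunk_side d)%N -> mesh R n.+1 * (d%:R - 1) < D -> 0 < D.
  move=> kd; apply: le_lt_trans; rewrite mulr_ge0 ?(ltW (mesh_gt0 R _))//.
  by rewrite subr_ge0 ler1n; move: kd; rewrite /chunk_side; lia.
have [K1|K1] := posnP (chunk_side d1).
  by exists false, false => k l; rewrite K1.
have [K2|K2] := posnP (chunk_side d2).
  by exists false, false => k l _; rewrite K2.
have := @empty_rectangle R w b p.1 q.1 p.2 q.2 w0.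
rewrite -!surjective_pairing h1 h2 (pos _ _ K1 g1) (pos _ _ K2 g2).
case/(_ wp wq wqp isT isT) => e1 [e2 he]; exists e1, e2 => k l kd ld.
apply/npoints_eq0P => _ /[swap] -[z [/= z1 z2] <-] zX.
have [s hs zs] := chunk_step pa z1 g1 kd; have [t ht zt] := chunk_step qa z2 g2 ld.
have := he s t hs ht; rewrite -zs -zt -surjective_pairing => /lt_geF.
by rewrite wX.
Qed.

Definition chunk n (z : int * int) (e : bool * bool) (k : nat * nat) :
    {set 'I_n.+1 * 'I_n.+1} :=
  (fun ij : 'I_k.1 * 'I_k.2 => tcell n
     (z.1 + (-1) ^+ e.1 * (ij.1).+1%:Z, z.2 + (-1) ^+ e.2 * (ij.2).+1%:Z)) @: predT.

Lemma ocell_tcell (R : realType) n z : @ocell R n.+1 (tcell n z) = cell n.+1 z.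
Proof. by rewrite cell_cidx. Qed.

Lemma locate_ocell (R : realType) n (c : 'I_n.+1 * 'I_n.+1) (x y : 'rV[R]_4) :
  (0 < n)%N -> ocell c x -> clifford_torus y ->
  exists (s : bool * bool) (d : 'I_n.+1 * 'I_n.+1),
    [/\ ocell (tcell n (cshift c s (d.1 : nat, d.2 : nat))) y,
     mesh R n.+1 * (d.1%:R - 1) < arcdist1 x y < mesh R n.+1 * (d.1%:R + 1) &
     mesh R n.+1 * (d.2%:R - 1) < arcdist2 x y < mesh R n.+1 * (d.2%:R + 1)].
Proof.
move=> n0 [p [p1 p2] <-] ty.
have [q [s [d [-> [h1 h2] [a1 a2] g1 g2]]]] := locate n0 p1 p2 ty.
exists s, d; split.
- by rewrite ocell_tcell; exists q.
- by rewrite arcdist1C arcdist1E acos_cos_small.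
- by rewrite arcdist2C arcdist2E acos_cos_small.
Qed.

(** The part of the functional that depends on the first angle. Comparing it at the two endpoints
    decides which of the other two corners lies in the cap. *)
Definition form1 (R : realType) (w x : 'rV[R]_4) : R :=
  w 0 0 * x 0 0 + w 0 1 * x 0 1.

Lemma pair_config (R : realType) n (X : {fset 'rV[R]_4}) (w : 'rV[R]_4) b
    (c : 'I_n.+1 * 'I_n.+1) (x y : 'rV[R]_4) :
  (0 < n)%N -> [set` X] `<=` @clifford_torus R ->
  w != 0 -> (forall z, z \in X -> dotp w z <= b) ->
  y \in X -> dotp w x = b -> dotp w y = b ->
  form1 w y <= form1 w x -> ocell c x ->
  exists (s : bool * bool) (d : 'I_n.+1 * 'I_n.+1) (e : bool * bool),
    let z := cshift c s (d.1 : nat, d.2 : nat) in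
    [/\ ocell (tcell n z) y,
     forall c', c' \in chunk n (c.1%:Z, z.2) e (chunk_side d.1, chunk_side d.2) ->
       npoints X (ocell c') = 0%N,
     mesh R n.+1 * (d.1%:R - 1) < arcdist1 x y < mesh R n.+1 * (d.1%:R + 1) &
     mesh R n.+1 * (d.2%:R - 1) < arcdist2 x y < mesh R n.+1 * (d.2%:R + 1)].
Proof.
move=> n0 tX w0 wX yX + + + [p [p1 p2] xE]; rewrite -{}xE => wx + f1.
have [q [s [d [yE [h1 h2] [a1 a2] g1 g2]]]] := locate n0 p1 p2 (tX y yX).
rewrite {}yE in yX f1 * => wy.
have f1' : dotp w (clifford_param (q.1, p.2)) <= dotp w (clifford_param p).
  by move: f1; rewrite !dotp_clifford /form1 !mxE /= lerD2r.
have g1' : mesh R n.+1 * (d.1%:R - 1) < `|q.1 - p.1| <= pi.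
  by rewrite h1 andbT; case/andP: g1.
have g2' : mesh R n.+1 * (d.2%:R - 1) < `|q.2 - p.2| <= pi.
  by rewrite h2 andbT; case/andP: g2.
have [e1 [e2 he]] := chunk_empty w0 wX wx wy f1' p1 a2 g1' g2'.
exists s, d, (e1, e2); split.
- by rewrite ocell_tcell; exists q.
- by move=> c' /imsetP[[i j] _ ->]; rewrite ocell_tcell /=; apply: he.
- by rewrite arcdist1C arcdist1E acos_cos_small.
- by rewrite arcdist2C arcdist2E acos_cos_small.
Qed.

(* Components: the cell of x, the index distances of y from x in the two angles,
   and the signs giving the position of y and the directions of the rectangle. *)
Definition pair_index n : finType :=
  (('I_n.+1 * 'I_n.+1) * ('I_n.+1 * 'I_n.+1) * ((bool * bool) * (bool * bool)))%type.

Definition pair_cell n (i : pair_index n) : 'I_n.+1 * 'I_n.+1 :=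
  tcell n (cshift i.1.1 i.2.1 (i.1.2.1 : nat, i.1.2.2 : nat)).

Definition pair_chunk n (i : pair_index n) : {set 'I_n.+1 * 'I_n.+1} :=
  chunk n ((i.1.1).1%:Z, (cshift i.1.1 i.2.1 (i.1.2.1 : nat, i.1.2.2 : nat)).2)
    i.2.2 (chunk_side i.1.2.1, chunk_side i.1.2.2).

(** Distinctness of the two cells is what gives the event its factor [m ^ 2]. *)
Definition pair_event (R : realType) n (i : pair_index n) (X : {fset 'rV[R]_4}) :
    Prop :=
  i.1.1 != pair_cell i /\
  occupancy X (i.1.1 |: finset.set1 (pair_cell i)) (pair_chunk i).

(** Under this condition a cell identifies its point, so a tuple of cells identifies the face
    spanned. *)
Definition cell_separated (R : realType) n (X : {fset 'rV[R]_4}) : Prop :=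
  forall c : 'I_n.+1 * 'I_n.+1, (npoints X (ocell c) <= 1)%N.

Lemma separated_eq1 (R : realType) n (X : {fset 'rV[R]_4}) (c : 'I_n.+1 * 'I_n.+1) x :
  cell_separated n X -> x \in X -> ocell c x -> npoints X (ocell c) = 1%N.
Proof.
by move=> sX xX cx; apply/eqP; rewrite eqn_leq sX; apply: npoints_gt0 cx.
Qed.

Lemma separated_inj (R : realType) n (X : {fset 'rV[R]_4}) (c : 'I_n.+1 * 'I_n.+1) x y :
  cell_separated n X -> x \in X -> ocell c x -> y \in X -> ocell c y -> y = x.
Proof.
move=> sX xX cx yX cy; have [z [_ _ h]] := npoints_eq1 (separated_eq1 sX xX cx).
by rewrite (h y)// (h x).
Qed.

Lemma proper_face (R : realType) (S F : set 'rV[R]_4) x :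
  face (convex_hull S) F -> F <> convex_hull S -> F x ->
  exists w b, [/\ w != 0, forall z, S z -> dotp w z <= b &
    forall z, F z -> dotp w z = b].
Proof.
move=> [w [b [Kb FE]]] FK Fx; exists w, b; split.
- apply/eqP => w0; apply: FK; rewrite FE; apply/seteqP; split => [y []//|y Ky].
  split => //=; move: Fx; rewrite FE => -[_ /=].
  by rewrite w0 !dot0p.
- by move=> z Sz; apply: Kb; apply: sub_convex_hull.
- by move=> z; rewrite FE => -[].
Qed.

Lemma torus_ocell (R : realType) n (x : 'rV[R]_4) :
  clifford_torus x -> exists c : 'I_n.+1 * 'I_n.+1, ocell c x.
Proof.
move=> [p _ <-]; have [a pa] := arc_ex p.1 (ltn0Sn n).
have [b pb] := arc_ex p.2 (ltn0Sn n).
by exists (tcell n (a, b)); rewrite ocell_tcell; exists p.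
Qed.

Lemma nfaces1_le (R : realType) n (X : {fset 'rV[R]_4}) :
  (0 < n)%N -> [set` X] `<=` @clifford_torus R -> cell_separated n X ->
  (nfaces 1 X <= #|[pred i : pair_index n | `[< pair_event i X >]]|.+1)%N.
Proof.
move=> n0 tX sX.
apply: (@nfaces_le R X 1 _ _ (fun i : pair_index n => convex_hull [set` X] `&`
  affine_hull ([set` X] `&` (ocell i.1.1 `|` ocell (pair_cell i))))).
move=> F fF dF FK; have [x [y [[Fx xX] [Fy yX] xy FE]]] := edge_spanned fF dF.
have [w [b [w0 wX wF]]] := proper_face fF FK Fx.
wlog xy1 : x y Fx xX Fy yX xy FE / form1 w y <= form1 w x.
  move=> W; have [yx|/ltW yx] := leP (form1 w y) (form1 w x); first exact: (W x y).
  by apply: (W y x) => //; [rewrite eq_sym|rewrite setUC].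
have [c cx] := torus_ocell n (tX x xX).
have [s [d [e /= [cy ec _ _]]]] :=
  pair_config n0 tX w0 wX yX (wF x Fx) (wF y Fy) xy1 cx.
exists (c, d, (s, e)) => /=.
  apply/asboolP; split.
    apply: contraNneq xy => /= cc; rewrite cc in cx.
    by rewrite (separated_inj sX yX cy xX cx).
  split => // c'; rewrite !inE => /orP[/eqP ->|/eqP ->].
    exact: separated_eq1 xX cx.
  exact: separated_eq1 yX cy.
rewrite FE; congr (_ `&` affine_hull _); apply/seteqP; split => z /=.
  move=> [zX [cz|cz]]; first by left; apply: separated_inj cx zX cz.
  by right; apply: separated_inj cy zX cz.
by move=> [->|->]; split => //; [left|right].
Qed.

Definition triple_index n : finType :=
  (pair_index n * (('I_n.+1 * 'I_n.+1) * (bool * bool)))%type.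

Definition third_cell n (i : triple_index n) : 'I_n.+1 * 'I_n.+1 :=
  tcell n (cshift i.1.1.1 i.2.2 (i.2.1.1 : nat, i.2.1.2 : nat)).

(** An index distance fixes an angular distance up to one mesh, so a factor 2 between angles becomes
    [d' - 1 < 2 (d + 1)] between indices. *)
Definition triple_close n (i : triple_index n) : bool :=
  ((i.2.1.1 <= 2 * i.1.1.2.1 + 2) && (i.2.1.2 <= 2 * i.1.1.2.2 + 2))%N.

Definition triple_event (R : realType) n (i : triple_index n) (X : {fset 'rV[R]_4}) :
    Prop :=
  [/\ triple_close i, uniq [:: i.1.1.1; pair_cell i.1; third_cell i] &
  occupancy X (i.1.1.1 |: (pair_cell i.1 |: finset.set1 (third_cell i)))
    (pair_chunk i.1)].

Lemma arcdist_triangle (R : realType) (x y z : 'rV[R]_4) :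
  clifford_torus x -> clifford_torus y -> clifford_torus z ->
  arcdist1 x z <= arcdist1 x y + arcdist1 y z /\
  arcdist2 x z <= arcdist2 x y + arcdist2 y z.
Proof.
move=> [p _ <-] [q _ <-] [r _ <-].
by rewrite !arcdist1E !arcdist2E; split; exact: acos_cos_triangle.
Qed.

Lemma arcdist_ge0 (R : realType) (x y : 'rV[R]_4) :
  clifford_torus x -> clifford_torus y -> 0 <= arcdist1 x y /\ 0 <= arcdist2 x y.
Proof.
move=> [p _ <-] [q _ <-]; rewrite arcdist1E arcdist2E.
by split; apply: acos_ge0; rewrite cos_geN1 cos_le1.
Qed.

Lemma set3_swap (T : Type) (x y z : T) :
  [set x; y; z] = [set x; z; y] /\ [set x; y; z] = [set y; x; z].
Proof.
by split; apply/seteqP; split => t /=; tauto.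
Qed.

Lemma close_index (R : realType) n (d d' : nat) (D D' : R) :
  mesh R n.+1 * (d'%:R - 1) < D' -> D < mesh R n.+1 * (d%:R + 1) ->
  D' <= 2 * D -> (d' <= 2 * d + 2)%N.
Proof.
move=> h1 h2 h3; have h0 := mesh_gt0 R (ltn0Sn n).
have : mesh R n.+1 * (d'%:R - 1) < mesh R n.+1 * (2 * (d%:R + 1)) by lra.
rewrite ltr_pM2l// => h4.
have : (d'%:R : R) < (2 * d + 3)%N%:R by rewrite natrD natrM; lra.
by rewrite ltr_nat; lia.
Qed.

Lemma nfaces2_le (R : realType) n (X : {fset 'rV[R]_4}) :
  (0 < n)%N -> [set` X] `<=` @clifford_torus R -> cell_separated n X ->
  (nfaces 2 X <= #|[pred i : triple_index n | `[< triple_event i X >]]|.+1)%N.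
Proof.
move=> n0 tX sX.
apply: (@nfaces_le R X 2 _ _ (fun i : triple_index n => convex_hull [set` X] `&`
  affine_hull ([set` X] `&` (ocell i.1.1.1 `|` ocell (pair_cell i.1)
    `|` ocell (third_cell i))))).
move=> F fF dF FK.
have [x0 [y0 [z0 [Fx0 Fy0 Fz0 u0 FE0]]]] := ridge_spanned fF dF.
have [w [b [w0 wX wF]]] := proper_face fF FK Fx0.1.
have tF t : (F `&` [set` X]) t -> clifford_torus t by move=> [_ /tX].
have [x [y [z [xyz [dxz dyz] [dxz' dyz']]]]] :
    exists x y z, [/\ [/\ (F `&` [set` X]) x, (F `&` [set` X]) y,
      (F `&` [set` X]) z, uniq [:: x; y; z] &
      F = convex_hull [set` X] `&` affine_hull [set x; y; z]],
    arcdist1 x z <= 2 * arcdist1 x y /\ arcdist1 y z <= 2 * arcdist1 x y &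
    arcdist2 x z <= 2 * arcdist2 x y /\ arcdist2 y z <= 2 * arcdist2 x y].
  have tx := tF _ Fx0; have ty := tF _ Fy0; have tz := tF _ Fz0.
  (* [spread_pair] asks for nonnegative distances on the whole type, which is known only for points
     of the torus. Pairs of booleans index just the three points at hand. *)
  pose D1 (i j : bool * bool) := arcdist1 (if i.1 then x0 else if i.2 then y0 else z0)
    (if j.1 then x0 else if j.2 then y0 else z0).
  pose D2 (i j : bool * bool) := arcdist2 (if i.1 then x0 else if i.2 then y0 else z0)
    (if j.1 then x0 else if j.2 then y0 else z0).
  have tor (i : bool * bool) : clifford_torus (if i.1 then x0 else if i.2 then y0 else z0).
    by case: i => [[] []].
  have [i [j [k [ijk h1 h2]]]] : exists i j k, [/\
     [\/ (i, j, k) = ((true, true), (false, true), (false, false)),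
         (i, j, k) = ((true, true), (false, false), (false, true))
       | (i, j, k) = ((false, true), (false, false), (true, true))],
    D1 i k <= 2 * D1 i j /\ D1 j k <= 2 * D1 i j &
    D2 i k <= 2 * D2 i j /\ D2 j k <= 2 * D2 i j].
    apply: spread_pair => [i j|i j||]; rewrite /D1 /D2.
    - by rewrite arcdist1C; split => //; apply: (arcdist_ge0 _ _).1.
    - by rewrite arcdist2C; split => //; apply: (arcdist_ge0 _ _).2.
    - by split; apply: (arcdist_triangle _ _ _).1.
    - by split; apply: (arcdist_triangle _ _ _).2.
  have [e1 e2] := set3_swap x0 y0 z0.
  have [e3 e4] := set3_swap y0 x0 z0.
  move: u0; rewrite /= !inE !negb_or !andbT => /andP[/andP[n1 n2] n3].
  case: ijk h1 h2 => -[-> -> ->] h1 h2.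
  - exists x0, y0, z0; split => //; split => //.
    by rewrite /= !inE negb_or n1 n2 n3.
  - exists x0, z0, y0; split => //; split => //; last by rewrite -e1.
    by rewrite /= !inE negb_or n1 n2 eq_sym n3.
  - exists y0, z0, x0; split => //; split => //; last by rewrite -e3 -e2.
    by rewrite /= !inE negb_or n3 eq_sym n1 eq_sym n2.
wlog xy1 : x y xyz dxz dyz dxz' dyz' / form1 w y <= form1 w x.
  move=> W; have [yx|/ltW yx] := leP (form1 w y) (form1 w x); first exact: (W x y).
  apply: (W y x) => //; rewrite ?[arcdist1 y x]arcdist1C ?[arcdist2 y x]arcdist2C//.
  move: xyz => [Fx Fy Fz u FE]; split => //; last by rewrite -(set3_swap x y z).2.
  by move: u; rewrite /= !inE !negb_or [y == x]eq_sym => /and3P[/andP[-> ->] -> _].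
move: xyz => [[Fx xX] [Fy yX] [Fz zX]].
rewrite /= !inE !negb_or !andbT => /andP[/andP[xy xz] yz] FE.
have [c cx] := torus_ocell n (tX x xX).
have [s [d [e /= [cy ec /andP[_ g1] /andP[_ g2]]]]] :=
  pair_config n0 tX w0 wX yX (wF x Fx) (wF y Fy) xy1 cx.
have [t [d' [cz /andP[g1' _] /andP[g2' _]]]] := locate_ocell n0 cx (tX z zX).
exists (c, d, (s, e), (d', t)) => /=.
  apply/asboolP; split.
  - by rewrite /triple_close /= (close_index g1' g1 dxz) (close_index g2' g2 dxz').
  - have ne (u v : 'rV[R]_4) (cu cv : 'I_n.+1 * 'I_n.+1) : u \in X -> v \in X ->
        ocell cu u -> ocell cv v -> u != v -> cu != cv.
      move=> uX vX cuu cvv uv; apply: contraNneq uv => cc; rewrite cc in cuu.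
      by rewrite (separated_inj sX uX cuu vX cvv).
    rewrite /= !inE !negb_or !andbT (ne x y _ _ xX yX cx cy xy).
    by rewrite (ne x z _ _ xX zX cx cz xz) (ne y z _ _ yX zX cy cz yz).
  split => // c'; rewrite !inE => /or3P[/eqP ->|/eqP ->|/eqP ->].
  - exact: separated_eq1 xX cx.
  - exact: separated_eq1 yX cy.
  - exact: separated_eq1 zX cz.
rewrite FE; congr (_ `&` affine_hull _); apply/seteqP; split => v /=.
  move=> [vX [[cv|cv]|cv]].
  - by left; left; apply: separated_inj cx vX cv.
  - by left; right; apply: separated_inj cy vX cv.
  - by right; apply: separated_inj cz vX cv.
by move=> [[->|->]|->]; split => //; [left; left|left; right|right].
Qed.

(** * Upper bound: expectations *)

Lemma sum_divn (R : realType) (F : nat -> R) (M k : nat) : (0 < k)%N ->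
  \sum_(0 <= d < M * k) F (d %/ k)%N = k%:R * \sum_(0 <= a < M) F a.
Proof.
move=> k0; elim: M => [|M IH]; first by rewrite mul0n !big_geq ?mulr0.
rewrite mulSnr (big_cat_nat (leq0n _) (leq_addr k (M * k)))/= IH.
rewrite big_nat_recr //= mulrDr; congr (_ + _).
rewrite -{1}[(M * k)%N]add0n big_addn addKn.
rewrite (eq_big_nat _ _ (F2 := fun=> F M)); last first.
  by move=> i /andP[_ ik]; rewrite addnC divnMDl// divn_small// addn0.
by rewrite big_const_nat subn0 iter_addr_0 mulr_natl.
Qed.

Lemma harmonic_ge (R : realType) (M : nat) :
  ln (M.+1%:R : R) <= \sum_(1 <= a < M.+1) (a%:R : R)^-1.
Proof.
elim: M => [|M IH]; first by rewrite big_geq// ln1.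
rewrite big_nat_recr//=; apply: le_trans (lerD IH (lexx _)).
have M0 : (0 : R) < M.+1%:R by rewrite ltr0n.
have -> : (M.+2%:R : R) = M.+1%:R * (1 + M.+1%:R^-1).
  by rewrite mulrDr mulr1 divff ?gt_eqF// natr1.
have i0 : 0 < (M.+1%:R : R)^-1 by rewrite invr_gt0.
rewrite lnM ?posrE ?addr_gt0// lerD2l; apply: le_ln1Dx.
by apply: lt_trans i0; lra.
Qed.

Lemma harmonic_le (R : realType) (M : nat) :
  \sum_(1 <= a < M.+2) (a%:R : R)^-1 <= 1 + ln (M.+1%:R : R).
Proof.
elim: M => [|M IH]; first by rewrite big_nat1 invr1 ln1 addr0.
rewrite big_nat_recr//=; apply: le_trans (lerD IH (lexx _)) _.
rewrite -addrA lerD2l.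
have M0 : (0 : R) < M.+1%:R by rewrite ltr0n.
have M2 : (0 : R) < M.+2%:R by rewrite ltr0n.
have e : (M.+1%:R : R) = M.+2%:R * (1 + - M.+2%:R^-1).
  by rewrite mulrDr mulr1 mulrN divff ?gt_eqF// -[M.+2%:R]natr1 addrK.
have i1 : (M.+2%:R : R)^-1 < 1 by rewrite invf_lt1// ltr1n.
have q0 : 0 < 1 + - M.+2%:R^-1 :> R by rewrite subr_gt0.
rewrite e lnM ?posrE// -addrA gerDl addrC -lerBrDl sub0r; apply: le_ln1Dx;
    rewrite ltrN2; exact: i1.
Qed.

(** With [q = expR (- t)], [q (1 + t) <= 1] gives [1 - q >= t / (1 + t) >= t / 2]. *)
Lemma geometric_le (R : realType) (t : R) (M : nat) : 0 < t <= 1 ->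
  \sum_(0 <= j < M) expR (- (t * j%:R)) <= 2 / t.
Proof.
move=> /andP[t0 t1]; pose q := expR (- t).
have qt : q * (1 + t) <= 1.
  have := expR_ge1Dx t; have := expRxMexpNx_1 t; have := expR_gt0 (- t).
  by rewrite -/q; nra.
have q0 : 0 < q by apply: expR_gt0.
have q1 : t / 2 <= 1 - q by nra.
have -> : \sum_(0 <= j < M) expR (- (t * j%:R)) = \sum_(0 <= j < M) q ^+ j.
  by apply: eq_bigr => j _; rewrite /q -expRM_natr mulNr.
rewrite ler_pdivlMr//.
have : (\sum_(0 <= j < M) q ^+ j) * (1 - q) <= 1.
  rewrite big_mkord mulrC -opprB mulNr -subrX1 opprB gerDl oppr_le0.
  by rewrite exprn_ge0// ltW.
have : 0 <= \sum_(0 <= j < M) q ^+ j.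
  by apply: sumr_ge0 => j _; rewrite exprn_ge0// ltW.
nra.
Qed.

(** The source of the logarithm in the upper bound. The row [a = 0] contributes [M.+1]; a row
    [a > 0] is geometric with sum at most [8 M.+1 / a], and the harmonic sum over [a] follows. *)
Lemma product_sum_le (R : realType) (M : nat) :
  \sum_(0 <= a < M.+1) \sum_(0 <= b < M.+1)
     expR (- (a%:R * b%:R / (4 * M.+1%:R) : R)) <=
  9 * M.+1%:R + 8 * M.+1%:R * ln (M.+1%:R : R).
Proof.
have M0 : (0 : R) < M.+1%:R by rewrite ltr0n.
rewrite big_nat_recl//= [leLHS]addrC.
have -> : \sum_(0 <= b < M.+1) expR (- (0%:R * b%:R / (4 * M.+1%:R) : R)) = M.+1%:R.
  rewrite (eq_bigr (fun=> 1)); last by move=> b _; rewrite !mul0r oppr0 expR0.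
  by rewrite big_const_nat subn0 iter_addr_0.
have : \sum_(0 <= a < M) \sum_(0 <= b < M.+1)
     expR (- (a.+1%:R * b%:R / (4 * M.+1%:R) : R)) <=
     8 * M.+1%:R * \sum_(0 <= a < M) (a.+1%:R : R)^-1.
  rewrite big_distrr /= !big_nat; apply: ler_sum => a /andP[_ aM].
  have a0 : (0 : R) < a.+1%:R by rewrite ltr0n.
  have -> : 8 * M.+1%:R * a.+1%:R^-1 = 2 / (a.+1%:R / (4 * M.+1%:R)) :> R.
    by field; rewrite !gt_eqF.
  apply: le_trans (@geometric_le R (a.+1%:R / (4 * M.+1%:R)) M.+1 _).
    apply: ler_sum => b _; rewrite ler_expR lerN2 le_eqVlt; apply/orP; left.
    by apply/eqP; ring.
  rewrite divr_gt0//= ?mulr_gt0// ler_pdivrMr ?mulr_gt0// mul1r.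
  have : (a.+1%:R : R) <= M.+1%:R by rewrite ler_nat ltnW.
  by lra.
have : \sum_(0 <= a < M) (a.+1%:R : R)^-1 <= 1 + ln M.+1%:R.
  apply: le_trans (harmonic_le R M);
      rewrite -(big_add1 _ _ 0 M.+1 xpredT (fun a => (a%:R : R)^-1)).
  by rewrite [leRHS]big_nat_recr//= lerDl invr_ge0.
nra.
Qed.

(** If the quotient is nonzero then [d >= k >= 8], so [4 * chunk_side d >= 2 d - 8 >= d]; the
    threshold 8 absorbs the rounding in [chunk_side]. *)
Lemma chunk_side_ge (k d : nat) : (8 <= k)%N -> (k * (d %/ k) <= 4 * chunk_side d)%N.
Proof.
move=> k8; rewrite /chunk_side; have := leq_trunc_div d k; rewrite mulnC.
have [->|] := posnP (d %/ k)%N; first by rewrite muln0.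
move: (d %/ k)%N => a a0 h; have : (8 <= k * a)%N by rewrite -[8%N]muln1 leq_mul.
by lia.
Qed.

Lemma cidx_eq n (a b : int) : cidx n a = cidx n b -> (n.+1%:Z %| a - b)%Z.
Proof.
move=> e; have /eqP := congr1 (fun i : 'I_n.+1 => i%:Z) e.
by rewrite !cidxE eqz_mod_dvd.
Qed.

Lemma cidx_step_inj n (a : int) (e : bool) (i j : nat) : (i < n.+1)%N -> (j < n.+1)%N ->
  cidx n (a + (-1) ^+ e * i.+1%:Z) = cidx n (a + (-1) ^+ e * j.+1%:Z) -> i = j.
Proof.
move=> iN jN /cidx_eq.
have -> : a + (-1) ^+ e * i.+1%:Z - (a + (-1) ^+ e * j.+1%:Z) =
          (-1) ^+ e * (i%:Z - j%:Z) by rewrite !intS; ring.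
rewrite dvdzE abszMsign absz_nat => dv; apply/eqP; case: eqVneq => // ij.
by move: dv; rewrite gtnNdvd//; lia.
Qed.

(** Sides of at most [n] cells keep the rectangle from wrapping around a circle onto itself. *)
Lemma card_chunk n z e (k : nat * nat) : (k.1 <= n)%N -> (k.2 <= n)%N ->
  #|chunk n z e k| = (k.1 * k.2)%N.
Proof.
move=> k1 k2; rewrite card_imset ?card_prod ?card_ord//.
move=> [i j] [i' j'] [] /= h1 h2; congr pair; apply: val_inj => /=.
  by apply: cidx_step_inj h1; apply: leq_trans (ltn_ord _) (leqW k1).
by apply: cidx_step_inj h2; apply: leq_trans (ltn_ord _) (leqW k2).
Qed.

(* Grouping indices in blocks of [k] bounds the sums over the grid by sums over
   [M.+1] blocks, uniformly in [k]; [M.+1] is of order lambda. *)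
Lemma coarse_exp (R : realType) (M k d1 d2 : nat) (m : R) :
  (8 <= k)%N -> 0 <= m -> 8 <= m * k%:R ^+ 2 * M.+1%:R ->
  (d1 %/ k)%:R * (d2 %/ k)%:R / (2 * M.+1%:R) <=
    m * (chunk_side d1)%:R * (chunk_side d2)%:R.
Proof.
move=> k8 m0 mk; have M0 : (0 : R) < M.+1%:R by rewrite ltr0n.
have h1 : k%:R * (d1 %/ k)%:R <= 4 * (chunk_side d1)%:R :> R.
  by rewrite -!natrM ler_nat chunk_side_ge.
have h2 : k%:R * (d2 %/ k)%:R <= 4 * (chunk_side d2)%:R :> R.
  by rewrite -!natrM ler_nat chunk_side_ge.
set a := (_ %/ k)%:R in h1 *; set b := (_ %/ k)%:R in h2 *.
set K := (chunk_side d1)%:R in h1 *; set L := (chunk_side d2)%:R in h2 *.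
have a0 : 0 <= a by rewrite ler0n. have b0 : 0 <= b by rewrite ler0n.
have K0 : 0 <= k%:R :> R by rewrite ler0n.
have h : (k%:R * a) * (k%:R * b) <= (4 * K) * (4 * L).
  by apply: ler_pM => //; apply: mulr_ge0.
rewrite ler_pdivrMr ?mulr_gt0//.
have h3 : m * M.+1%:R * ((k%:R * a) * (k%:R * b)) <= m * M.+1%:R * ((4 * K) * (4 * L)).
  by apply: ler_wpM2l => //; rewrite mulr_ge0 ?ler0n.
have h4 : 8 * (a * b) <= m * k%:R ^+ 2 * M.+1%:R * (a * b).
  by apply: ler_wpM2r => //; apply: mulr_ge0.
nra.
Qed.

(** The left side counts the cells for the third point, times [m]. With [a], [b] the block indices
    and [t = a b / M.+1], this weight is at most [9 * 64 (t + 2)]; the exponential is at most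
    [expR (- t / 2)], half of which absorbs [t + 2] at the cost of a factor 4. *)
Lemma coarse_weight (R : realType) (M k d1 d2 : nat) (m : R) :
  (8 <= k)%N -> 0 <= m -> 8 <= m * k%:R ^+ 2 * M.+1%:R <= 64 ->
  (d1 < M.+1 * k)%N -> (d2 < M.+1 * k)%N ->
  (2 * d1 + 3)%N%:R * (2 * d2 + 3)%N%:R * m *
    expR (- (m * (chunk_side d1)%:R * (chunk_side d2)%:R)) <=
  2304 * expR (- ((d1 %/ k)%:R * (d2 %/ k)%:R / (4 * M.+1%:R))).
Proof.
move=> k8 m0 /andP[mk1 mk2] dM1 dM2; have M0 : (0 : R) < M.+1%:R by rewrite ltr0n.
have k0 : (0 < k)%N by apply: leq_trans k8.
have le1 (d : nat) : (d < M.+1 * k)%N ->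
    (2 * d + 3)%N%:R <= 3 * k%:R * ((d %/ k)%:R + 1) :> R.
  move=> dM; rewrite natr1 -!natrM ler_nat.
  have := ltn_ceil d k0; rewrite mulSn; nia.
have aM (d : nat) : (d < M.+1 * k)%N -> (d %/ k)%:R + 1 <= M.+1%:R :> R.
  by move=> dM; rewrite natr1 ler_nat ltn_divLR.
have e1 := coarse_exp d1 d2 k8 m0 mk1.
move: (le1 _ dM1) (le1 _ dM2) (aM _ dM1) (aM _ dM2) e1.
set a := (d1 %/ k)%:R; set b := (d2 %/ k)%:R; set D1 := (_ + _)%:R; set D2 := (_ + _)%:R.
move=> h1 h2 a1 b1 e1.
have a0 : 0 <= a by rewrite ler0n. have b0 : 0 <= b by rewrite ler0n.
pose t := a * b / M.+1%:R.
have t0 : 0 <= t by rewrite divr_ge0 ?mulr_ge0// ltW.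
have w1 : D1 * D2 * m <= 576 * (t + 2).
  have p1 : D1 * D2 <= (3 * k%:R * (a + 1)) * (3 * k%:R * (b + 1)).
    by apply: ler_pM => //; rewrite ler0n.
  have p2 : D1 * D2 * m <= 9 * (m * k%:R ^+ 2) * ((a + 1) * (b + 1)).
    by apply: le_trans (ler_wpM2r m0 p1) _; rewrite le_eqVlt; apply/orP; left;
        apply/eqP; ring.
  apply: (le_trans p2); rewrite -(ler_pM2r M0).
  have -> : 576 * (t + 2) * M.+1%:R = 576 * (a * b + 2 * M.+1%:R).
    by rewrite /t; field; rewrite gt_eqF.
  have ab : (a + 1) * (b + 1) <= a * b + 2 * M.+1%:R by lra.
  have ab0 : 0 <= (a + 1) * (b + 1) by apply: mulr_ge0; lra.
  have : m * k%:R ^+ 2 * M.+1%:R * ((a + 1) * (b + 1)) <= 64 * ((a + 1) * (b + 1)).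
    exact: ler_wpM2r.
  lra.
have -> : a * b / (4 * M.+1%:R) = t / 4 by rewrite /t; field; rewrite gt_eqF.
have {}e1 : expR (- (m * (chunk_side d1)%:R * (chunk_side d2)%:R)) <=
    expR (- (t / 4)) * expR (- (t / 4)).
  rewrite -expRD ler_expR; suff -> : - (t / 4) - t / 4 = - (a * b / (2 * M.+1%:R)).
    by rewrite lerN2.
  by rewrite /t; field; rewrite gt_eqF.
have E := expRxMexpNx_1 (t / 4); have E1 := expR_ge1Dx (t / 4).
have E0 := expR_gt0 (- (t / 4)).
move: E E1 E0 e1; set q := expR (- (t / 4)); set r := expR (t / 4) => E E1 E0 e1.
have q1 : (t + 2) * q <= 4.
  have : 4 * (r * q) = 4 by rewrite E mulr1.
  have : (t + 2) * q <= 4 * r * q by apply: ler_wpM2r; lra.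
  lra.
apply: (@le_trans _ _ (576 * (t + 2) * (q * q))).
  by apply: ler_pM; rewrite ?mulr_ge0 ?ler0n ?expR_ge0.
have : 576 * q * ((t + 2) * q) <= 576 * q * 4 by apply: ler_wpM2l; lra.
lra.
Qed.

Lemma sum_fst (R : realType) (A B : finType) (f : A -> R) :
  \sum_(i : A * B) f i.1 = (\sum_a f a) * #|B|%:R.
Proof.
rewrite -(pair_bigA _ (fun a (_ : B) => f a)) /= mulr_suml.
by apply: eq_bigr => a _; rewrite sumr_const mulr_natr.
Qed.

Lemma sum_snd (R : realType) (A B : finType) (f : B -> R) :
  \sum_(i : A * B) f i.2 = #|A|%:R * \sum_b f b.
Proof.
rewrite -(pair_bigA _ (fun (_ : A) b => f b)) /= exchange_big /= mulr_sumr.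
by apply: eq_bigr => a _; rewrite sumr_const mulr_natl.
Qed.

Lemma coarse_sum (R : realType) (M k n : nat) : (0 < k)%N -> n.+1 = (M.+1 * k)%N ->
  \sum_(d : 'I_n.+1 * 'I_n.+1)
    expR (- ((d.1 %/ k)%:R * (d.2 %/ k)%:R / (4 * M.+1%:R) : R)) <=
  k%:R ^+ 2 * (9 * M.+1%:R + 8 * M.+1%:R * ln (M.+1%:R : R)).
Proof.
move=> k0 nE; pose f (a b : nat) : R := expR (- (a%:R * b%:R / (4 * M.+1%:R))).
rewrite -(pair_bigA _ (fun d1 d2 : 'I_n.+1 => f (d1 %/ k)%N (d2 %/ k)%N)) /=.
have -> : \sum_(d1 < n.+1) \sum_(d2 < n.+1) f (d1 %/ k)%N (d2 %/ k)%N =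
    k%:R ^+ 2 * \sum_(0 <= a < M.+1) \sum_(0 <= b < M.+1) f a b.
  rewrite (eq_bigr (fun d1 : 'I_n.+1 => k%:R * \sum_(0 <= b < M.+1) f (d1 %/ k)%N b)).
    rewrite -mulr_sumr expr2 -mulrA; congr (_ * _).
    rewrite -(big_mkord xpredT (fun d1 => \sum_(0 <= b < M.+1) f (d1 %/ k)%N b)) nE.
    by rewrite (sum_divn (fun a => \sum_(0 <= b < M.+1) f a b)).
  move=> d1 _; move: (d1 %/ k)%N => a.
  by rewrite -(big_mkord xpredT (fun d2 => f a (d2 %/ k)%N)) nE sum_divn.
by apply: ler_wpM2l; [exact: sqr_ge0|exact: product_sum_le].
Qed.

Lemma chunk_side_le n (d : 'I_n.+1) : (chunk_side d <= n)%N.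
Proof. by rewrite /chunk_side; have := ltn_ord d; lia. Qed.

Lemma card_pair_chunk n (i : pair_index n) :
  #|pair_chunk i| = (chunk_side i.1.2.1 * chunk_side i.1.2.2)%N.
Proof. by rewrite card_chunk ?chunk_side_le. Qed.

Lemma prob_pair_event (R : realType) d (Omega : measurableType d)
    (P : probability Omega R) lambda (X : Omega -> {fset 'rV[R]_4}) n
    (i : pair_index n) (m := lambda * mesh R n.+1 ^+ 2) :
  poisson_point_process P lambda X -> (0 < n)%N -> 0 < lambda ->
  measurable [set w | pair_event i (X w)] /\
  (P [set w | pair_event i (X w)] <= (m ^+ 2 *
    expR (- (m * (chunk_side i.1.2.1)%:R * (chunk_side i.1.2.2)%:R)))%:E)%E.
Proof.
move=> hX n0 l0; have m0 : 0 <= m by rewrite mulr_ge0 ?sqr_ge0 ?ltW.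
have [AB|AB] := boolP (i.1.1 != pair_cell i); last first.
  rewrite (_ : [set w | _] = set0); last by apply/seteqP; split => w // -[];
      rewrite (negbTE AB).
  by rewrite measure0 lee_fin mulr_ge0 ?expR_ge0 ?sqr_ge0.
rewrite (_ : [set w | _] = [set w | occupancy (X w)
  (i.1.1 |: finset.set1 (pair_cell i)) (pair_chunk i)]); last first.
  by apply/seteqP; split => w; [case|split].
split; first exact: measurable_occupancy hX _.
apply: le_trans (prob_occupancy_le _ _ hX _ l0) _ => //.
by rewrite cardsU1 cards1 inE AB card_pair_chunk natrM mulrA.
Qed.

Lemma prob_triple_event (R : realType) d (Omega : measurableType d)
    (P : probability Omega R) lambda (X : Omega -> {fset 'rV[R]_4}) n
    (i : triple_index n) (m := lambda * mesh R n.+1 ^+ 2) :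
  poisson_point_process P lambda X -> (0 < n)%N -> 0 < lambda ->
  measurable [set w | triple_event i (X w)] /\
  (P [set w | triple_event i (X w)] <= ((triple_close i)%:R * (m ^+ 3 *
    expR (- (m * (chunk_side i.1.1.2.1)%:R * (chunk_side i.1.1.2.2)%:R))))%:E)%E.
Proof.
move=> hX n0 l0; have m0 : 0 <= m by rewrite mulr_ge0 ?sqr_ge0 ?ltW.
have [/andP[cl AB]|AB] := boolP (triple_close i &&
    uniq [:: i.1.1.1; pair_cell i.1; third_cell i]); last first.
  rewrite (_ : [set w | _] = set0); last first.
    by apply/seteqP; split => w // -[c u _]; move: AB; rewrite c u.
  split => //; rewrite measure0 lee_fin; apply: mulr_ge0; first exact: ler0n.
  by apply: mulr_ge0; [exact: exprn_ge0|exact: expR_ge0].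
rewrite (_ : [set w | _] = [set w | occupancy (X w)
  (i.1.1.1 |: (pair_cell i.1 |: finset.set1 (third_cell i))) (pair_chunk i.1)]).
  split; first exact: measurable_occupancy hX _.
  apply: le_trans (prob_occupancy_le _ _ hX _ l0) _ => //.
  move: AB; rewrite /= !inE negb_or !andbT => /andP[/andP[h1 h2] h3].
  rewrite !cardsU1 cards1 !inE (negbTE h1) (negbTE h2) (negbTE h3) cl mul1r.
  by rewrite card_pair_chunk natrM mulrA.
by apply/seteqP; split => w; [case|split].
Qed.

Lemma sum_le_count (R : realType) (N c : nat) :
  \sum_(x < N) (x <= c)%N%:R <= c.+1%:R :> R.
Proof.
rewrite -natr_sum ler_nat -(big_mkord xpredT (fun x => (x <= c)%N : nat)).
have [Nc|cN] := leqP N c.+1.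
  rewrite (leq_trans _ Nc)//; apply: (@leq_trans (\sum_(0 <= x < N) 1)).
    by apply: leq_sum => x _; exact: leq_b1.
  by rewrite sum_nat_const_nat muln1 subn0.
rewrite (big_cat_nat (leq0n _) (ltnW cN))/=.
rewrite [X in (_ + X)%N]big_nat_cond [X in (_ + X)%N]big1; last first.
  by move=> x /andP[/andP[cx _] _]; rewrite leqNgt cx.
rewrite addn0; apply: (@leq_trans (\sum_(0 <= x < c.+1) 1)).
  by apply: leq_sum => x _; exact: leq_b1.
by rewrite sum_nat_const_nat muln1 subn0.
Qed.

Lemma sum_pair_events (R : realType) d (Omega : measurableType d)
    (P : probability Omega R) lambda (X : Omega -> {fset 'rV[R]_4}) M k n
    (m := lambda * mesh R n.+1 ^+ 2) :
  poisson_point_process P lambda X -> (0 < n)%N -> 0 < lambda ->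
  (8 <= k)%N -> n.+1 = (M.+1 * k)%N -> 8 <= m * k%:R ^+ 2 * M.+1%:R <= 64 ->
  (\sum_(i : pair_index n) P [set w | pair_event i (X w)] <=
   (16 * 64 ^+ 2 * (9 * M.+1%:R + 8 * M.+1%:R * ln (M.+1%:R)))%:E)%E.
Proof.
move=> hX n0 l0 k8 nE /andP[mk1 mk2].
have m0 : 0 <= m by rewrite mulr_ge0 ?sqr_ge0 ?ltW.
have k0 : (0 < k)%N by apply: leq_trans k8.
apply: (@le_trans _ _ (\sum_(i : pair_index n) (m ^+ 2 *
    expR (- (m * (chunk_side i.1.2.1)%:R * (chunk_side i.1.2.2)%:R)))%:E)%E).
  by apply: lee_sum => i _; exact: (prob_pair_event i hX n0 l0).2.
rewrite sumEFin lee_fin -mulr_sumr.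
pose f (d : 'I_n.+1 * 'I_n.+1) := expR (- (m * (chunk_side d.1)%:R * (chunk_side d.2)%:R)).
rewrite (@sum_fst R _ _ (fun u => f u.2)) (@sum_snd R _ _ f).
rewrite !card_prod !card_bool !card_ord.
have : \sum_b f b <= k%:R ^+ 2 * (9 * M.+1%:R + 8 * M.+1%:R * ln (M.+1%:R : R)).
  apply: le_trans (coarse_sum R k0 nE); apply: ler_sum => b _.
  (* Weakening the denominator [2 * M.+1] of [coarse_exp] to [4 * M.+1] lets pairs and triples share
     the same sum. *)
  rewrite ler_expR lerN2; apply: le_trans (coarse_exp b.1 b.2 k8 m0 mk1).
  rewrite !invfM !mulrA ler_wpM2r ?invr_ge0//.
  by rewrite ler_wpM2l ?mulr_ge0// lef_pV2 ?posrE//; lra.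
set S := _ + _ => fS.
have S0 : 0 <= S.
  by rewrite addr_ge0 ?mulr_ge0// ln_ge0// ler1n.
(* Since [n.+1 = M.+1 * k], the left side is the square of [m k ^ 2 M.+1], free of the mesh. *)
have e1 : m ^+ 2 * (n.+1 * n.+1)%N%:R * k%:R ^+ 2 <= 64 ^+ 2.
  rewrite nE !natrM; set u := m * _ * _ in mk1 mk2.
  have -> : m ^+ 2 * (M.+1%:R * k%:R * (M.+1%:R * k%:R)) * k%:R ^+ 2 = u ^+ 2.
    by rewrite /u; ring.
  by rewrite lerXn2r ?nnegrE//; lra.
have -> : (2 * 2 * (2 * 2))%N%:R = 16 :> R by [].
have h := ler_wpM2l (mulr_ge0 (exprn_ge0 2 m0) (ler0n _ (n.+1 * n.+1))) fS.
have h2 := ler_wpM2r S0 e1.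
rewrite !mulrA; move: h h2; rewrite !mulrA.
lra.
Qed.

Lemma sum_triple_events (R : realType) d (Omega : measurableType d)
    (P : probability Omega R) lambda (X : Omega -> {fset 'rV[R]_4}) M k n
    (m := lambda * mesh R n.+1 ^+ 2) :
  poisson_point_process P lambda X -> (0 < n)%N -> 0 < lambda ->
  (8 <= k)%N -> n.+1 = (M.+1 * k)%N -> 8 <= m * k%:R ^+ 2 * M.+1%:R <= 64 ->
  (\sum_(i : triple_index n) P [set w | triple_event i (X w)] <=
   (64 * 2304 * 64 ^+ 2 * (9 * M.+1%:R + 8 * M.+1%:R * ln (M.+1%:R)))%:E)%E.
Proof.
move=> hX n0 l0 k8 nE /[dup] mk /andP[mk1 mk2].
have m0 : 0 <= m by rewrite mulr_ge0 ?sqr_ge0 ?ltW.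
have k0 : (0 < k)%N by apply: leq_trans k8.
pose E (d : 'I_n.+1 * 'I_n.+1) := expR (- (m * (chunk_side d.1)%:R * (chunk_side d.2)%:R)).
pose c (d : 'I_n.+1 * 'I_n.+1) : R :=
  expR (- ((d.1 %/ k)%:R * (d.2 %/ k)%:R / (4 * M.+1%:R) : R)).
apply: (@le_trans _ _ (\sum_(i : triple_index n) ((triple_close i)%:R *
    (m ^+ 3 * E i.1.1.2))%:E)%E).
  by apply: lee_sum => i _; exact: (prob_triple_event i hX n0 l0).2.
rewrite sumEFin lee_fin.
(* The third point is summed out first: 4 sign choices, and the factor 2304 of [coarse_weight] for
   its position and one power of [m]. *)
apply: (@le_trans _ _ (\sum_(p : pair_index n) 4 * 2304 * m ^+ 2 * c p.1.2)).
  rewrite -(pair_bigA _ (fun (p : pair_index n) (q : ('I_n.+1 * 'I_n.+1) * (bool * bool)) =>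
    (triple_close (p, q))%:R * (m ^+ 3 * E p.1.2))) /=.
  apply: ler_sum => p _; rewrite -mulr_suml.
  rewrite (@sum_fst R _ _ (fun u : 'I_n.+1 * 'I_n.+1 =>
    ((u.1 <= 2 * p.1.2.1 + 2)%N && (u.2 <= 2 * p.1.2.2 + 2)%N)%:R)).
  rewrite -(pair_bigA _ (fun u v : 'I_n.+1 =>
    ((u <= 2 * p.1.2.1 + 2)%N && (v <= 2 * p.1.2.2 + 2)%N)%:R)) /=.
  set S := \sum_i _; have hS : S <= (2 * p.1.2.1 + 3)%N%:R * (2 * p.1.2.2 + 3)%N%:R.
    rewrite /S; under eq_bigr => u _ do
      (under eq_bigr => v _ do rewrite -mulnb natrM; rewrite -mulr_sumr).
    rewrite -mulr_suml !addnS; apply: ler_pM; rewrite ?sumr_ge0//.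
      exact: sum_le_count.
    exact: sum_le_count.
  have [d1 d2] : (p.1.2.1 < M.+1 * k)%N /\ (p.1.2.2 < M.+1 * k)%N by rewrite -nE.
  have := coarse_weight k8 m0 mk d1 d2; rewrite -/(E p.1.2) -/(c p.1.2).
  rewrite card_prod !card_bool; have E0 : 0 <= E p.1.2 by apply: expR_ge0.
  have m2 : 0 <= 4 * m ^+ 2 by rewrite mulr_ge0 ?sqr_ge0.
  move=> /(ler_wpM2l m2) h; rewrite -[leRHS]mulrA -[leRHS]mulrA.
  have := ler_wpM2r (mulr_ge0 (exprn_ge0 3 m0) E0) (ler_wpM2r (ler0n R (2 * 2)) hS).
  move/le_trans; apply.
  rewrite [leLHS](_ : _ = 4 * m ^+ 2 * ((2 * p.1.2.1 + 3)%N%:R * (2 * p.1.2.2 + 3)%N%:R * m * E p.1.2)).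
    by apply: (le_trans h); rewrite le_eqVlt; apply/orP; left; apply/eqP; ring.
  by have -> : (2 * 2)%N%:R = 4 :> R by []; ring.
rewrite -mulr_sumr (@sum_fst R _ _ (fun u => c u.2)) (@sum_snd R _ _ c).
rewrite !card_prod !card_bool !card_ord.
have : \sum_b c b <= k%:R ^+ 2 * (9 * M.+1%:R + 8 * M.+1%:R * ln (M.+1%:R : R)).
  exact: coarse_sum k0 nE.
set S := _ + _ => fS.
have S0 : 0 <= S.
  by rewrite addr_ge0 ?mulr_ge0// ln_ge0// ler1n.
have e1 : m ^+ 2 * (n.+1 * n.+1)%N%:R * k%:R ^+ 2 <= 64 ^+ 2.
  rewrite nE !natrM; set u := m * _ * _ in mk1 mk2.
  have -> : m ^+ 2 * (M.+1%:R * k%:R * (M.+1%:R * k%:R)) * k%:R ^+ 2 = u ^+ 2.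
    by rewrite /u; ring.
  by rewrite lerXn2r ?nnegrE//; lra.
have -> : (2 * 2 * (2 * 2))%N%:R = 16 :> R by [].
have h := ler_wpM2l (mulr_ge0 (exprn_ge0 2 m0) (ler0n _ (n.+1 * n.+1))) fS.
have h2 := ler_wpM2r S0 e1.
rewrite [leLHS](_ : _ = 4 * 2304 * 16 * (m ^+ 2 * (n.+1 * n.+1)%N%:R * \sum_b c b)).
  by move: h h2; rewrite mulrA; lra.
by ring.
Qed.

(* No measurability is assumed, as the number of faces is not known to be a
   measurable function; the integral is a supremum over simple functions. *)
Lemma le_integral_nonneg (R : realType) d (T : measurableType d)
    (mu : {measure set T -> \bar R}) (f g : T -> \bar R) :
  (forall x, (0 <= f x)%E) -> (forall x, (f x <= g x)%E) ->
  (\int[mu]_x f x <= \int[mu]_x g x)%E.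
Proof.
move=> f0 fg; have g0 x : (0 <= g x)%E by exact: le_trans (f0 x) (fg x).
rewrite !ge0_integralTE//; apply: ereal_sup_le => _ [h /= hf <-].
by exists h => // x; apply: le_trans (hf x) (fg x).
Qed.

Lemma integral_event_count (R : realType) d (T : measurableType d)
    (mu : {measure set T -> \bar R}) (I : finType) (Ev : I -> T -> Prop) :
  (forall i, measurable [set w | Ev i w]) ->
  @measurable_fun _ _ T (\bar R) setT (fun w => (#|[pred i | `[< Ev i w >]]|%:R)%:E) /\
  (\int[mu]_w (#|[pred i | `[< Ev i w >]]|%:R : R)%:E =
   \sum_i mu [set w | Ev i w])%E.
Proof.
move=> mE.
have e w : (#|[pred i | `[< Ev i w >]]|%:R : R)%:E =
    (\sum_(i : I) (\1_[set w | Ev i w] w)%:E)%E.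
  rewrite sumEFin -sum1_card natr_sum big_mkcond /=; congr EFin.
  apply: eq_bigr => i _; rewrite inE indicE.
  by case: asboolP => h; [rewrite mem_set|rewrite memNset].
have m1 i : @measurable_fun _ _ T (\bar R) setT (fun w => (\1_[set w | Ev i w] w)%:E).
  by apply/measurable_EFinP; exact: measurable_indic.
under [X in measurable_fun _ X]eq_fun do rewrite e.
under eq_integral do rewrite e.
split; first by apply: emeasurable_sum => i; exact: m1.
rewrite ge0_integral_sum//.
by apply: eq_bigr => i _; rewrite integral_indic// setIT.
Qed.

Lemma limn_einf_sup_einfs (R : realType) (u : (\bar R)^nat) :
  limn_einf u = ereal_sup (range (einfs u)).
Proof.
by rewrite limn_einf_lim; apply/cvg_lim => //; exact: cvg_einfs_sup.
Qed.

(** The grids are indexed by [j]. Eventually [f] is below the measurable count on grid [j] plus one,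
    hence below the lower limit of these, and Fatou passes the uniform bound to [f]. *)
Lemma expectation_count_le (R : realType) d (T : measurableType d)
    (P : probability T R) (f : T -> nat) (I : nat -> finType)
    (Ev : forall j, I j -> T -> Prop) (B : R) :
  (forall j i, measurable [set w | Ev j i w]) ->
  (forall w, \forall j \near \oo, (f w <= #|[pred i | `[< Ev j i w >]]|.+1)%N) ->
  (forall j, (\sum_i P [set w | Ev j i w] <= B%:E)%E) ->
  ('E_P[fun w => (f w)%:R] <= (1 + B)%:E)%E.
Proof.
move=> mE fE PB; rewrite unlock.
pose g j w : \bar R := (1 + (#|[pred i | `[< Ev j i w >]]|%:R : R)%:E)%E.
have mg j : measurable_fun setT (g j).
  by apply: emeasurable_funD => //; exact: (integral_event_count P (mE j)).1.
have g0 j w : (0 <= g j w)%E by rewrite adde_ge0// lee_fin.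
apply: (@le_trans _ _ (\int[P]_w limn_einf (g ^~ w))%E).
  apply: le_integral_nonneg => w; first by rewrite lee_fin.
  rewrite limn_einf_sup_einfs; have [j _ hj] := fE w.
  apply: (@le_trans _ _ (einfs (g ^~ w) j)); last by apply: ereal_sup_ubound; exists j.
  apply: le_ereal_inf_tmp => _ [l /= jl <-]; rewrite /g -EFinD lee_fin nat1r ler_nat.
  exact: hj.
apply: (le_trans (fatou P measurableT mg (fun j w _ => g0 j w))).
rewrite limn_einf_sup_einfs; apply: ge_ereal_sup => _ [j _ <-].
apply: (@le_trans _ _ (\int[P]_w g j w)%E).
  by apply: ereal_inf_lbound; exists j => /=.
have [mc ic] := integral_event_count P (mE j).
rewrite ge0_integralD//.
have -> : (\int[P]__ 1 = 1 :> \bar R)%E.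
  by rewrite integral_cst//= probability_setT mule1.
rewrite EFinD; apply: leeD => //.
by rewrite ic.
Qed.

Lemma ocell_angles (R : realType) N (c : 'I_N * 'I_N) (p : R * R) :
  @angle_square R p -> ocell c (clifford_param p) ->
  angle_arc N c.1%:Z p.1 /\ angle_arc N c.2%:Z p.2.
Proof.
move=> sp [q [q1 q2] /clifford_square_inj e].
have <- : q = p.
  by apply: e; rewrite inE //; split; [exact: (arc_sub q1)|exact: (arc_sub q2)].
by [].
Qed.

Lemma same_arc (R : realType) N a (x y : R) : angle_arc N a x -> angle_arc N a y ->
  `|x - y| < mesh R N.
Proof.
move=> /angle_arcP/andP[x1 x2] /angle_arcP/andP[y1 y2].
by rewrite ltr_norml; apply/andP; split; lra.
Qed.

Lemma near_separated (R : realType) (X : {fset 'rV[R]_4}) (n : nat -> nat) :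
  [set` X] `<=` @clifford_torus R -> (forall j, (j <= n j)%N) ->
  \forall j \near \oo, cell_separated (n j) X.
Proof.
move=> tX nj.
have h x y : x \in X -> y \in X -> \forall j \near \oo,
    forall c : 'I_(n j).+1 * 'I_(n j).+1, ocell c x -> ocell c y -> x = y.
  move=> /tX [p sp <-] /tX [q sq <-].
  have [->|pq] := eqVneq p q; first by near=> j.
  have D0 : 0 < `|p.1 - q.1| + `|p.2 - q.2|.
    rewrite lt0r addr_ge0// andbT paddr_eq0// !normr_eq0 !subr_eq0.
    by apply: contraNN pq => /andP[/eqP e1 /eqP e2]; apply/eqP;
        case: p q e1 e2 {sp sq} => ? ? [? ?] /= -> ->.
  set D := _ + _ in D0.
  (* Two points in one cell differ by less than a mesh in each angle, so [D] would be below
     [2 mesh = 4 pi / (n j).+1]. *)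
  exists (Num.truncn (4 * pi / D)).+1 => // j /= jD c cp cq.
  have [p1 p2] := ocell_angles sp cp; have [q1 q2] := ocell_angles sq cq.
  have := ltrD (same_arc p1 q1) (same_arc p2 q2); rewrite -/D => Dm.
  have nD : 4 * pi / D < (n j).+1%:R.
    apply: (lt_le_trans (truncnS_gt _)); rewrite ler_nat.
    by apply: (leq_trans jD); rewrite (leq_trans (nj j)).
  move: nD; rewrite ltr_pdivrMr// => nD; exfalso.
  have hN := meshN R (ltn0Sn (n j)).
  have : (n j).+1%:R * D < (n j).+1%:R * (mesh R (n j).+1 + mesh R (n j).+1).
    by rewrite ltr_pM2l.
  by lra.
have h2 x : x \in X -> \forall j \near \oo, forall y, y \in X ->
    forall c : 'I_(n j).+1 * 'I_(n j).+1, ocell c x -> ocell c y -> x = y.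
  by move=> xX; apply: filter_bigI => y yX; apply: h.
have : \forall j \near \oo, forall x, x \in X -> forall y, y \in X ->
    forall c : 'I_(n j).+1 * 'I_(n j).+1, ocell c x -> ocell c y -> x = y.
  by apply: filter_bigI => x xX; apply: h2.
apply: filterS => j hj c; apply: npoints_le1 => x y xX yX; exact: hj.
Unshelve. all: by end_near. Qed.

Lemma pi_le4 (R : realType) : pi <= 4 :> R.
Proof. by have := pihalf_lt2 R; lra. Qed.

(** The quantity equals [4 pi ^ 2 lambda / M.+1] for every [k], with [4 <= pi ^ 2 <= 16] and
    [lambda / M.+1] between 1/2 and 1. *)
Lemma coarse_size (R : realType) (lambda : R) (M k : nat) : 1 <= lambda -> (0 < k)%N ->
  lambda <= M.+1%:R <= lambda + 1 ->
  8 <= lambda * mesh R (M.+1 * k) ^+ 2 * k%:R ^+ 2 * M.+1%:R <= 64.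
Proof.
move=> l1 k0 /andP[lM Ml]; have M0 : (0 : R) < M.+1%:R by rewrite ltr0n.
have k1 : (0 : R) < k%:R by rewrite ltr0n.
have -> : lambda * mesh R (M.+1 * k) ^+ 2 * k%:R ^+ 2 * M.+1%:R =
  4 * pi ^+ 2 * lambda / M.+1%:R.
  by rewrite /mesh natrM; field; rewrite !gt_eqF.
have p2 := pi_ge2 R; have p4 := pi_le4 R.
have pp : 4 <= (pi : R) ^+ 2 by nra.
have pp' : (pi : R) ^+ 2 <= 16 by nra.
rewrite ler_pdivlMr// ler_pdivrMr//; apply/andP; split; nra.
Qed.

Lemma expectation_upper (R : realType) d (Omega : measurableType d)
    (P : probability Omega R) lambda (X : Omega -> {fset 'rV[R]_4}) :
  4 <= lambda -> poisson_point_process P lambda X ->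
  ('E_P[fun w => (nfaces 1 (X w))%:R] <=
     (2 ^+ 40 * (lambda * ln lambda))%:E)%E /\
  ('E_P[fun w => (nfaces 2 (X w))%:R] <=
     (2 ^+ 40 * (lambda * ln lambda))%:E)%E.
Proof.
move=> l4 hX; pose M := Num.truncn lambda.
have l0 : 0 < lambda by lra.
have lM : lambda <= M.+1%:R <= lambda + 1.
  by rewrite (ltW (truncnS_gt _))/= -natr1 lerD2r truncn_le ltW.
have [lM1 Ml1] := andP lM.
(* The number [M.+1] of blocks stays fixed while the block size [j + 8] refines the grid; it starts
   at the 8 required by [chunk_side_ge]. *)
pose n j := (M.+1 * (j + 8)).-1.
have nE j : (n j).+1 = (M.+1 * (j + 8))%N by rewrite /n prednK// muln_gt0 addnS.
have n0 j : (0 < n j)%N by rewrite -ltnS nE; nia.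
have jn j : (j <= n j)%N by rewrite -ltnS nE; nia.
have k8 j : (8 <= j + 8)%N by rewrite leq_addl.
have mk j : 8 <= lambda * mesh R (n j).+1 ^+ 2 * (j + 8)%N%:R ^+ 2 * M.+1%:R <= 64.
  by rewrite nE; apply: coarse_size lM; [lra|rewrite addnS].
have sep w : \forall j \near \oo, cell_separated (n j) (X w).
  by apply: near_separated => //; have [h _ _ _] := hX; exact: h.
have L : 9 * M.+1%:R + 8 * M.+1%:R * ln (M.+1%:R : R) <= 50 * (lambda * ln lambda).
  have ln1 : 1 / 2 <= ln lambda.
    apply: (@le_trans _ _ (ln 4)); last by rewrite ler_ln ?posrE//; lra.
    have -> : (4 : R) = (1/4)^-1 by field.
    rewrite lnV ?posrE//; have := @le_ln1Dx R (- (3 / 4)).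
    by rewrite (_ : 1 + - (3 / 4) = 1 / 4 :> R); [lra|field].
  have lnM : ln (M.+1%:R : R) <= 2 * ln lambda.
    have -> : 2 * ln lambda = ln (lambda ^+ 2) by rewrite lnXn// mulr2n; ring.
    by rewrite ler_ln ?posrE ?exprn_gt0 ?ltr0n//; nra.
  have lnM0 : 0 <= ln (M.+1%:R : R) by rewrite ln_ge0// ler1n.
  have M2 : M.+1%:R <= 5 / 4 * lambda by lra.
  have : M.+1%:R * ln (M.+1%:R : R) <= 5 / 4 * lambda * (2 * ln lambda).
    by apply: ler_pM; rewrite ?ler0n.
  have : lambda * (1 / 2) <= lambda * ln lambda by rewrite ler_pM2l.
  lra.
have ll : 1 <= 2 * (lambda * ln lambda).
  have lnM0 : 0 <= ln (M.+1%:R : R) by rewrite ln_ge0// ler1n.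
  have : 0 <= M.+1%:R * ln (M.+1%:R : R) by rewrite mulr_ge0.
  lra.
have tX w : [set` X w] `<=` @clifford_torus R by have [h _ _ _] := hX; exact: h.
split.
  apply: le_trans (@expectation_count_le R _ _ P _ (fun j => pair_index (n j))
    (fun j i w => pair_event i (X w)) (16 * 64 ^+ 2 * (9 * M.+1%:R + 8 * M.+1%:R * ln (M.+1%:R))) _ _ _) _.
  - by move=> j i; exact: (prob_pair_event i hX (n0 j) l0).1.
  - by move=> w; apply: filterS (sep w) => j sj; apply: nfaces1_le.
  - by move=> j; exact: (sum_pair_events hX (n0 j) l0 (k8 j) (nE j) (mk j)).
  - by rewrite lee_fin; lra.
apply: le_trans (@expectation_count_le R _ _ P _ (fun j => triple_index (n j))
    (fun j i w => triple_event i (X w)) (64 * 2304 * 64 ^+ 2 * (9 * M.+1%:R + 8 * M.+1%:R * ln (M.+1%:R))) _ _ _) _.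
- by move=> j i; exact: (prob_triple_event i hX (n0 j) l0).1.
- by move=> w; apply: filterS (sep w) => j sj; apply: nfaces2_le.
- by move=> j; exact: (sum_triple_events hX (n0 j) l0 (k8 j) (nE j) (mk j)).
- by rewrite lee_fin; lra.
Qed.

(** * Lower bound *)

(** With [h] the mesh, the half distance is at most [(8 i + 1) h / 2 <= 9 i h / 2], and 42 times
    this is at most [189 i h]. So arcs more than [190 i] indices from the midpoint index [a + 4 i]
    are far. Starting at [250 L] keeps the midpoint a quarter turn away from the cut, which gives
    the upper bound on [|p - (x + y) / 2|]. *)
Lemma scale_bounds (R : realType) (n L a i : nat) (x y : R) :
  n.+1 = (1000 * L)%N -> (250 * L <= a < 500 * L)%N -> (0 < i <= L)%N ->
  angle_arc n.+1 a%:Z x -> angle_arc n.+1 (a + 8 * i)%N%:Z y ->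
  0 < (y - x) / 2 <= 1 / 21 /\
  forall c p, angle_arc n.+1 c%:Z p -> - pi < p <= pi ->
    ~~ ((a + 4 * i <= c + 190 * i)%N && (c <= a + 194 * i)%N) ->
    42 * ((y - x) / 2) <= `|p - (x + y) / 2| <= 2 * pi - 42 * ((y - x) / 2).
Proof.
move=> nE /andP[La aL] /andP[i0 iL] /angle_arcP xa /angle_arcP yb.
have h0 := mesh_gt0 R (ltn0Sn n).
have hN : mesh R n.+1 * (1000 * L%:R) = 2 * pi.
  by rewrite -(meshN R (ltn0Sn n)); congr (_ * _); rewrite -natrM -nE.
have p2 := pi_ge2 R; have p4 := pi_le4 R.
move: xa yb; rewrite -!pmulrn natrD natrM; move: h0 hN.
set h := mesh R n.+1 => h0 hN /andP[x1 x2] /andP[y1 y2].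
have i1 : h <= h * i%:R by rewrite ler_pMr// ler1n.
have iL1 : h * i%:R <= h * L%:R by rewrite ler_pM2l// ler_nat.
have aL1 : h * a%:R + h <= h * (500 * L%:R).
  by rewrite -{2}[h]mulr1 -mulrDr ler_pM2l// natr1 -natrM ler_nat.
have aL2 : h * (250 * L%:R) <= h * a%:R by rewrite ler_pM2l// -natrM ler_nat.
split; first by apply/andP; split; lra.
move=> c p /angle_arcP; rewrite -/h -pmulrn => /andP[p1' p2'] /andP[ppi ppi'].
move=> out; apply/andP; split; last by rewrite ler_norml; apply/andP; split; lra.
rewrite ler_normr; move: out; rewrite negb_and -!ltnNge => /orP[c1|c1].
  apply/orP; right.
  have c2 : h * (c%:R + 190 * i%:R + 1) <= h * (a%:R + 4 * i%:R).
    by rewrite ler_pM2l// -!natrM -!natrD natr1 ler_nat.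
  lra.
apply/orP; left.
have c2 : h * (a%:R + 194 * i%:R + 1) <= h * c%:R.
  by rewrite ler_pM2l// -!natrM -!natrD natr1 ler_nat.
lra.
Qed.

(** In units of the mesh, [z] is between [5 i] and [7 i] from the midpoint, while the half distance
    is between [7 i / 2] and [9 i / 2]; [left_bounds] mirrors this. These are the ranges for [u] and
    [v] in [edge_triangle_caps]. *)
Lemma right_bounds (R : realType) (n a i s : nat) (x y z : R) :
  (0 < i)%N -> (s < i)%N ->
  angle_arc n.+1 a%:Z x -> angle_arc n.+1 (a + 8 * i)%N%:Z y ->
  angle_arc n.+1 (a + 10 * i + s)%N%:Z z ->
  (y - x) / 2 < z - (x + y) / 2 <= 2 * ((y - x) / 2).
Proof.
move=> i0 si /angle_arcP + /angle_arcP + /angle_arcP.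
have h0 := mesh_gt0 R (ltn0Sn n); rewrite -!pmulrn.
rewrite (natrD _ (a + 10 * i) s) (natrD _ a (10 * i)) (natrD _ a (8 * i)) !natrM.
set h := mesh R n.+1 => /andP[x1 x2] /andP[y1 y2] /andP[z1 z2].
have i1 : h <= h * i%:R by rewrite ler_pMr// ler1n.
have s1 : h * s%:R + h <= h * i%:R.
  by rewrite -{2}[h]mulr1 -mulrDr ler_pM2l// natr1 ler_nat.
have s0 : 0 <= h * s%:R by rewrite mulr_ge0// ltW.
by apply/andP; split; lra.
Qed.

Lemma left_bounds (R : realType) (n a i s : nat) (x y z : R) :
  (0 < i)%N -> (s < i)%N -> (2 * i + s <= a)%N ->
  angle_arc n.+1 a%:Z x -> angle_arc n.+1 (a + 8 * i)%N%:Z y ->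
  angle_arc n.+1 (a - (2 * i + s))%N%:Z z ->
  (y - x) / 2 < (x + y) / 2 - z <= 2 * ((y - x) / 2).
Proof.
move=> i0 si ia /angle_arcP + /angle_arcP + /angle_arcP.
have h0 := mesh_gt0 R (ltn0Sn n); rewrite -!pmulrn natrB//.
rewrite (natrD _ (2 * i) s) (natrD _ a (8 * i)) !natrM.
set h := mesh R n.+1 => /andP[x1 x2] /andP[y1 y2] /andP[z1 z2].
have i1 : h <= h * i%:R by rewrite ler_pMr// ler1n.
have s1 : h * s%:R + h <= h * i%:R.
  by rewrite -{2}[h]mulr1 -mulrDr ler_pM2l// natr1 ler_nat.
have s0 : 0 <= h * s%:R by rewrite mulr_ge0// ltW.
by apply/andP; split; lra.
Qed.

(* Components: the position of the cell A of x (shifted by [250 L] to stay away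
   from the cut), the size [(i, j)] of the configuration up to a successor, and
   the position of the cell of z in a block of [i * j] cells. *)
Definition low_index L : finType :=
  (('I_(250 * L) * 'I_(250 * L)) * (('I_L * 'I_L) * ('I_L * 'I_L)))%type.

Definition low_corner L (q : low_index L) : nat * nat :=
  ((250 * L + q.1.1)%N, (250 * L + q.1.2)%N).

Definition low_size L (q : low_index L) : nat * nat := (q.2.1.1.+1, q.2.1.2.+1).

Definition low_offset L (q : low_index L) : nat * nat := (q.2.2.1 : nat, q.2.2.2 : nat).

(** [i * j <= L] keeps the expected number of points in the box bounded whatever its shape; the
    offsets place [z] in a block of [i] by [j] cells. *)
Definition low_ok L (q : low_index L) : bool :=
  [&& ((low_size q).1 * (low_size q).2 <= L)%N,
      ((low_offset q).1 < (low_size q).1)%N & ((low_offset q).2 < (low_size q).2)%N].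

Definition natcell n (a b : nat) : 'I_n.+1 * 'I_n.+1 := (inord a, inord b).

Definition lowA n L (q : low_index L) :=
  natcell n (low_corner q).1 (low_corner q).2.

Definition lowB n L (q : low_index L) :=
  natcell n ((low_corner q).1 + 8 * (low_size q).1) ((low_corner q).2 + 8 * (low_size q).2).

Definition lowZ n L (q : low_index L) :=
  natcell n ((low_corner q).1 + 10 * (low_size q).1 + (low_offset q).1)
            ((low_corner q).2 - (2 * (low_size q).2 + (low_offset q).2)).

(** Indices within [190 i] of [a + 4 i], written without truncated subtraction. *)
Definition near_block (a i c : nat) : bool :=
  ((a + 4 * i <= c + 190 * i) && (c <= a + 194 * i))%N.

Definition lowD n L (q : low_index L) : {set 'I_n.+1 * 'I_n.+1} :=
  finset.finset (fun c : 'I_n.+1 * 'I_n.+1 =>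
    near_block (low_corner q).1 (low_size q).1 c.1 &&
    near_block (low_corner q).2 (low_size q).2 c.2).

Definition low_cells n L (q : low_index L) : {set 'I_n.+1 * 'I_n.+1} :=
  lowA n q |: (lowB n q |: finset.set1 (lowZ n q)).

Definition low_event (R : realType) n L (q : low_index L) (X : {fset 'rV[R]_4}) : Prop :=
  low_ok q /\ occupancy X (low_cells n q) (lowD n q :\: low_cells n q).

Lemma low_facts n L (q : low_index L) : n.+1 = (1000 * L)%N -> low_ok q ->
  let a := (low_corner q).1 in let b := (low_corner q).2 in
  let i := (low_size q).1 in let j := (low_size q).2 in
  let s := (low_offset q).1 in let t := (low_offset q).2 in
  [/\ (250 * L <= a < 500 * L)%N /\ (250 * L <= b < 500 * L)%N,
      (0 < i <= L)%N /\ (0 < j <= L)%N, (s < i)%N /\ (t < j)%N, (i * j <= L)%N &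
      [/\ (lowA n q).1 = a :> nat /\ (lowA n q).2 = b :> nat,
          (lowB n q).1 = (a + 8 * i)%N :> nat /\ (lowB n q).2 = (b + 8 * j)%N :> nat &
          (lowZ n q).1 = (a + 10 * i + s)%N :> nat /\
          (lowZ n q).2 = (b - (2 * j + t))%N :> nat]].
Proof.
case: q => [[a b] [[i j] [s t]]] nE; rewrite /low_ok /lowA /lowB /lowZ /natcell /=.
move=> /and3P[ijL si tj].
have := ltn_ord a; have := ltn_ord b; have := ltn_ord i; have := ltn_ord j.
move: (nat_of_ord a) (nat_of_ord b) (nat_of_ord i) (nat_of_ord j) (nat_of_ord s)
  (nat_of_ord t) ijL si tj => {}a {}b {}i {}j {}s {}t ijL si tj jL iL bL aL.
by do !split; rewrite ?inordK ?nE //; lia.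
Qed.

(** Any further point of [X] lies in a cell outside the box, hence is far from the centre in at
    least one angle, and being far in one angle already excludes it from both caps. *)
Lemma low_geometry (R : realType) n L (q : low_index L) (X : {fset 'rV[R]_4}) :
  n.+1 = (1000 * L)%N -> [set` X] `<=` @clifford_torus R -> low_event n q X ->
  exists (x y z w0 w1 : 'rV[R]_4) (c0 c1 : R),
    [/\ [/\ x \in X, y \in X & z \in X],
      [/\ ocell (lowA n q) x, ocell (lowB n q) y & ocell (lowZ n q) z],
      [/\ dotp w0 x = c0, dotp w0 y = c0 & dotp w0 z < c0],
      [/\ dotp w1 x = c1, dotp w1 y = c1 & dotp w1 z = c1] &
      forall v, v \in X -> v <> x -> v <> y -> v <> z ->
        dotp w0 v < c0 /\ dotp w1 v < c1].
Proof.
move=> nE tX [ok [occ1 occ0]].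
have [[a1 b1] [i1 j1] [si tj] ijL [[A1 A2] [B1 B2] [Z1 Z2]]] := low_facts nE ok.
have hA : lowA n q \in low_cells n q by rewrite !inE eqxx.
have hB : lowB n q \in low_cells n q by rewrite !inE eqxx orbT.
have hZ : lowZ n q \in low_cells n q by rewrite !inE eqxx !orbT.
have [x [xX Ax xu]] := npoints_eq1 (occ1 _ hA).
have [y [yX By yu]] := npoints_eq1 (occ1 _ hB).
have [z [zX Zz zu]] := npoints_eq1 (occ1 _ hZ).
have [px [px1 px2] pxE] := Ax; have [py [py1 py2] pyE] := By.
have [pz [pz1 pz2] pzE] := Zz.
rewrite /= A1 in px1; rewrite /= A2 in px2; rewrite /= B1 in py1.
rewrite /= B2 in py2; rewrite /= Z1 in pz1; rewrite /= Z2 in pz2.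
have [al far1] := scale_bounds nE a1 i1 px1 py1.
have [be far2] := scale_bounds nE b1 j1 px2 py2.
have u1 := right_bounds (proj1 (andP i1)) si px1 py1 pz1.
have tb : (2 * (low_size q).2 + (low_offset q).2 <= (low_corner q).2)%N.
  move: b1 j1 tj; clear; move: (low_corner q).2 (low_size q).2 (low_offset q).2.
  by lia.
have v1 := left_bounds (proj1 (andP j1)) tj tb px2 py2 pz2.
have [w0 [c0 [w1 [c1 /= [[e1 e2 e3] [e4 e5 e6] far]]]]] :=
  edge_triangle_caps ((px.1 + py.1) / 2) ((px.2 + py.2) / 2) al be u1 v1.
have X1 (s t : R) : (s + t) / 2 - (t - s) / 2 = s by field.
have Y1 (s t : R) : (s + t) / 2 + (t - s) / 2 = t by field.
have Z1' (s t : R) : s + (t - s) = t by rewrite addrC subrK.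
have Z2' (s t : R) : s - (s - t) = t by rewrite opprB addrC subrK.
rewrite !X1 !Y1 Z1' Z2' -!surjective_pairing pxE pyE pzE in e1 e2 e3 e4 e5 e6.
exists x, y, z, w0, w1, c0, c1; split => //.
move=> v vX vx vy vz; have [p [p1 p2] pv] := tX v vX.
have [c cv] := torus_ocell n (tX v vX).
have cN : c \notin low_cells n q.
  rewrite !inE; apply/negP => /or3P[/eqP cc|/eqP cc|/eqP cc]; rewrite cc in cv.
  - exact/vx/xu.
  - exact/vy/yu.
  - exact/vz/zu.
have cD : c \notin lowD n q.
  apply/negP => cD; have /npoints_eq0P/(_ v vX) : npoints X (ocell c) = 0%N.
    by apply: occ0; rewrite inE cD cN.
  exact.
have [q1 q2] : angle_arc n.+1 c.1%:Z p.1 /\ angle_arc n.+1 c.2%:Z p.2.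
  by apply: ocell_angles; [split|rewrite pv].
rewrite -pv [p]surjective_pairing; apply: far.
move: cD; rewrite inE negb_and => /orP[cD|cD]; [left|right].
  by apply: far1 cD => //; move: p1; rewrite /= in_itv.
by apply: far2 cD => //; move: p2; rewrite /= in_itv.
Qed.

Lemma low_cells_uniq n L (q : low_index L) : n.+1 = (1000 * L)%N -> low_ok q ->
  uniq [:: lowA n q; lowB n q; lowZ n q].
Proof.
move=> nE ok; have [_ [i1 _] _ _ [[A1 _] [B1 _] [Z1 _]]] := low_facts nE ok.
rewrite /= !inE !negb_or !andbT -!andbA.
move: A1 B1 Z1 i1; move: (low_corner q).1 (low_size q).1 (low_offset q).1 => a i s.
move: (lowA n q) (lowB n q) (lowZ n q) => cA cB cZ A1 B1 Z1 /andP[i0 _].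
apply/and3P; split; apply/eqP => e; move: A1 B1 Z1; rewrite e; clear -i0; lia.
Qed.

(** Recording exactly which points of [X] the face carries allows its cells to be read back, as
    injectivity requires. *)
Definition face_with (R : realType) (X : {fset 'rV[R]_4}) (i : nat)
    (C F : set 'rV[R]_4) : Prop :=
  (face (convex_hull [set` X]) F /\ has_dim F i) /\ F `&` [set` X] = [set` X] `&` C.

Definition low_edge (R : realType) n L (X : {fset 'rV[R]_4}) (q : low_index L) :=
  xget set0 (face_with X 1 (ocell (lowA n q) `|` ocell (lowB n q))).

Definition low_triangle (R : realType) n L (X : {fset 'rV[R]_4}) (q : low_index L) :=
  xget set0 (face_with X 2
    (ocell (lowA n q) `|` ocell (lowB n q) `|` ocell (lowZ n q))).

Lemma low_cell_unique (R : realType) n L (q : low_index L) (X : {fset 'rV[R]_4}) c x y :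
  low_event n q X -> c \in low_cells n q -> x \in X -> y \in X ->
  ocell c x -> ocell c y -> x = y.
Proof.
move=> [_ [occ1 _]] cq xX yX cx cy.
by have [z [_ _ h]] := npoints_eq1 (occ1 c cq); rewrite (h x)// (h y).
Qed.

Lemma low_edgeP (R : realType) n L (q : low_index L) (X : {fset 'rV[R]_4}) :
  n.+1 = (1000 * L)%N -> [set` X] `<=` @clifford_torus R -> low_event n q X ->
  face_with X 1 (ocell (lowA n q) `|` ocell (lowB n q)) (low_edge n X q).
Proof.
move=> nE tX ev; have [x [y [z [w0 [w1 [c0 [c1 [[xX yX zX] [Ax By Zz]]]]]]]]] :=
    low_geometry nE tX ev.
move=> [w0x w0y w0z] _ out.
have /= /andP[/norP[/eqP AB _] _] := low_cells_uniq nE ev.1.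
pose F := convex_hull [set` X] `&` [set p | dotp w0 p = c0].
have valid v : v \in X -> dotp w0 v <= c0.
  move=> vX; have [->|/eqP vx] := eqVneq v x; first by rewrite w0x.
  have [->|/eqP vy] := eqVneq v y; first by rewrite w0y.
  have [->|/eqP vz] := eqVneq v z; first exact: ltW.
  by have [/ltW] := out v vX vx vy vz.
have fF : face (convex_hull [set` X]) F.
  by exists w0, c0; split => //; apply: convex_hull_le.
have FX : F `&` [set` X] = [set x; y].
  apply/seteqP; split => [v [[_ /= w0v] vX]|v [->|->]]; last 2 first.
  - by split => //; split => //; exact: sub_convex_hull.
  - by split => //; split => //; exact: sub_convex_hull.
  apply: contrapT => /not_orP[vx vy].
  have [vz|/eqP vz] := eqVneq v z; first by move: w0z; rewrite -vz w0v ltxx.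
  by have [] := out v vX vx vy vz; rewrite w0v ltxx.
have xy : x != y by apply/eqP => xy; apply: AB; apply: ocell_inj Ax _; rewrite xy.
apply: (@xgetPex _ set0 (face_with X 1 _)).
exists F; split; first by split => //; exact: face_edge FX xy.
rewrite FX; apply/seteqP; split => v; first by move=> [->|->]; split => //; [left|right].
have hA : lowA n q \in low_cells n q by rewrite !inE eqxx.
have hB : lowB n q \in low_cells n q by rewrite !inE eqxx orbT.
move=> [vX [Av|Bv]]; [left|right].
  exact: (low_cell_unique ev hA).
exact: (low_cell_unique ev hB).
Qed.

Lemma low_triangleP (R : realType) n L (q : low_index L) (X : {fset 'rV[R]_4}) :
  n.+1 = (1000 * L)%N -> [set` X] `<=` @clifford_torus R -> low_event n q X ->
  face_with X 2 (ocell (lowA n q) `|` ocell (lowB n q) `|` ocell (lowZ n q))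
    (low_triangle n X q).
Proof.
move=> nE tX ev.
have [x [y [z [w0 [w1 [c0 [c1 [[xX yX zX] [Ax By Zz]]]]]]]]] := low_geometry nE tX ev.
move=> [w0x w0y w0z] [w1x w1y w1z] out.
have /= /andP[/norP[/eqP AB _] _] := low_cells_uniq nE ev.1.
pose F := convex_hull [set` X] `&` [set p | dotp w1 p = c1].
have valid v : v \in X -> dotp w1 v <= c1.
  move=> vX; have [->|/eqP vx] := eqVneq v x; first by rewrite w1x.
  have [->|/eqP vy] := eqVneq v y; first by rewrite w1y.
  have [->|/eqP vz] := eqVneq v z; first by rewrite w1z.
  by have [_ /ltW] := out v vX vx vy vz.
have fF : face (convex_hull [set` X]) F.
  by exists w1, c1; split => //; apply: convex_hull_le.
have FX : F `&` [set` X] = [set x; y; z].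
  apply/seteqP; split => [v [[_ /= w1v] vX]|v [[->|->]|->]]; last 3 first.
  - by split => //; split => //; exact: sub_convex_hull.
  - by split => //; split => //; exact: sub_convex_hull.
  - by split => //; split => //; exact: sub_convex_hull.
  apply: contrapT => /not_orP[/not_orP[vx vy] vz].
  by have [_] := out v vX vx vy vz; rewrite w1v ltxx.
have xy : x != y by apply/eqP => xy; apply: AB; apply: ocell_inj Ax _; rewrite xy.
apply: (@xgetPex _ set0 (face_with X 2 _)).
exists F; split.
  by split => //; apply: (face_triangle fF FX xy w0x w0y); rewrite lt_eqF.
rewrite FX; apply/seteqP; split => v.
  by move=> [[->|->]|->]; split => //; [left; left|left; right|right].
have hA : lowA n q \in low_cells n q by rewrite !inE eqxx.
have hB : lowB n q \in low_cells n q by rewrite !inE eqxx orbT.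
have hZ : lowZ n q \in low_cells n q by rewrite !inE eqxx !orbT.
move=> [vX [[Av|Bv]|Zv]]; [left; left|left; right|right].
- exact: (low_cell_unique ev hA).
- exact: (low_cell_unique ev hB).
- exact: (low_cell_unique ev hZ).
Qed.

Lemma low_index_eq L (q q' : low_index L) : low_corner q = low_corner q' ->
  low_size q = low_size q' -> low_offset q = low_offset q' -> q = q'.
Proof.
case: q q' => [[a b] [[i j] [s t]]] [[a' b'] [[i' j'] [s' t']]].
move=> [/addnI/val_inj -> /addnI/val_inj ->] [/val_inj -> /val_inj ->].
by move=> [/val_inj -> /val_inj ->].
Qed.

(** With equal corner and size, the third cell of [q'] lies in the box of [q] and is occupied, so it
    is one of the three cells of [q]; its indices rule out the first two. Hence edges determine the
    whole index. *)
Lemma low_third_cell (R : realType) n L (q q' : low_index L) (X : {fset 'rV[R]_4}) :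
  n.+1 = (1000 * L)%N -> low_event n q X -> low_event n q' X ->
  low_corner q = low_corner q' -> low_size q = low_size q' -> q = q'.
Proof.
move=> nE ev ev' ec es; apply: low_index_eq => //.
have [_ [i1 j1] _ _ [[A1 A2] [B1 B2] [Z1 Z2]]] := low_facts nE ev.1.
have [[a1 b1] _ [si' tj'] _ [_ _ [Z1' Z2']]] := low_facts nE ev'.1.
have hZ' : lowZ n q' \in low_cells n q' by rewrite !inE eqxx !orbT.
have [z [zX Zz _]] := npoints_eq1 (ev'.2.1 _ hZ').
have ZD : lowZ n q' \in lowD n q.
  rewrite inE Z1' Z2' /near_block ec es; move: i1 j1 a1 b1 si' tj'; rewrite es.
  move: (low_corner q').1 (low_corner q').2 (low_size q').1 (low_size q').2.
  move: (low_offset q').1 (low_offset q').2; clear; lia.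
have ZS : lowZ n q' \in low_cells n q.
  apply/negPn/negP => ZN; have /npoints_eq0P/(_ z zX) : npoints X (ocell (lowZ n q')) = 0%N.
    by apply: ev.2.2; rewrite inE ZN ZD.
  exact.
have [so to] : (low_offset q).1 = (low_offset q').1 /\
    (low_offset q).2 = (low_offset q').2.
  move: A1 A2 B1 B2 Z1 Z2 Z1' Z2' a1 b1 i1 j1 si' tj'; rewrite ec es.
  have [_ _ sij _ _] := low_facts nE ev.1; move: sij; rewrite es => -[].
  move: (low_corner q').1 (low_corner q').2 (low_size q').1 (low_size q').2 => a b i j.
  move: (low_offset q').1 (low_offset q').2 (low_offset q).1 (low_offset q).2.
  move=> s t s' t' si tj A1 A2 B1 B2 Z1 Z2 Z1' Z2' a1 b1 i1 j1 si' tj'.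
  move: ZS; rewrite !inE => /or3P[] /eqP e; rewrite e in Z1' Z2'.
  - by move: A1 Z1' i1; clear; lia.
  - by move: B1 Z1' i1; clear; lia.
  by move: Z1 Z1' Z2 Z2' b1 j1 tj tj'; clear; lia.
by rewrite [LHS]surjective_pairing so to -surjective_pairing.
Qed.

(** Sizes are positive, so the cell of [x] precedes that of [y] in the first index and two pairs
    cannot match crosswise. *)
Lemma low_pair_eq n L (q q' : low_index L) :
  n.+1 = (1000 * L)%N -> low_ok q -> low_ok q' ->
  lowA n q \in [:: lowA n q'; lowB n q'] -> lowB n q \in [:: lowA n q'; lowB n q'] ->
  low_corner q = low_corner q' /\ low_size q = low_size q'.
Proof.
move=> nE ok ok'.
have [_ [i1 j1] _ _ [[A1 A2] [B1 B2] _]] := low_facts nE ok.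
have [_ [i1' j1'] _ _ [[A1' A2'] [B1' B2'] _]] := low_facts nE ok'.
rewrite [low_corner q]surjective_pairing [low_corner q']surjective_pairing.
rewrite [low_size q]surjective_pairing [low_size q']surjective_pairing.
move: A1 A2 B1 B2 A1' A2' B1' B2' i1 j1 i1' j1'.
move: (lowA n q) (lowB n q) (lowA n q') (lowB n q') => cA cB cA' cB'.
move: (low_corner q).1 (low_corner q).2 (low_size q).1 (low_size q).2 => a b i j.
move: (low_corner q').1 (low_corner q').2 (low_size q').1 (low_size q').2 => a' b' i' j'.
move=> A1 A2 B1 B2 A1' A2' B1' B2' i1 j1 i1' j1'.
rewrite !inE => /orP[]/eqP e /orP[]/eqP e'; subst cA cB;
  move: A1 A2 B1 B2 A1' A2' B1' B2' i1 j1 i1' j1'; clear => *.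
- by exfalso; lia.
- by split; congr pair; lia.
- by exfalso; lia.
- by exfalso; lia.
Qed.

(** The first indices [a < a + 8 i < a + 10 i + s] order the three cells, so the triples match cell
    by cell. *)
Lemma low_triple_pair n L (q q' : low_index L) :
  n.+1 = (1000 * L)%N -> low_ok q -> low_ok q' ->
  (forall c, c \in [:: lowA n q; lowB n q; lowZ n q] ->
    c \in [:: lowA n q'; lowB n q'; lowZ n q']) ->
  lowA n q \in [:: lowA n q'; lowB n q'] /\ lowB n q \in [:: lowA n q'; lowB n q'].
Proof.
move=> nE ok ok' sub.
have := sub (lowA n q); have := sub (lowB n q); have := sub (lowZ n q).
rewrite !inE !eqxx ?orbT => /(_ isT) hZ /(_ isT) hB /(_ isT) hA.
have [_ [i1 _] _ _ [[A1 _] [B1 _] [Z1 _]]] := low_facts nE ok.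
have [_ [i1' _] _ _ [[A1' _] [B1' _] [Z1' _]]] := low_facts nE ok'.
move: hA hB hZ A1 B1 Z1 A1' B1' Z1' i1 i1'.
move: (lowA n q) (lowB n q) (lowZ n q) (lowA n q') (lowB n q') (lowZ n q').
move: (low_corner q).1 (low_size q).1 (low_offset q).1.
move: (low_corner q').1 (low_size q').1 (low_offset q').1.
clear=> a' i' s' a i s cA cB cZ cA' cB' cZ'.
case/or3P => /eqP eA; case/or3P => /eqP eB; case/or3P => /eqP eZ;
  subst cA cB cZ => *; rewrite ?eqxx ?orbT //; exfalso; lia.
Qed.

Lemma low_event_points (R : realType) n L (q : low_index L) (X : {fset 'rV[R]_4}) c :
  low_event n q X -> c \in [:: lowA n q; lowB n q; lowZ n q] ->
  exists2 x, x \in X & ocell c x.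
Proof.
move=> [_ [occ1 _]] cq; have [|x [xX cx _]] := npoints_eq1 (occ1 c _).
  by move: cq; rewrite !inE.
by exists x.
Qed.

Lemma low_count (R : realType) n L (X : {fset 'rV[R]_4}) :
  n.+1 = (1000 * L)%N -> [set` X] `<=` @clifford_torus R ->
  (#|[pred q : low_index L | `[< low_event n q X >]]| <= nfaces 1 X)%N /\
  (#|[pred q : low_index L | `[< low_event n q X >]]| <= nfaces 2 X)%N.
Proof.
move=> nE tX; split.
  apply: (@nfaces_ge _ _ _ _ _ (@low_edge R n L X)).
    by move=> q /asboolP ev; exact: (low_edgeP nE tX ev).1.
  move=> q q' /asboolP ev /asboolP ev' e.
  have := (low_edgeP nE tX ev).2; rewrite e (low_edgeP nE tX ev').2 => eX.
  have sub c : c \in [:: lowA n q; lowB n q] -> c \in [:: lowA n q'; lowB n q'].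
    move=> cq; have [|x xX cx] := @low_event_points R n L q X c ev.
      by move: cq; rewrite !inE => /orP[] ->; rewrite ?orbT.
    have : ([set` X] `&` (ocell (lowA n q') `|` ocell (lowB n q'))) x.
      rewrite eX; split => //; move: cq; rewrite !inE => /orP[]/eqP <-; [left|right];
          exact: cx.
    by move=> [_ [c'|c']]; rewrite (ocell_inj cx c') !inE eqxx ?orbT.
  have [|| h1 h2] := low_pair_eq nE ev.1 ev'.1; try by apply: sub; rewrite !inE eqxx ?orbT.
  exact: low_third_cell nE ev ev' h1 h2.
apply: (@nfaces_ge _ _ _ _ _ (@low_triangle R n L X)).
  by move=> q /asboolP ev; exact: (low_triangleP nE tX ev).1.
move=> q q' /asboolP ev /asboolP ev' e.
have := (low_triangleP nE tX ev).2; rewrite e (low_triangleP nE tX ev').2 => eX.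
have sub c : c \in [:: lowA n q; lowB n q; lowZ n q] ->
    c \in [:: lowA n q'; lowB n q'; lowZ n q'].
  move=> cq; have [x xX cx] := low_event_points ev cq.
  have : ([set` X] `&` (ocell (lowA n q') `|` ocell (lowB n q') `|` ocell (lowZ n q'))) x.
    rewrite eX; split => //; move: cq; rewrite !inE => /or3P[]/eqP <-;
      [left; left|left; right|right]; exact: cx.
  by move=> [_ [[c'|c']|c']]; rewrite (ocell_inj cx c') !inE eqxx ?orbT.
have [hA hB] := low_triple_pair nE ev.1 ev'.1 sub.
have [h1 h2] := low_pair_eq nE ev.1 ev'.1 hA hB.
exact: low_third_cell nE ev ev' h1 h2.
Qed.

(** * Number and probability of the configurations *)

Lemma card_interval n lo len :
  (#|[pred x : 'I_n | (lo <= x)%N && (x < lo + len)%N]| <= len)%N.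
Proof.
rewrite cardE -(size_map val) -[leqRHS](size_iota lo); apply: uniq_leq_size.
  by rewrite map_inj_uniq ?enum_uniq//; exact: val_inj.
move=> _ /mapP[x + ->]; rewrite mem_enum inE mem_iota.
exact.
Qed.

Lemma card_lowD n L (q : low_index L) :
  (#|lowD n q| <= (381 * (low_size q).1) * (381 * (low_size q).2))%N.
Proof.
(* A side of the box runs from [a - 186 i] to [a + 194 i], that is over at most [380 i + 1 <= 381 i]
   indices. *)
pose I k a i := [pred x : 'I_k | (a + 4 * i - 190 * i <= x)%N &&
  (x < a + 4 * i - 190 * i + 381 * i)%N].
have sz : (0 < (low_size q).1)%N /\ (0 < (low_size q).2)%N by [].
apply: (@leq_trans (#|finset.setX (finset.finset (I n.+1 (low_corner q).1 (low_size q).1))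
    (finset.finset (I n.+1 (low_corner q).2 (low_size q).2))|)%N); last first.
  by rewrite cardsX !cardsE leq_mul// card_interval.
apply: subset_leq_card; apply/fintype.subsetP => -[x y]; rewrite !inE /near_block /=.
move: sz (nat_of_ord x) (nat_of_ord y).
move: (low_corner q).1 (low_corner q).2 (low_size q).1 (low_size q).2.
by clear; lia.
Qed.

Lemma prob_low_event (R : realType) d (Omega : measurableType d)
    (P : probability Omega R) lambda (X : Omega -> {fset 'rV[R]_4}) n L
    (q : low_index L) (m := lambda * mesh R n.+1 ^+ 2) :
  poisson_point_process P lambda X -> 0 < lambda -> n.+1 = (1000 * L)%N ->
  m * L%:R * 1000 ^+ 2 <= 64 ->
  measurable [set w | low_event n q (X w)] /\
  (((low_ok q)%:R * (m ^+ 3 * expR (- 10)))%:E <= P [set w | low_event n q (X w)])%E.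
Proof.
move=> hX l0 nE mL; have m0 : 0 <= m by rewrite mulr_ge0 ?sqr_ge0 ?ltW.
have n1 : (1 < n.+1)%N by rewrite nE; case: L q nE {mL} => //; lia.
have [ok|nok] := boolP (low_ok q); last first.
  rewrite (_ : [set w | _] = set0); last by apply/seteqP; split => w // -[];
      rewrite (negbTE nok).
  by rewrite measure0 mul0r.
rewrite (_ : [set w | _] = [set w | occupancy (X w) (low_cells n q)
  (lowD n q :\: low_cells n q)]); last by apply/seteqP; split => w; [case|split].
split; first exact: measurable_occupancy hX _.
rewrite (prob_occupancy hX)//; last by move=> c cS; rewrite inE cS.
have c3 : #|low_cells n q| = 3%N.
  have := low_cells_uniq nE ok; rewrite /= !inE negb_or !andbT => /andP[/andP[h1 h2] h3].
  by rewrite /low_cells !cardsU1 cards1 !inE (negbTE h1) (negbTE h2) (negbTE h3).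
rewrite c3 mul1r lee_fin ler_wpM2l ?exprn_ge0// ler_expR lerN2.
(* Passing from 381 to 382 makes room for the three occupied cells, and
   [64 * 382 ^ 2 / 1000 ^ 2 < 10] yields the exponent 10. *)
have cD : (3 + #|lowD n q :\: low_cells n q| <= 382 * 382 * L)%N.
  have [_ [/andP[i0 iL] _] _ ijL _] := low_facts nE ok.
  have h : (#|lowD n q :\: low_cells n q| <= #|lowD n q|)%N.
    by apply: subset_leq_card; exact: finset.subsetDl.
  have := leq_trans h (card_lowD n q).
  move: ijL i0 iL; move: (low_size q).1 (low_size q).2 #|_ :\: _|.
  clear => i j k; nia.
have cD' : (3 + #|lowD n q :\: low_cells n q|)%N%:R <= 382 * 382 * L%:R :> R.
  by rewrite -!natrM ler_nat.
rewrite -/m; have := ler_wpM2l m0 cD'; lra.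
Qed.

Lemma sum_lt_count (R : realType) (N c : nat) : (c <= N)%N ->
  \sum_(x < N) (x < c)%N%:R = c%:R :> R.
Proof.
move=> cN; rewrite -natr_sum -(big_mkord xpredT (fun x => (x < c)%N : nat)).
rewrite (big_cat_nat (leq0n _) cN)/= [X in (_ + X)%N]big_nat_cond.
rewrite [X in (_ + X)%N]big1 => [|x /andP[/andP[cx _] _]]; last by rewrite ltnNge cx.
rewrite addn0 (eq_big_nat _ _ (F2 := fun=> 1%N)); last by move=> x /andP[_ ->].
by rewrite sum_nat_const_nat muln1 subn0.
Qed.

Lemma sum_succ (R : realType) (J : nat) :
  \sum_(0 <= j < J) j.+1%:R = J%:R * (J%:R + 1) / 2 :> R.
Proof.
elim: J => [|J IH]; first by rewrite big_geq// !mul0r.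
by rewrite big_nat_recr//= IH -natr1; field.
Qed.

(** For [J = L %/ i.+1] the row sums to [i.+1 * J (J + 1) / 2]; since [J >= 1],
    [(J + 1) ^ 2 <= 2 J (J + 1)], and [L <= i.+1 * (J + 1)]. *)
Lemma hyperbola_row (R : realType) (L i : nat) : (i < L)%N ->
  L%:R ^+ 2 / 4 * i.+1%:R^-1 <=
  \sum_(j < L) (i.+1 * j.+1 <= L)%N%:R * (i.+1%:R * j.+1%:R) :> R.
Proof.
move=> iL; pose J := (L %/ i.+1)%N.
have J1 : (0 < J)%N by rewrite divn_gt0.
have JL : (J <= L)%N by exact: leq_div.
have i0 : (0 : R) < i.+1%:R by rewrite ltr0n.
have LJ : (L%:R : R) <= i.+1%:R * (J%:R + 1).
  by rewrite natr1 -natrM ler_nat mulnC ltnW// ltn_ceil.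
apply: (@le_trans _ _ (i.+1%:R * (J%:R * (J%:R + 1) / 2))).
  rewrite ler_pdivrMr//.
  have J1' : (1 : R) <= J%:R by rewrite ler1n.
  have h : (L%:R : R) ^+ 2 <= (i.+1%:R * (J%:R + 1)) ^+ 2.
    by rewrite lerXn2r ?nnegrE ?mulr_ge0 ?ler0n// addr_ge0.
  have h' : (J%:R + 1) ^+ 2 <= 2 * (J%:R * (J%:R + 1)) :> R by nra.
  have := ler_wpM2l (exprn_ge0 2 (ltW i0)) h'; lra.
rewrite -(big_mkord xpredT (fun j => (i.+1 * j.+1 <= L)%N%:R * (i.+1%:R * j.+1%:R))).
rewrite (big_cat_nat (leq0n _) JL)/=.
rewrite [X in _ <= X + _](eq_big_nat _ _ (F2 := fun j => i.+1%:R * j.+1%:R)).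
  rewrite -mulr_sumr sum_succ lerDl; apply: sumr_ge0 => j _.
  by rewrite !mulr_ge0.
move=> j /andP[_ jJ].
by rewrite (leq_trans (leq_mul (leqnn _) jJ)) ?mul1r// mulnC leq_trunc_div.
Qed.

(** For a size [(i, j)] there are [i j] offsets, so the count is a sum of [i j] below the hyperbola
    [i j <= L]; its rows are of order [L ^ 2 / i], and the harmonic sum produces the logarithm. *)
Lemma sum_low_ok (R : realType) L : (0 < L)%N ->
  (250 * L%:R) ^+ 2 * (L%:R ^+ 2 / 4 * ln (L.+1%:R)) <=
  \sum_(q : low_index L) (low_ok q)%:R :> R.
Proof.
move=> L0.
pose g (u : ('I_L * 'I_L) * ('I_L * 'I_L)) : R :=
  [&& (u.1.1.+1 * u.1.2.+1 <= L)%N, (u.2.1 < u.1.1.+1)%N & (u.2.2 < u.1.2.+1)%N]%:R.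
have -> : \sum_(q : low_index L) (low_ok q)%:R = \sum_(q : low_index L) g q.2 by [].
rewrite (@sum_snd R _ _ g) card_prod !card_ord !natrM -expr2.
rewrite ler_wpM2l ?sqr_ge0//.
rewrite -(pair_bigA _ (fun d o : 'I_L * 'I_L => g (d, o))) /=.
rewrite -(pair_bigA _ (fun i j : 'I_L => \sum_(o : 'I_L * 'I_L) g ((i, j), o))) /=.
apply: (@le_trans _ _ (\sum_(i < L) L%:R ^+ 2 / 4 * i.+1%:R^-1)).
  rewrite -mulr_sumr ler_wpM2l ?divr_ge0 ?sqr_ge0//.
  apply: le_trans (harmonic_ge R L) _.
  by rewrite big_add1 /= big_mkord.
apply: ler_sum => i _; apply: (le_trans (hyperbola_row R (ltn_ord i))).
apply: ler_sum => j _.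
rewrite -(pair_bigA _ (fun s t : 'I_L => g ((i, j), (s, t)))) /= /g /=.
rewrite -(sum_lt_count R (ltn_ord i)) -(sum_lt_count R (ltn_ord j)) big_distrlr /=.
rewrite mulr_sumr; apply: ler_sum => s _; rewrite mulr_sumr; apply: ler_sum => t _.
by rewrite -!natrM !mulnb.
Qed.

Lemma expectation_lower (R : realType) d (Omega : measurableType d)
    (P : probability Omega R) lambda (X : Omega -> {fset 'rV[R]_4})
    (c := 15625 * (8 / 1000 ^+ 2) ^+ 3 * expR (- 10) : R) :
  4 <= lambda -> poisson_point_process P lambda X ->
  ((c * (lambda * ln lambda))%:E <= 'E_P[fun w => (nfaces 1 (X w))%:R])%E /\
  ((c * (lambda * ln lambda))%:E <= 'E_P[fun w => (nfaces 2 (X w))%:R])%E.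
Proof.
move=> l4 hX; pose L := (Num.truncn lambda).+1.
have l0 : 0 < lambda by lra.
have lL : lambda <= L%:R by rewrite ltW// truncnS_gt.
have Ll : L%:R <= lambda + 1 by rewrite -natr1 lerD2r truncn_le ltW.
have L0 : (0 : R) < L%:R by lra.
pose n := (1000 * L).-1; have nE : n.+1 = (1000 * L)%N by rewrite prednK.
pose m := lambda * mesh R n.+1 ^+ 2.
have m0 : 0 <= m by rewrite mulr_ge0 ?sqr_ge0 ?ltW.
have mE : m * L%:R * 1000 ^+ 2 = 4 * pi ^+ 2 * lambda / L%:R.
  by rewrite /m nE /mesh natrM; field; rewrite gt_eqF.
have p2 := pi_ge2 R; have p4 := pi_le4 R.
have pp : 4 <= (pi : R) ^+ 2 by nra.
have pp' : (pi : R) ^+ 2 <= 16 by nra.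
have m64 : m * L%:R * 1000 ^+ 2 <= 64 by rewrite mE ler_pdivrMr//; nra.
have m8 : 8 <= m * L%:R * 1000 ^+ 2 by rewrite mE ler_pdivlMr//; nra.
have tX w : [set` X w] `<=` @clifford_torus R by have [h _ _ _] := hX; exact: h.
have pE (q : low_index L) := prob_low_event q hX l0 nE m64.
have [_ iE] := integral_event_count P (fun q => (pE q).1).
have S : ((c * (lambda * ln lambda))%:E <=
    \int[P]_w (#|[pred q : low_index L | `[< low_event n q (X w) >]]|%:R : R)%:E)%E.
  rewrite iE; apply: (@le_trans _ _ (\sum_(q : low_index L)
      ((low_ok q)%:R * (m ^+ 3 * expR (- 10)))%:E)%E); last first.
    by apply: lee_sum => q _; exact: (pE q).2.
  rewrite sumEFin lee_fin -mulr_suml.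
  have e10 : 0 <= expR (- 10) :> R by apply: expR_ge0.
  have m3 : 0 <= m ^+ 3 * expR (- 10) by rewrite mulr_ge0 ?exprn_ge0.
  have := ler_wpM2r m3 (sum_low_ok R (ltn0Sn (Num.truncn lambda))).
  rewrite -/L; apply: le_trans.
  (* [15625 = 250 ^ 2 / 4]. Three of the four powers of [L] pair with [m ^ 3], since [m L] is
     bounded below, leaving [L ln L]. *)
  have -> : (250 * L%:R) ^+ 2 * (L%:R ^+ 2 / 4 * ln L.+1%:R) * (m ^+ 3 * expR (- 10)) =
    15625 * (m * L%:R) ^+ 3 * expR (- 10) * (L%:R * ln (L.+1%:R)) by field.
  have K0 : 0 < 1000 ^+ 2 :> R by lra.
  have D0 : 0 <= 15625 :> R by lra.
  rewrite /c; move: m8 K0; move: (1000 ^+ 2) => K /[swap] K0; rewrite -ler_pdivrMr// => h8.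
  move: (15625) D0 => D D0.
  have K8 : 0 <= 8 / K by rewrite divr_ge0// ltW.
  have h83 : (8 / K) ^+ 3 <= (m * L%:R) ^+ 3.
    by rewrite lerXn2r// nnegrE mulr_ge0// ltW.
  have lnl : 0 <= ln lambda by rewrite ln_ge0//; lra.
  have K83 : 0 <= (8 / K) ^+ 3 by apply: exprn_ge0.
  apply: ler_pM.
  - by apply: mulr_ge0 => //; apply: mulr_ge0.
  - by rewrite mulr_ge0// ltW.
  - by rewrite ler_wpM2r// ler_wpM2l.
  - apply: ler_pM => //; first exact: ltW.
    rewrite ler_ln ?posrE ?ltr0n//; apply: (le_trans lL).
    by rewrite ler_nat.
rewrite unlock; split; apply: (le_trans S); apply: le_integral_nonneg => w;
  rewrite lee_fin ?ler0n// ler_nat.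
- exact: (low_count nE (tX w)).1.
- exact: (low_count nE (tX w)).2.
Qed.

(** The upper limit is at most the supremum over [l >= 4], where the two bounds make [F1] finite and
    positive, so that the inverses are those of real numbers. *)
Lemma O_star_bounds (R : realType) (F1 : R -> \bar R) (f : R -> R) (c C : R) :
  0 < c -> 0 < C ->
  (forall l, 4 <= l -> [/\ 0 < f l, ((c * f l)%:E <= F1 l)%E & (F1 l <= (C * f l)%:E)%E]) ->
  O_star F1 (fun l => (f l)%:E).
Proof.
move=> c0 C0 h; apply: (@le_lt_trans _ _ (C + c^-1)%:E); last exact: ltry.
apply: ge_ereal_inf; exists (ereal_sup ((fun l : R =>
  maxe `|F1 l * ((f l)%:E)^-1| `|(f l)%:E * (F1 l)^-1|)%E @` [set l | 4 <= l])).
  exists [set l | 4 <= l] => //; exists 4; split => // x /=; exact: ltW.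
apply: ge_ereal_sup => _ [l /= l4 <-]; have [f0 cF FC] := h l l4.
have Ff : F1 l \is a fin_num.
  by rewrite fin_real// (lt_le_trans (ltNyr _) cF) (le_lt_trans FC (ltry _)).
move: cF FC; rewrite -(fineK Ff) !lee_fin; set e := fine _ => cF FC.
have e0 : 0 < e by apply: lt_le_trans cF; rewrite mulr_gt0.
rewrite !inver !gt_eqF// -!EFinM !abse_EFin -EFin_max lee_fin ge_max.
rewrite !ger0_norm ?divr_ge0 ?(ltW e0) ?(ltW f0)//.
have ci : 0 < c^-1 by rewrite invr_gt0.
apply/andP; split; rewrite ler_pdivrMr// mulrDl.
  by rewrite ler_wpDr// mulr_ge0// ltW.
rewrite ler_wpDl ?mulr_ge0 ?(ltW C0) ?(ltW e0)//.
by rewrite -ler_pdivrMl ?invrK.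
Qed.

Theorem theorem2p2 (R : realType) (d : R -> measure_display)
  (Omega : forall lambda : R, measurableType (d lambda))
  (P : forall lambda : R, probability (Omega lambda) R)
  (X : forall lambda : R, Omega lambda -> {fset 'rV[R]_4})
  (hX : forall lambda : R, 0 < lambda ->
    poisson_point_process (P lambda) lambda (X lambda)) :
  O_star (fun lambda : R => 'E_(P lambda)[fun w => (nfaces 1 (X lambda w))%:R]%E)
         (fun lambda : R => (lambda * ln lambda)%:E) /\
  O_star (fun lambda : R => 'E_(P lambda)[fun w => (nfaces 2 (X lambda w))%:R]%E)
         (fun lambda : R => (lambda * ln lambda)%:E).

Proof.
pose f (l : R) := l * ln l.
have f0 l : 4 <= l -> 0 < f l by move=> l4; rewrite mulr_gt0 ?ln_gt0; lra.
pose c : R := 15625 * (8 / 1000 ^+ 2) ^+ 3 * expR (- 10).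
have c0 : 0 < c.
  apply: mulr_gt0; last exact: expR_gt0.
  by apply: mulr_gt0; [lra|apply: exprn_gt0; apply: divr_gt0; lra].
have C0 : 0 < 2 ^+ 40 :> R by apply: exprn_gt0.
split; apply: (O_star_bounds c0 C0) => l l4; (split; first exact: f0);
  have l0 : 0 < l by [lra|lra].
- exact: (expectation_lower l4 (hX l l0)).1.
- exact: (expectation_upper l4 (hX l l0)).1.
- exact: (expectation_lower l4 (hX l l0)).2.
- exact: (expectation_upper l4 (hX l l0)).2.
Qed.
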